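(* Let $\alpha\in(0,1]$, let $\rho$ be the Mittag-Leffler distribution with parameter $\alpha$, i.e. the probability measure on $[0,\infty)$ with Laplace transform $\hat\rho(\lambda)=1/(1+\lambda^\alpha)$, and let $\mu$ be the Lebesgue measure on $[0,\infty)$. Then the Feller random measure $\xi\sim F(\mu,\rho)$ admits a square-integrable density if and only if $\alpha>1/2$.
   Context: $(f*\kappa)(t)=\int_{[0,t]}f(t-s)\,\kappa(ds)$. $F(\mu,\rho)$ is the law of the locally finite random measure $\xi$ on $[0,\infty)$ uniquely characterized by $\mathbb{E}[e^{(f*\xi)(t)}]=e^{(h[f]*\mu)(t)}$, $t\ge0$, for all continuous $f:[0,\infty)\to\mathbb{R}$ with $f(0)=0$ and $|f|\le1/2$, where $h[f]$ is the unique locally bounded solution of $h=(f+\frac12h^2)*\rho$. (Existence and uniqueness of this law may be taken as known.) A density of $\xi$ is a nonnegative measurable process $\{Y_t\}_{t\ge0}$ such that, almost surely, $\xi(A)=\int_AY_t\,dt$ for all Borel $A\subseteq[0,\infty)$. It is square-integrable if $\mathbb{E}[Y_t^2]<\infty$ for every $t\ge0$. *)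

(* Defs.v *)
From HB Require Import structures.
From mathcomp Require Import all_boot all_order all_algebra.
From mathcomp Require Import all_classical all_reals all_analysis.
Set Implicit Arguments.
Unset Strict Implicit.
Unset Printing Implicit Defensive.
Import Order.TTheory GRing.Theory Num.Theory.
Import numFieldNormedType.Exports.
Local Open Scope classical_set_scope.
Local Open Scope ring_scope.

(* Functions and measures on [0, +oo) are represented by functions and Borel
   measures on R. Only the values of a function on [0, +oo) are ever used, and
   measures are required to give no mass to the negative half-line. *)

Definition nonneg_supported (R : realType)
    (k : {measure set (measurableTypeR R) -> \bar R}) : Prop :=
  k `]-oo, 0[%classic = 0%E.

(* (f * k)(t) = \int_[0, t] f(t - s) k(ds) *)
Definition convolution (R : realType) (f : R -> R)
    (k : {measure set (measurableTypeR R) -> \bar R}) (t : R) : R :=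
  \int[k]_(s in `[0, t]) f (t - s).

Definition lebesgue_nonneg (R : realType) :
    {measure set (measurableTypeR R) -> \bar R} :=
  mrestr (@lebesgue_measure R) (measurable_itv `[0%R, +oo[).

Section random_measures.
Context d (T : measurableType d) (R : realType).

(* A kernel from T to R is a random measure: each xi w is a measure, and
   w |-> xi w A is measurable for every Borel set A. *)
Definition locally_finite_random_measure
    (xi : R.-ker T ~> (measurableTypeR R)) : Prop :=
  forall w, nonneg_supported (xi w) /\
    forall t : R, (xi w `[0%R, t]%classic < +oo)%E.

Definition test_function (f : R -> R) : Prop :=
  [/\ {within `[0, +oo[, continuous f},
      f 0 = 0 &
      forall t, 0 <= t -> `|f t| <= 2^-1].

(* h is a locally bounded solution of h = (f + h^2 / 2) * rho on [0, +oo).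
   For a test function f and a probability measure rho on [0, +oo) such that
   rho {0} = 0, there is exactly one such h up to its values on the negative
   half-line: this is h[f]. *)
Definition riccati_solution
    (rho : {measure set (measurableTypeR R) -> \bar R})
    (f h : R -> R) : Prop :=
  [/\ measurable_fun (`[0, +oo[%classic : set R) h,
      forall t : R, [bounded h s | s in `[0, t]] &
      forall t, 0 <= t -> h t = convolution (fun s => f s + 2^-1 * h s ^+ 2) rho t].

(* xi ~ F(mu, rho) under P: the law F(mu, rho) is identified through the
   exponential functional that characterizes it. *)
Definition feller_random_measure (P : probability T R)
    (mu rho : {measure set (measurableTypeR R) -> \bar R})
    (xi : R.-ker T ~> (measurableTypeR R)) : Prop :=
  locally_finite_random_measure xi /\
  forall f h : R -> R, test_function f -> riccati_solution rho f h ->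
    forall t, 0 <= t ->
      'E_P[fun w => expR (convolution f (xi w) t)]%E = (expR (convolution h mu t))%:E.

(* The process Y is measurable in the usual sense: jointly in time and chance.
   The exceptional null set does not depend on A. *)
Definition density (P : probability T R)
    (xi : R.-ker T ~> (measurableTypeR R)) (Y : R -> T -> R) : Prop :=
  [/\ measurable_fun ((`[0, +oo[%classic : set (measurableTypeR R)) `*` [set: T])
        (fun p => Y p.1 p.2),
      forall t w, 0 <= t -> 0 <= Y t w &
      {ae P, forall w, forall A : set (measurableTypeR R),
        measurable A -> A `<=` `[0, +oo[ ->
        xi w A = (\int[lebesgue_measure]_(t in A) (Y t w)%:E)%E}].

Definition square_integrable (P : probability T R) (Y : R -> T -> R) : Prop :=
  forall t, 0 <= t -> ('E_P[fun w => (Y t w ^+ 2)%R] < +oo)%E.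

End random_measures.

Definition laplace_transform (R : realType)
    (rho : {measure set (measurableTypeR R) -> \bar R}) (l : R) : \bar R :=
  (\int[rho]_(x in `[0%R, +oo[) (expR (- (l * x)))%:E)%E.

Definition mittag_leffler (R : realType) (alpha : R)
    (rho : probability (measurableTypeR R) R) : Prop :=
  nonneg_supported rho /\
  forall l : R, 0 <= l ->
    laplace_transform rho l = ((1 + l `^ alpha)^-1)%:E.

(* Main.v *)
Require Import Defs.
From HB Require Import structures.
From mathcomp Require Import all_boot all_order all_algebra.
From mathcomp Require Import all_classical all_reals all_analysis.
From mathcomp Require Import measurable_realfun.
From mathcomp Require Import ring lra.

(** The Mittag-Leffler law [rho] behaves near the origin like the measure of density
    [k u = u ^ (a - 1) / Gamma a], the kernel of fractional integration: the Laplace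
    transforms [1 / (1 + l ^ a)] of [rho] and [l ^ (- a)] of [k] give the
    resolvent equation [rho + k * rho = k] ([mittag_leffler_resolvent]), whence
    [rho <= k], and [rho >= k / 2] on a neighbourhood of [0]. The condition
    [a > 1 / 2] says that [k] is locally square integrable.

    This enters through the second moments of [xi]. Let [f] be continuous with
    values in [[0, 1 / 2]] and [f 0 = 0], and put [X = (f * xi)(t)],
    [q = f * rho]. Inserting [- theta f] in the exponential functional that
    characterizes [xi], and expanding the Riccati solution to second order in
    [theta], gives [v <= E (X ^ 2) <= m ^ 2 + v] ([second_moment_ge],
    [second_moment_le]), where [m] is the integral of [q] over [[0, t]] and
    [v = (q ^ 2 * rho * mu)(t)] lies between constant multiples of integrals of
    [q ^ 2] ([iterated_convolution_le], [iterated_convolution_ge]).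

    If [a > 1 / 2], taking for [f] a trapezoid concentrated on an interval [I]
    yields [E (xi I ^ 2) = O (|I| ^ 2)] ([cell_second_moment]). Hence the averages
    of [xi] over a grid of cells of length [1 / (n + 1)] are bounded in [L ^ 2].
    By Fatou's lemma, almost every path has locally finite energy, that is, the
    limit inferior of the local [L ^ 2] norms of its averages is finite. This
    forces the path to be absolutely continuous, and by Lebesgue differentiation
    its density is the limit of the averages ([cell_density]). Their limit
    inferior [lower_density] is jointly measurable and, again by Fatou's lemma,
    square integrable.

    If [a <= 1 / 2] and [xi] had a square-integrable density, then on some set of
    times of positive measure the second moment of the density would be at most a
    constant [N], so [E (xi A ^ 2) <= N * |A| ^ 2] for every compact subset [A].
    The lower bound for [E (X ^ 2)], with [f] decreasing to half the indicator
    function of a reflection of [A], gives on the other hand that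
    [E (xi A ^ 2)] is at least a constant times [|A| ^ 2 * ln (1 / delta)] when
    [A] lies in an interval of length [delta] ([compact_second_moment_ln]),
    because a translate of [A] at distance [y] from the origin has [rho]-measure
    of order at least [|A| * (y + delta) ^ (- 1 / 2)]. Letting [delta] tend to
    [0] is contradictory ([density_gt_half]). *)

Import Order.TTheory GRing.Theory Num.Theory.
Import numFieldNormedType.Exports.
Local Open Scope classical_set_scope.
Local Open Scope ring_scope.

Set Implicit Arguments.
Unset Strict Implicit.
Unset Printing Implicit Defensive.

(** * Measures and integrals *)

Section weighted_measure.
Context d (T : measurableType d) (R : realType).
Variables (mu : {measure set T -> \bar R}) (g : T -> \bar R).
Hypotheses (mg : measurable_fun setT g) (g0 : forall x, (0 <= g x)%E).
Local Open Scope ereal_scope.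

(** The hypotheses on [g] are arguments so that the measure structure below can
    be inferred from the term alone. *)
Definition weighted (_ : measurable_fun setT g) (_ : forall x, 0 <= g x)
  (A : set T) := \int[mu]_(x in A) g x.

Local Notation nu := (weighted mg g0).

Let nu0 : nu set0 = 0.
Proof. by rewrite /weighted integral_set0. Qed.

Let nu_ge0 A : 0 <= nu A.
Proof. exact: integral_ge0. Qed.

Let nu_sigma_additive : semi_sigma_additive nu.
Proof.
move=> /= F mF tF mUF; rewrite /weighted; apply: cvg_toP.
  apply: ereal_nondecreasing_is_cvgn => m n mn.
  by apply: lee_sum_nneg_natr => // k _ _; exact: integral_ge0.
by rewrite ge0_integral_bigcup//=; exact: measurable_funTS.
Qed.

HB.instance Definition _ := isMeasure.Build _ _ _ nu
  nu0 nu_ge0 nu_sigma_additive.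

Import HBNNSimple.

Lemma integral_weighted (f : T -> \bar R) :
  measurable_fun setT f -> (forall x, 0 <= f x) ->
  \int[nu]_x f x = \int[mu]_x (f x * g x).
Proof.
move=> mf f0; pose h := nnsfun_approx measurableT mf.
have mh n : measurable_fun setT (EFin \o h n).
  exact/measurable_EFinP.
transitivity (limn (fun n => \int[nu]_x (EFin \o h n) x)).
  rewrite -monotone_convergence//; last 2 first.
    - by move=> n x _; rewrite lee_fin.
    - by move=> x _ a b ab; rewrite lee_fin; exact/lefP/nd_nnsfun_approx.
  by apply: eq_integral => x _; apply/esym/cvg_lim => //; exact: cvg_nnsfun_approx.
transitivity (limn (fun n => \int[mu]_x ((EFin \o h n) x * g x))); last first.
  rewrite -monotone_convergence//; last 3 first.
    - by move=> n; exact: emeasurable_funM.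
    - by move=> n x _; rewrite mule_ge0// lee_fin.
    - move=> x _ a b ab; rewrite lee_wpmul2r// lee_fin.
      exact/lefP/nd_nnsfun_approx.
  apply: eq_integral => x _; apply/cvg_lim => //.
  have hx := @cvg_nnsfun_approx _ _ _ _ measurableT _ mf (fun x _ => f0 x) x I.
  have [fx0|fx0] := eqVneq (f x) 0.
    rewrite fx0 mul0e; under eq_fun => n.
      have -> : (EFin \o h n) x = 0.
        apply/eqP; rewrite eq_le; apply/andP; split; last by rewrite /= lee_fin.
        by rewrite -fx0 /= nnsfun_approxE; apply: le_approx.
      rewrite mul0e; over.
    exact: cvg_cst.
  have [gx0|gx0] := eqVneq (g x) 0.
    by rewrite gx0 mule0; under eq_fun do rewrite mule0; exact: cvg_cst.
  apply: cvgeM => //; last exact: cvg_cst.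
  by rewrite mule_defE (negbTE fx0) (negbTE gx0).
congr (limn _); apply/funext => n.
have -> : \int[nu]_x (EFin \o h n) x =
    \sum_(y \in range (h n)) y%:E * nu (h n @^-1` [set y]).
  by rewrite integralT_nnsfun sintegralE.
transitivity (\int[mu]_x
    (\sum_(y \in range (h n)) (y%:E * (\1_(h n @^-1` [set y]) x)%:E * g x))).
  rewrite ge0_integral_fsum//; last 2 first.
  - by move=> y; apply: emeasurable_funM => //; apply: emeasurable_funM => //;
      apply/measurable_EFinP.
  - move=> y x _; rewrite mule_ge0// -EFinM.
    exact: nnfun_muleindic_ge0.
  apply: eq_fsbigr => y /[!inE] -[x _ <-{y}].
  under eq_integral do rewrite -muleA.
  rewrite ge0_integralZl//; last 3 first.
  - by apply: emeasurable_funM => //; exact/measurable_EFinP.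
  - by move=> z _; rewrite mule_ge0// lee_fin.
  - by rewrite lee_fin.
  rewrite /weighted integral_mkcond; congr (_ * _).
  apply: eq_integral => z _; rewrite patchE indicE.
  by case: ifPn => _; rewrite ?mul1e ?mul0e.
apply: eq_integral => x _.
rewrite /= fimfunE -fsumEFin// ge0_mule_fsuml//.
by move=> y; rewrite ?EFinM nnfun_muleindic_ge0.
Qed.

Lemma integral_weighted_patch (D : set T) (f : T -> \bar R) : measurable D ->
  measurable_fun setT f -> (forall x, 0 <= f x) ->
  \int[nu]_(x in D) f x = \int[mu]_(x in D) (f x * g x).
Proof.
move=> mD mf f0; rewrite [LHS]integral_mkcond integral_weighted; first last.
- by move=> x; apply: erestrict_ge0.
- by apply/(measurable_restrictT _ _).1 => //; exact: measurable_funTS.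
rewrite [RHS]integral_mkcond; apply: eq_integral => x _.
by rewrite !patchE; case: ifPn => // _; rewrite mul0e.
Qed.

End weighted_measure.

Section affine_change_of_variables.
Context (R : realType).
Local Notation leb := (@lebesgue_measure R).

Let affine (a b x : R) : measurableTypeR R := a * x + b.

Lemma measurable_affine (a b : R) : measurable_fun [set: measurableTypeR R] (affine a b).
Proof. by apply: measurable_funD => //; exact: measurable_funM. Qed.

Lemma lebesgue_measure_affine (a b : R) (A : set R) : a != 0 -> measurable A ->
  leb A = (`|a|%:E * leb ((fun x => (a * x + b)%R) @^-1` A))%E.
Proof.
move=> a0 mA.
have na0 : 0 <= `|a| by [].
pose nu_ : {measure set (measurableTypeR R) -> \bar R} :=
  mscale (NngNum na0) (pushforward leb (affine a b)).
pose nu := nu_ (measurable_affine a b).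
rewrite (lebesgue_measure_unique (mu := nu)) => // X [[p q] _ <-{X}].
rewrite /nu /nu_/= /mscale/= /pushforward lebesgue_measure_itv/= lte_fin.
have [agt0|alt0|a00] := ltgtP 0 a; last by rewrite -a00 eqxx in a0.
- rewrite [X in leb X](_ : _ = `]((p - b) / a), ((q - b) / a)]%classic); last first.
    apply/seteqP; split=> x /=; rewrite !in_itv/= /affine ltr_pdivrMr// ler_pdivlMr//;
    by rewrite ltrBlDr lerBrDr mulrC.
  rewrite lebesgue_measure_itv/= lte_fin ltr_pM2r ?invr_gt0// ltrD2r gtr0_norm//.
  case: ifPn => _; last by rewrite mule0.
  by rewrite -!EFinB -EFinM -mulrBl mulrCA divff// mulr1; congr _%:E; ring.
- rewrite [X in leb X](_ : _ = `[((q - b) / a), ((p - b) / a)[%classic); last first.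
    apply/seteqP; split=> x /=; rewrite !in_itv/= /affine ltr_ndivlMr// ler_ndivrMr//;
    by rewrite ltrBlDr lerBrDr mulrC andbC.
  rewrite lebesgue_measure_itv/= lte_fin ltr_nM2r ?invr_lt0// ltrD2r ltr0_norm//.
  case: ifPn => _; last by rewrite mule0.
  by rewrite -!EFinB -EFinM -mulrBl mulrCA mulNr divff//; congr _%:E; ring.
Qed.

Lemma integral_affine (a b : R) (f : R -> \bar R) : a != 0 ->
  measurable_fun [set: R] f -> (forall x, (0 <= f x)%E) ->
  (\int[leb]_x f x = `|a|%:E * \int[leb]_x f (a * x + b)%R)%E.
Proof.
move=> a0 mf f0.
have na0 : 0 <= `|a| by [].
pose nu_ : {measure set (measurableTypeR R) -> \bar R} :=
  mscale (NngNum na0) (pushforward leb (affine a b)).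
pose nu := nu_ (measurable_affine a b).
rewrite (eq_measure_integral nu); last first.
  by move=> A mA _; exact: (lebesgue_measure_affine b a0 mA).
rewrite ge0_integral_mscale//.
rewrite ge0_integral_pushforward//.
exact: measurable_affine.
Qed.

Lemma integral_reflect (b : R) (f : R -> \bar R) :
  measurable_fun [set: R] f -> (forall x, (0 <= f x)%E) ->
  (\int[leb]_x f (b - x)%R = \int[leb]_x f x)%E.
Proof.
move=> mf f0; rewrite [RHS](@integral_affine (-1) b)// ?oppr_eq0//.
rewrite normrN1 mul1e; apply: eq_integral => x _.
by rewrite mulN1r addrC.
Qed.

Lemma integral_shift (b : R) (f : R -> \bar R) :
  measurable_fun [set: R] f -> (forall x, (0 <= f x)%E) ->
  (\int[leb]_x f (x - b)%R = \int[leb]_x f x)%E.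
Proof.
move=> mf f0; rewrite [RHS](@integral_affine 1 (- b))// ?oner_eq0//.
by rewrite normr1 mul1e; apply: eq_integral => x _; rewrite mul1r.
Qed.

End affine_change_of_variables.

Lemma cauchy_schwarz_integral d (T : measurableType d) (R : realType)
    (mu : {measure set T -> \bar R}) (D : set T) (h : T -> R) :
  measurable D -> (mu D < +oo)%E -> measurable_fun D h ->
  (forall x, D x -> 0 <= h x) ->
  ((\int[mu]_(x in D) (h x)%:E) * (\int[mu]_(x in D) (h x)%:E) <=
   mu D * \int[mu]_(x in D) (h x ^+ 2)%:E)%E.
Proof.
move=> mD muD mh h0.
have mh2 : measurable_fun D (fun x => (h x ^+ 2)%:E).
  by apply/measurable_EFinP; exact: measurable_funX.
have mEh : measurable_fun D (fun x => (h x)%:E) by exact/measurable_EFinP.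
have I0 : (0 <= \int[mu]_(x in D) (h x)%:E)%E.
  by apply: integral_ge0 => x Dx; rewrite lee_fin h0.
have J0 : (0 <= \int[mu]_(x in D) (h x ^+ 2)%:E)%E.
  by apply: integral_ge0 => x Dx; rewrite lee_fin sqr_ge0.
have [D0|Dn0] := eqVneq (mu D) 0%E.
  by rewrite D0 mul0e null_set_integral ?mule0//; exact: subset_measure0 D0.
have D_gt0 : (0 < mu D)%E by rewrite lt_neqAle eq_sym Dn0/=.
have [Jy|Jy] := eqVneq (\int[mu]_(x in D) (h x ^+ 2)%:E)%E +oo%E.
  by rewrite Jy gt0_muley// leey.
have Jfin : (\int[mu]_(x in D) (h x ^+ 2)%:E)%E \is a fin_num.
  by rewrite ge0_fin_numE// ltey.
have Dfin : mu D \is a fin_num by rewrite ge0_fin_numE.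
have Ifin : (\int[mu]_(x in D) (h x)%:E)%E \is a fin_num.
  rewrite ge0_fin_numE//.
  apply: (@le_lt_trans _ _ (\int[mu]_(x in D) ((1 : R)%:E + (h x ^+ 2)%:E))%E).
    apply: ge0_le_integral => //.
    - exact: emeasurable_funD.
    - by move=> x Dx; rewrite -EFinD lee_fin; have := h0 x Dx; nra.
  rewrite ge0_integralD//; last by move=> x Dx; rewrite lee_fin sqr_ge0.
  by rewrite integral_cst// mul1e lte_add_pinfty// ltey.
have Dr0 : 0 < fine (mu D) by rewrite fine_gt0// D_gt0.
pose c := fine (\int[mu]_(x in D) (h x)%:E)%E / fine (mu D).
have c0 : 0 <= c by rewrite divr_ge0// fine_ge0.
have : (\int[mu]_(x in D) ((2 * c)%:E * (h x)%:E) <=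
        \int[mu]_(x in D) ((c ^+ 2)%:E + (h x ^+ 2)%:E))%E.
  apply: ge0_le_integral => //.
  - by move=> x Dx; apply: mule_ge0; rewrite lee_fin; [exact: mulr_ge0|exact: h0].
  - exact: emeasurable_funM.
  - exact: emeasurable_funD.
  - by move=> x Dx; rewrite -EFinD -EFinM lee_fin; have := sqr_ge0 (c - h x); nra.
rewrite ge0_integralZl//; last first.
- by rewrite lee_fin mulr_ge0.
rewrite ge0_integralD//; first last.
- by move=> x Dx; rewrite lee_fin sqr_ge0.
- by move=> x Dx; rewrite lee_fin sqr_ge0.
rewrite integral_cst// -(fineK Ifin) -(fineK Jfin) -(fineK Dfin) -!EFinM -EFinD !lee_fin.
rewrite /c; set i := fine (\int[mu]_(x in D) (h x)%:E)%E; set m := fine (mu D); set j := fine _.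
rewrite -/m in Dr0 => H.
have {}H : 2 * (i / m) * i <= i * i / m + j.
  by apply: le_trans H _; rewrite lerD2r le_eqVlt; apply/orP; left; apply/eqP; field; rewrite gt_eqF.
have e1 : 2 * (i / m) * i = 2 * (i * i / m) by ring.
have : i * i / m <= j by lra.
by rewrite ler_pdivrMr// [j * m]mulrC.
Qed.

Lemma countable_cover_gt0 d (T : measurableType d) (R : realType)
    (mu : {measure set T -> \bar R}) (B : set T) (F : nat -> set T) :
  measurable B -> (forall n, measurable (F n)) -> B `<=` \bigcup_n F n -> (0 < mu B)%E ->
  exists n, (0 < mu (B `&` F n))%E.
Proof.
move=> mB mF BF B_gt0; apply: contrapT => h; move: B_gt0; apply/negP; rewrite -leNgt.
have BFE : B = \bigcup_n (B `&` F n) by rewrite -setI_bigcupr; apply/esym/setIidPl.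
have neg n : mu.-negligible (B `&` F n).
  have mBF : measurable (B `&` F n) by exact: measurableI.
  apply/(negligibleP mu mBF)/eqP.
  by rewrite -measure_le0 leNgt; apply/negP => BFn; apply: h; exists n.
have := negligible_bigcup neg; rewrite -BFE => /(negligibleP mu mB) ->.
exact: lexx.
Qed.

(** * Limits and inferior limits *)

Lemma squeeze_harmonic (R : realType) (K l : R) (u : nat -> R) :
  (forall n, `|u n - l| <= K * harmonic n) -> u n @[n --> \oo] --> l.
Proof.
move=> uK; have Kh : K * harmonic n @[n --> \oo] --> 0.
  by rewrite -(mulr0 K); apply: cvgMr; exact: cvg_harmonic.
apply: (@squeeze_cvgr _ _ _ _ (fun n => l - K * harmonic n)
  (fun n => l + K * harmonic n)).
- apply: nearW => n; have := uK n; rewrite ler_norml => /andP[u1 u2].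
  by apply/andP; split; lra.
- by rewrite -[X in _ --> X]subr0; apply: cvgB => //; exact: cvg_cst.
- by rewrite -[X in _ --> X]addr0; apply: cvgD => //; exact: cvg_cst.
Qed.

Lemma lee_limn_einf (R : realType) (u v : nat -> \bar R) :
  (forall n, u n <= v n)%E -> (limn_einf u <= limn_einf v)%E.
Proof.
move=> uv; rewrite !limn_einf_lim; apply: lee_lim; [exact: is_cvg_einfs|exact: is_cvg_einfs|].
apply: nearW => n; apply: le_ereal_inf_tmp => _ [k /= nk <-].
by apply: ge_ereal_inf; exists (u k) => //; exists k.
Qed.

Lemma limn_einf_ge0 (R : realType) (u : nat -> \bar R) :
  (forall n, 0 <= u n)%E -> (0 <= limn_einf u)%E.
Proof.
move=> u0; have c : (fun=> 0 : \bar R)%E n @[n --> \oo] --> (0 : \bar R)%E by exact: cvg_cst.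
by rewrite -(cvg_limn_einf_sup c).1; exact: lee_limn_einf.
Qed.

Section limn_einf_frequently.
Context (R : realType).
Implicit Types (u : nat -> \bar R) (c : \bar R).

Lemma limn_einf_le_frequently u c :
  (forall m, exists2 n, (m <= n)%N & (u n <= c)%E) -> (limn_einf u <= c)%E.
Proof.
move=> uc; rewrite limn_einf_lim; apply: lime_le; first exact: is_cvg_einfs.
apply: nearW => m; have [n mn unc] := uc m.
by apply: ge_ereal_inf; exists (u n) => //; exists n.
Qed.

Lemma limn_einf_lt_frequently u c : (limn_einf u < c)%E ->
  forall m, exists2 n, (m <= n)%N & (u n < c)%E.
Proof.
move=> uc m; apply: contrapT => h; move: uc; apply/negP; rewrite -leNgt.
rewrite limn_einf_lim; apply: lime_ge; first exact: is_cvg_einfs.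
exists m => // n /= mn; apply: le_ereal_inf_tmp => _ [k /= nk <-].
by rewrite leNgt; apply/negP => ukc; apply: h; exists k => //; exact: leq_trans nk.
Qed.

End limn_einf_frequently.

Lemma measurable_fun_limn_einf d (T : measurableType d) (R : realType)
    (D : set T) (f : nat -> T -> \bar R) : (forall n, measurable_fun D (f n)) ->
  measurable_fun D (fun x => limn_einf (f^~ x)).
Proof.
move=> mf; rewrite (_ : (fun x => _) = (fun x => - limn_esup (fun n => - f n x))%E); last first.
  by apply/funext => x; rewrite -[RHS]oppeK -limn_einfN -[LHS]oppeK; congr (- - limn_einf _)%E;
    apply/funext => n /=; rewrite oppeK.
apply: measurableT_comp => //.
by apply: measurable_fun_limn_esup => n; exact: measurableT_comp.
Qed.

(** Squaring commutes with the limit inferior of a nonnegative sequence; the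
    inequality is strict when that limit is infinite, as [fine] then is null. *)
Lemma sqr_fine_limn_einf (R : realType) (u : nat -> R) : (forall n, 0 <= u n) ->
  ((fine (limn_einf (fun n => (u n)%:E)) ^+ 2)%:E <= limn_einf (fun n => (u n ^+ 2)%:E))%E.
Proof.
move=> u0; have L0 : (0 <= limn_einf (fun n => (u n)%:E))%E.
  by apply: limn_einf_ge0 => n; rewrite lee_fin.
have S0 : (0 <= limn_einf (fun n => (u n ^+ 2)%:E))%E.
  by apply: limn_einf_ge0 => n; rewrite lee_fin sqr_ge0.
move: L0; case L : (limn_einf (fun n => (u n)%:E)) => [l| |] L0; last 2 first.
- by rewrite /= expr0n.
- by rewrite /= expr0n.
rewrite leNgt; apply/negP => Sl; rewrite lee_fin in L0.
have [s sE] : exists s, limn_einf (fun n => (u n ^+ 2)%:E) = s%:E.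
  exists (fine (limn_einf (fun n => (u n ^+ 2)%:E))); rewrite fineK// ge0_fin_numE//.
  by apply: (lt_trans Sl); rewrite ltry.
rewrite sE lee_fin in S0; rewrite sE lte_fin/= in Sl.
pose c := (s + l ^+ 2) / 2.
have sc : s < c by rewrite /c; lra.
have cl : c < l ^+ 2 by rewrite /c; lra.
have c0 : 0 <= c by rewrite (le_trans S0)// ltW.
have : (limn_einf (fun n => (u n)%:E) <= (Num.sqrt c)%:E)%E.
  apply: limn_einf_le_frequently => k.
  have [n kn] : exists2 n, (k <= n)%N & ((u n ^+ 2)%:E < c%:E)%E.
    by apply: (limn_einf_lt_frequently (u := fun n => (u n ^+ 2)%:E)); rewrite sE lte_fin.
  rewrite lte_fin => unc; exists n => //; rewrite lee_fin.
  by rewrite -(@ler_pXn2r _ 2)// ?nnegrE ?sqrtr_ge0// sqr_sqrtr// ltW.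
rewrite L lee_fin => lc; have : l ^+ 2 <= Num.sqrt c ^+ 2 by rewrite ler_pXn2r// ?nnegrE ?sqrtr_ge0.
by rewrite sqr_sqrtr// leNgt cl.
Qed.

(** * Uniqueness of Laplace transforms *)

Lemma expR_ge_sqr (R : realType) (x : R) : 0 <= x -> x ^+ 2 / 4 <= expR x.
Proof.
move=> x0; have -> : expR x = expR (x / 2) ^+ 2 by rewrite -expRM_natl; congr expR; field.
have -> : x ^+ 2 / 4 = (x / 2) ^+ 2 by field.
by rewrite lerXn2r ?nnegrE ?expR_ge0 ?divr_ge0// (le_trans _ (expR_ge1Dx _))// lerDr.
Qed.

Section laplace_uniqueness.
Context (R : realType).
Implicit Types (m : {measure set (measurableTypeR R) -> \bar R}) (x z : R).
Local Notation D := (`[0, +oo[%classic : set R).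
Local Notation e n x := (expR (- (n%:R * x))).

Let F (k n N : nat) x : R := e k x * (1 - e n x) ^+ N.

Let e_itv (n : nat) x : D x -> 0 <= 1 - e n x <= 1.
Proof.
rewrite /= in_itv/= andbT => x0.
rewrite subr_ge0 -[leRHS]expR0 ler_expR oppr_le0 mulr_ge0//= lerBlDr lerDl expR_ge0.
Qed.

Let mF k n N : measurable_fun D (F k n N).
Proof.
apply: measurable_funM => //.
  by apply: measurableT_comp => //; apply: measurable_funN; exact: measurable_funM.
apply: measurable_funX; apply: measurable_funB => //.
by apply: measurableT_comp => //; apply: measurable_funN; exact: measurable_funM.
Qed.

Let F_itv k n N x : D x -> 0 <= F k n N x <= e k x.
Proof.
move=> /e_itv - /(_ n) /andP[e0 e1].
by rewrite mulr_ge0 ?expR_ge0 ?exprn_ge0//= ler_piMr ?expR_ge0// exprn_ile1.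
Qed.

Let iF m k n N : (\int[m]_(x in D) (e k x)%:E < +oo)%E ->
  m.-integrable D (EFin \o F k n N).
Proof.
move=> mfin; apply/integrableP; split; first by apply/measurable_EFinP; exact: mF.
apply: le_lt_trans mfin; apply: ge0_le_integral => //.
- by apply: measurableT_comp => //; by apply/measurable_EFinP; exact: mF.
- apply/measurable_EFinP; apply: measurableT_comp => //.
  by apply: measurable_funN; exact: measurable_funM.
- move=> x /F_itv - /(_ k n N) /andP[F0 F1].
  by rewrite /= lee_fin ger0_norm.
Qed.

Let eF m1 m2 :
  (forall n, \int[m1]_(x in D) (e n.+1 x)%:E < +oo)%E ->
  (forall n, \int[m1]_(x in D) (e n.+1 x)%:E =
             \int[m2]_(x in D) (e n.+1 x)%:E)%E ->
  forall k n N, (\int[m1]_(x in D) (F k.+1 n N x)%:E =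
                 \int[m2]_(x in D) (F k.+1 n N x)%:E)%E.
Proof.
move=> fin eq12 k n N; elim: N k => [k|N IH k].
  by under eq_integral do rewrite /F expr0 mulr1;
    under [RHS]eq_integral do rewrite /F expr0 mulr1; exact: eq12.
have FS x : F k.+1 n N.+1 x = F k.+1 n N x - F (k + n).+1 n N x.
  rewrite /F exprS mulrA mulrBr mulr1 mulrBl -expRD; congr (_ - expR _ * _).
  by rewrite -opprD -mulrDl -natrD addSn.
under eq_integral do rewrite FS.
under [RHS]eq_integral do rewrite FS.
rewrite !integralB_EFin//; last 4 first.
- by apply: iF; rewrite -eq12; exact: fin.
- by apply: iF; rewrite -eq12; exact: fin.
- by apply: iF; exact: fin.
- by apply: iF; exact: fin.
by rewrite !IH.
Qed.

(** For [z >= 0] and [N] of order [n * exp (n z)], the polynomial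
    [1 - (1 - exp (- n x)) ^ N] in [exp (- x)] tends to the indicator function
    of [x <= z]. *)
Let G (n N : nat) x : R := 1 - (1 - e n x) ^+ N.

Let GE n N x : G n N x = \sum_(j < N) F n n j x.
Proof.
rewrite /G -[LHS]opprK opprB subrX1 -mulNr opprB subKr mulr_sumr.
by apply: eq_bigr => i _.
Qed.

Let eG m1 m2 :
  (forall n, \int[m1]_(x in D) (e n.+1 x)%:E < +oo)%E ->
  (forall n, \int[m1]_(x in D) (e n.+1 x)%:E =
             \int[m2]_(x in D) (e n.+1 x)%:E)%E ->
  forall n N, (\int[m1]_(x in D) (G n.+1 N x)%:E =
                 \int[m2]_(x in D) (G n.+1 N x)%:E)%E.
Proof.
move=> fin eq12 n N.
have H m : (\int[m]_(x in D) (G n.+1 N x)%:E =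
    \sum_(j < N) \int[m]_(x in D) (F n.+1 n.+1 j x)%:E)%E.
  under eq_integral do rewrite GE -sumEFin.
  rewrite ge0_integral_sum//.
  - by move=> j; apply/measurable_EFinP; exact: mF.
  - by move=> j x /F_itv - /(_ n.+1 n.+1 j) /andP[]; rewrite lee_fin.
rewrite !H; apply: eq_bigr => j _; exact: eF.
Qed.

Let rank (z : R) n : nat := (Num.trunc (n.+1%:R * expR (n.+1%:R * z))).+1.

Let rank_itv z n : 0 <= z ->
  n.+1%:R * expR (n.+1%:R * z) <= (rank z n)%:R <= 2 * (n.+1%:R * expR (n.+1%:R * z)).
Proof.
move=> z0; set y := _ * expR _.
have y1 : 1 <= y.
  rewrite -[1]mulr1 ler_pM ?ler1n// -[leLHS]expR0 ler_expR mulr_ge0//.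
have /andP[y2 y3] := truncn_itv (le_trans ler01 y1).
rewrite /rank -/y (ltW y3)/= -[(_.+1)%:R]natr1; lra.
Qed.

Let g z n x := G n.+1 (rank z n) x.

Let g_itv z n x : D x -> 0 <= g z n x <= 1.
Proof.
move=> /e_itv - /(_ n.+1) /andP[e0 e1]; rewrite /g /G.
by rewrite subr_ge0 exprn_ile1//= lerBlDr lerDl exprn_ge0.
Qed.

Let g_below z n x : D x -> 0 <= z -> x <= z -> `|g z n x - 1| <= harmonic n.
Proof.
move=> Dx z0 xz; have /andP[e0 e1] := e_itv n.+1 Dx.
rewrite /g /G addrAC subrr add0r normrN ger0_norm ?exprn_ge0//.
have -> : harmonic n = (n.+1%:R : R)^-1 by [].
have e1D : 1 - e n.+1 x <= expR (- e n.+1 x) by exact: expR_ge1Dx.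
apply: (@le_trans _ _ (expR (- e n.+1 x) ^+ rank z n)).
  by rewrite lerXn2r// ?nnegrE ?expR_ge0.
rewrite -expRM_natl -[leRHS]invrK -lef_pV2 ?posrE ?expR_gt0 ?invr_gt0// ?invrK.
rewrite -expRN mulrN opprK.
have /andP[r1 _] := rank_itv n z0.
apply: (@le_trans _ _ ((rank z n)%:R * e n.+1 x)); last first.
  by rewrite (le_trans _ (expR_ge1Dx _))// lerDr.
apply: (@le_trans _ _ (n.+1%:R * expR (n.+1%:R * z) * e n.+1 x)).
  rewrite -mulrA -expRD ler_peMr// -[leLHS]expR0 ler_expR -mulrBr.
  by rewrite mulr_ge0// subr_ge0.
by rewrite ler_wpM2r// expR_ge0.
Qed.

Let g_above z n x : D x -> 0 <= z ->
  g z n x <= 2 * (n.+1%:R * expR (- (n.+1%:R * (x - z)))).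
Proof.
move=> Dx z0; rewrite /g GE.
apply: (@le_trans _ _ (\sum_(j < rank z n) e n.+1 x)).
  by apply: ler_sum => j _; have /andP[] := F_itv n.+1 n.+1 j Dx.
rewrite sumr_const card_ord -[leLHS]mulr_natl.
have /andP[_ r2] := rank_itv n z0.
rewrite (le_trans (ler_wpM2r (expR_ge0 _) r2))// -!mulrA -expRD.
by rewrite mulrBr opprB.
Qed.

Let g_cvg z x : D x -> 0 <= z -> g z n x @[n --> \oo] --> ((x <= z)%R%:R : R).
Proof.
move=> Dx z0; have [xz|xz] := leP x z.
  by apply: (@squeeze_harmonic _ 1) => n; rewrite mul1r; exact: g_below.
have d0 : 0 < x - z by rewrite subr_gt0.
apply: (@squeeze_harmonic _ (8 / (x - z) ^+ 2)) => n.
have /andP[g0 _] := g_itv z n Dx.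
rewrite subr0 ger0_norm//; apply: (le_trans (g_above n Dx z0)).
set M := n.+1%:R; have M0 : 0 < M by exact: ltr0Sn.
have /expR_ge_sqr := ltW (mulr_gt0 M0 d0).
set E := expR _ => E1; have E0 : 0 < E by exact: expR_gt0.
rewrite expRN -/E mulrA ler_pdivrMr//.
apply: le_trans (ler_wpM2l _ E1); last first.
  by rewrite mulr_ge0 ?invr_ge0// divr_ge0// sqr_ge0.
rewrite le_eqVlt; apply/orP; left; apply/eqP.
have -> : harmonic n = M^-1 by [].
by field; rewrite !gt_eqF.
Qed.

(** A domination independent of [n]: up to [z + 1] the bound [1] is enough, and
    beyond it the exponential decay of [g_above] absorbs the factor [n + 1]. *)
Let g_dominated z n x : D x -> 0 <= z -> g z n x <= 2 * expR (z + 1) * e 1 x.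
Proof.
move=> Dx z0; rewrite mul1r -mulrA -expRD.
have [xz|xz] := leP x (z + 1).
  have /andP[_ g1] := g_itv z n Dx; rewrite (le_trans g1)//.
  have : 1 <= expR (z + 1 - x) by rewrite -[leLHS]expR0 ler_expR subr_ge0.
  by lra.
rewrite (le_trans (g_above n Dx z0))// ler_pM2l//.
set u := x - z; have u1 : 1 <= u by rewrite /u lerBrDl ltW.
have -> : z + 1 - x = 1 - u by rewrite /u; ring.
apply: (@le_trans _ _ (expR n%:R * expR (- (n.+1%:R * u)))).
  rewrite ler_wpM2r ?expR_ge0// -natr1 addrC; exact: expR_ge1Dx.
rewrite -expRD ler_expR -natr1 mulrDl mul1r.
have : n%:R <= n%:R * u by rewrite ler_peMr.
by lra.
Qed.

Let integral_g_cvg m z : 0 <= z ->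
  (\int[m]_(x in D) (e 1 x)%:E < +oo)%E ->
  (m `[0%R, z]%classic < +oo)%E /\
  (\int[m]_(x in D) (g z n x)%:E @[n --> \oo] --> m `[0%R, z]%classic)%E.
Proof.
move=> z0 mfin.
have me : measurable_fun D (fun x => e 1 x).
  by apply: measurableT_comp => //; apply: measurable_funN; exact: measurable_funM.
have -> : m `[0, z]%classic = (\int[m]_(x in D) ((x <= z)%R%:R : R)%:E)%E.
  have -> : `[0, z]%classic = `]-oo, z]%classic `&` D.
    by apply/seteqP; split=> x/=; rewrite !in_itv/= andbT; [move=> /andP[-> ->]|move=> [-> ->]].
  rewrite -integral_indic//; apply: eq_integral => x _.
  rewrite indicE; congr (_%:R%:E); apply: congr1.
  by apply/idP/idP; rewrite inE/= in_itv.
have [] := @dominated_convergence _ _ _ m D _ (fun n x => (g z n x)%:E)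
  (fun x => ((x <= z)%R%:R : R)%:E) (fun x => (2 * expR (z + 1) * e 1 x)%:E) => //; last first.
  move=> ifi _ cv; split; [exact: integrable_lty ifi|exact: cv].
- apply: aeW => x n Dx; rewrite lee_fin.
  have /andP[g0 _] := g_itv z n Dx.
  by rewrite ger0_norm// g_dominated.
- apply: (@integrableZl _ _ _ m D _ (2 * expR (z + 1)) (fun x => (e 1 x)%:E)) => //.
  apply/integrableP; split; first exact/measurable_EFinP.
  by under eq_integral do rewrite gee0_abs ?lee_fin ?expR_ge0//.
- by apply: aeW => x Dx; apply: cvg_EFin; [exact: nearW|exact: g_cvg].
- apply/measurable_EFinP.
  rewrite (_ : (fun x => _) = \1_(`]-oo, z]%classic)).
    exact: measurable_indic.
  apply/funext => x; rewrite indicE; congr (_%:R); apply: congr1.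
  by apply/idP/idP; rewrite inE/= in_itv.
- move=> n; apply/measurable_EFinP; apply: measurable_funB => //.
  apply: measurable_funX; apply: measurable_funB => //.
  by apply: measurableT_comp => //; apply: measurable_funN; exact: measurable_funM.
Qed.

(** The values at the positive integers give the integrals of all polynomials
    in [exp (- x)] without constant term. Some of these, dominated by a multiple
    of [exp (- x)], converge to the indicator function of the interval from [0]
    to [z], which yields the distribution function. *)
Lemma laplace_unique m1 m2 :
  nonneg_supported m1 -> nonneg_supported m2 ->
  (forall n : nat, (\int[m1]_(x in `[0%R, +oo[) (expR (- (n.+1%:R * x)))%:E < +oo)%E) ->
  (forall n : nat, (\int[m1]_(x in `[0%R, +oo[) (expR (- (n.+1%:R * x)))%:E =
                    \int[m2]_(x in `[0%R, +oo[) (expR (- (n.+1%:R * x)))%:E)%E) ->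
  forall A, measurable A -> m1 A = m2 A.
Proof.
move=> s1 s2 fin eq12.
have itv0 z : 0 <= z -> m1 `[0, z]%classic = m2 `[0, z]%classic.
  move=> z0; have [_ c1] := integral_g_cvg z0 (fin 0%N).
  have fin2 := fin 0%N; rewrite eq12 in fin2.
  have [_ c2] := integral_g_cvg z0 fin2.
  have eqg : (fun n => \int[m1]_(x in D) (g z n x)%:E)%E =
             (fun n => \int[m2]_(x in D) (g z n x)%:E)%E.
    by apply/funext => n; exact: eG.
  by rewrite eqg in c1; exact: cvg_unique c1 c2.
have fin0 z : (m1 `[0%R, z]%classic < +oo)%E.
  have [z0|z0] := leP 0 z; first by have [] := integral_g_cvg z0 (fin 0%N).
  by rewrite set_itv_ge ?measure0//= bnd_simp -ltNge.
have split0 m b : nonneg_supported m -> m `]-oo, b]%classic = m `[0, b]%classic.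
  move=> sm; have -> : `]-oo, b]%classic = (`]-oo, b]%classic `&` `]-oo, 0[%classic) `|` `[0, b]%classic.
    apply/seteqP; split=> x/=; rewrite !in_itv/=.
      by move=> ->; have [x0|x0] := ltP x 0; [left|right].
    by move=> [[]//|/andP[]].
  rewrite measureU//=; first last.
  - by apply/seteqP; split=> x//=; rewrite !in_itv/= => -[[_ x0] /andP[]]; rewrite leNgt x0.
  - by exact: measurableI.
  by rewrite [X in (X + _)%E](subset_measure0 _ _ _ sm) ?add0e//; exact: measurableI.
have itvN z : m1 `]-oo, z]%classic = m2 `]-oo, z]%classic.
  rewrite !split0//; have [/itv0//|z0] := leP 0 z.
  by rewrite set_itv_ge ?measure0//= bnd_simp -ltNge.
move=> A mA; apply: (@measure_unique _ R (measurableTypeR R) (@ocitv R) (fun n => `](- n%:R), n%:R]%classic)) => //.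
- exact: ocitvI.
- by move=> n; exists (- n%:R, n%:R).
- apply/seteqP; split=> // x _; exists (Num.trunc `|x|).+1 => //=.
  rewrite in_itv/=; have := truncnS_gt `|x|; rewrite ltr_norml => /andP[-> /ltW ->//].
- move=> X [[a b] _ <-{X}]/=.
  have [ab|ba] := leP a b; last by rewrite set_itv_ge ?measure0//= bnd_simp -leNgt ltW.
  have H m : (m `]-oo, b]%classic = m `]-oo, a]%classic + m `]a, b]%classic)%E.
    rewrite -measureU//=; first by rewrite -itv_bndbnd_setU// bnd_simp.
    by apply/seteqP; split=> x//=; rewrite !in_itv/= => -[xa /andP[]]; rewrite ltNge xa.
  have fina : m1 `]-oo, a]%classic \is a fin_num.
    by rewrite split0// ge0_fin_numE.
  have := itvN b; rewrite (H m1) (H m2) -(itvN a).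
  by rewrite !(addeC (m1 `]-oo, a]%classic)) => /(congr1 (fun y => y - m1 `]-oo, a]%classic)%E); rewrite !addeK.
- move=> n; apply: (@le_lt_trans _ _ (m1 `]-oo, n%:R]%classic)).
    rewrite le_measure// ?inE//.
    by move=> x/=; rewrite !in_itv/= => /andP[].
  by rewrite split0.
Qed.

End laplace_uniqueness.

(** * The kernel of fractional integration *)

Section power_kernel.
Context (R : realType).
Implicit Types (a u s l : R).
Local Notation leb := (@lebesgue_measure R).

(** The unnormalised kernel of fractional integration of order [a]. *)
Definition frac a u : R := if 0 < u then u `^ (a - 1) else 0.

Lemma frac_ge0 a u : 0 <= frac a u.
Proof. by rewrite /frac; case: ifP => // _; exact: powR_ge0. Qed.

Lemma measurable_frac a : measurable_fun [set: R] (frac a).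
Proof.
apply: measurable_fun_ifT => //; exact: measurable_fun_ltr.
Qed.

Lemma frac_decreasing a u s : a <= 1 -> 0 < u -> u <= s -> frac a s <= frac a u.
Proof.
move=> a1 u0 us; rewrite /frac u0 (lt_le_trans u0 us).
rewrite -[leLHS]invrK -[leRHS]invrK lef_pV2 ?posrE ?invr_gt0 ?powR_gt0//; last first.
  exact: lt_le_trans us.
by rewrite -!powRN opprB ge0_ler_powR ?nnegrE ?subr_ge0// ltW// (lt_le_trans u0 us).
Qed.

Lemma integral_frac_itv a r s : 0 < a -> 0 < r -> r < s ->
  (\int[leb]_(u in `[r, s]) (frac a u)%:E = (s `^ a / a)%:E - (r `^ a / a)%:E)%E.
Proof.
move=> a0 r0 rs.
transitivity (\int[leb]_(u in `[r, s]) (u `^ (a - 1))%:E)%E.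
  apply: eq_integral => u; rewrite inE/= in_itv/= => /andP[ru _].
  by rewrite /frac (lt_le_trans r0 ru).
have dF u : 0 < u -> is_derive u 1 (fun x => x `^ a / a) (u `^ (a - 1)).
  move=> u0; have D := is_derive1_powR a u0.
  rewrite (_ : (fun x => _) = (fun x => a^-1 *: (x `^ a))); last first.
    by apply/funext => x; rewrite /GRing.scale/= mulrC.
  apply: is_derive_eq.
  by rewrite /GRing.scale/= mulKf// gt_eqF.
have cF b u : 0 < u -> {for u, continuous (fun x : R => x `^ b)}.
  move=> u0; apply: differentiable_continuous; apply/derivable1_diffP.
  by apply: derivable_powR; rewrite in_itv/= andbT.
have cFa u : 0 < u -> {for u, continuous (fun x : R => x `^ a / a)}.
  by move=> u0; apply: cvgMl; exact: cF.
apply: (@continuous_FTC2 _ _ (fun x => x `^ a / a)) => //.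
- apply: continuous_in_subspaceT => x; rewrite inE/= in_itv/= => /andP[rx _].
  by apply: cF; exact: lt_le_trans rx.
- split.
  + move=> x; rewrite in_itv/= => /andP[rx _].
    by have [] := dF x (lt_trans r0 rx).
  + by apply: cvg_at_right_filter; exact: cFa.
  + by apply: cvg_at_left_filter; apply: cFa; exact: lt_trans rs.
- move=> x; rewrite in_itv/= => /andP[rx _].
  by have [_ <-] := dF x (lt_trans r0 rx); rewrite derive1E.
Qed.

(** The singularity at the origin is approached through the intervals from
    [s / (n + 1)] to [s], on which the fundamental theorem of calculus applies. *)
Lemma integral_frac_le a s : 0 < a -> 0 < s ->
  (\int[leb]_(u in `]-oo, s]) (frac a u)%:E <= (s `^ a / a)%:E)%E.
Proof.
move=> a0 s0.
have mf (D : set R) : measurable_fun D (fun u => (frac a u)%:E).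
  by apply/measurable_EFinP; apply: measurable_funTS; exact: measurable_frac.
rewrite (_ : (\int[leb]_(u in _) _ = \int[leb]_(u in `]0%R, s]) (frac a u)%:E)%E); last first.
  rewrite integral_mkcond [RHS]integral_mkcond; apply: eq_integral => u _.
  rewrite !patchE !mem_setE !in_itv/=; case: (u <= s) => /=.
    by rewrite andbT /frac; case: ifP.
  by rewrite andbF.
have -> : `]0, s]%classic = \bigcup_n `[s * harmonic n, s]%classic.
  apply/seteqP; split=> [u|u [n _]]/=; rewrite !in_itv/=.
    move=> /andP[u0 us]; exists (Num.trunc (s / u)) => //=; rewrite in_itv/= us andbT.
    rewrite /harmonic/= ler_pdivrMr// mulrC -ler_pdivrMr// ltW// truncnS_gt//.
  by move=> /andP[su ->]; rewrite andbT (lt_le_trans _ su)// mulr_gt0// invr_gt0.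
have cv : (\int[leb]_(u in `[(s * harmonic n)%R, s]) (frac a u)%:E)%E @[n --> \oo] -->
    (\int[leb]_(u in \bigcup_n `[(s * harmonic n)%R, s]%classic) (frac a u)%:E)%E.
  apply: ge0_nondecreasing_set_cvg_integral => //.
  - move=> m n mn; rewrite subsetEset => u/=; rewrite !in_itv/= => /andP[su ->].
    rewrite andbT (le_trans _ su)// ler_pM2l// /harmonic/= lef_pV2 ?posrE// ler_nat//.
  - by move=> n; exact: mf.
  - by move=> n u _; rewrite lee_fin frac_ge0.
rewrite -(cvg_lim _ cv)//; apply: lime_le.
  by apply/cvg_ex; eexists; exact: cv.
apply: nearW => n; have [->|n0] := eqVneq n 0%N.
  rewrite /harmonic/= invr1 mulr1 set_itv1 integral_set1 lee_fin.
  by rewrite divr_ge0 ?powR_ge0// ltW.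
have h0 : 0 < harmonic n :> R by rewrite /harmonic/= invr_gt0.
rewrite integral_frac_itv//; last 2 first.
- by rewrite mulr_gt0.
- by rewrite gtr_pMr// /harmonic/= invf_lt1// ltr1n ltnS lt0n.
by rewrite lee_fin gerBl divr_ge0 ?powR_ge0// ltW.
Qed.

Let exp_frac a l u : R := expR (- (l * u)) * frac a u.

Let exp_frac_ge0 a l u : 0 <= exp_frac a l u.
Proof. by rewrite mulr_ge0 ?expR_ge0 ?frac_ge0. Qed.

Let measurable_exp_frac a l (D : set R) : measurable_fun D (exp_frac a l).
Proof.
apply: measurable_funTS; apply: measurable_funM; last exact: measurable_frac.
by apply: measurableT_comp => //; apply: measurable_funN; exact: measurable_funM.
Qed.

Definition Gamma a : R := fine (\int[leb]_u (expR (- u) * frac a u)%:E)%E.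

Let Gamma_integral a : (\int[leb]_u (expR (- u) * frac a u)%:E =
  \int[leb]_u (exp_frac a 1 u)%:E)%E.
Proof. by apply: eq_integral => u _; rewrite /exp_frac mul1r. Qed.

Let Gamma_lty a : 0 < a -> a <= 1 -> (\int[leb]_u (exp_frac a 1 u)%:E < +oo)%E.
Proof.
move=> a0 a1.
have mf (D : set R) : measurable_fun D (fun u => (exp_frac a 1 u)%:E).
  by apply/measurable_EFinP.
have -> : [set: R] = `]-oo, 1]%classic `|` `]1, +oo[%classic.
  by apply/seteqP; split=> // x _ /=; rewrite !in_itv/= andbT; have [x1|x1] := leP x 1; [left|right].
rewrite ge0_integral_setU//=; first last.
- by apply/disj_setPS => x/=; rewrite !in_itv/= andbT => -[x1]; rewrite ltNge x1.
- by move=> x _; rewrite lee_fin.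
- exact: mf.
apply: lte_add_pinfty.
  apply: (@le_lt_trans _ _ (\int[leb]_(u in `]-oo, 1%R]) (frac a u)%:E)%E); last first.
    by apply: le_lt_trans (integral_frac_le a0 ltr01) _; rewrite ltry.
  apply: ge0_le_integral => //.
  - by move=> x _; rewrite lee_fin.
  - exact: mf.
  - by apply/measurable_EFinP; apply: measurable_funTS; exact: measurable_frac.
  - move=> x _; rewrite lee_fin /exp_frac /frac; case: ifPn => [x0|]; last by rewrite mulr0.
    by rewrite ler_piMl ?powR_ge0// -[leRHS]expR0 ler_expR oppr_le0 mul1r ltW.
apply: (@le_lt_trans _ _ (\int[leb]_u (exponential_pdf 1 u)%:E)%E); last first.
  by rewrite integral_exponential_pdf// ltry.
apply: (@le_trans _ _ (\int[leb]_(u in `]1%R, +oo[) (exponential_pdf 1 u)%:E)%E); last first.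
  apply: ge0_subset_integral => //.
  - by apply/measurable_EFinP; exact: measurable_exponential_pdf.
  - by move=> x _; rewrite lee_fin exponential_pdf_ge0.
apply: ge0_le_integral => //.
- by move=> x _; rewrite lee_fin.
- exact: mf.
- by apply/measurable_EFinP; apply: measurable_funTS; exact: measurable_exponential_pdf.
- move=> x /=; rewrite in_itv/= andbT => x1; have x0 : 0 < x by exact: lt_trans x1.
  rewrite lee_fin (exponential_pdfE _ (ltW x0)) /exp_frac /frac x0 !mul1r mulN1r.
  rewrite ler_piMr ?expR_ge0// -[leRHS](powRr0 x) ler_powR ?subr_le0 ?(ltW x1)//.
Qed.

Lemma Gamma_gt0 a : 0 < a -> a <= 1 -> 0 < Gamma a.
Proof.
move=> a0 a1; rewrite /Gamma Gamma_integral fine_gt0// Gamma_lty// andbT.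
apply: (@lt_le_trans _ _ (\int[leb]_(u in `[1%R, 2%R]) (expR (- 2) / 2)%:E)%E).
  rewrite integral_cst//= lebesgue_measure_itv/= lte_fin ltr1n/= -EFinD -EFinM.
  by rewrite lte_fin !mulr_gt0 ?expR_gt0// subr_gt0 ltr1n.
apply: (@le_trans _ _ (\int[leb]_(u in `[1%R, 2%R]) (exp_frac a 1 u)%:E)%E); last first.
  apply: ge0_subset_integral => //.
  - apply/measurable_EFinP; exact: measurable_exp_frac.
  - by move=> x _; rewrite lee_fin.
apply: ge0_le_integral => //.
- apply/measurable_EFinP; exact: measurable_exp_frac.
- move=> x /=; rewrite in_itv/= => /andP[x1 x2]; have x0 : 0 < x by exact: lt_le_trans x1.
  rewrite lee_fin /exp_frac mul1r ler_pM ?expR_ge0 ?invr_ge0//.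
    by rewrite ler_expR lerN2.
  rewrite /frac x0; apply: (@le_trans _ _ (x `^ (- 1))).
    by rewrite powRN (powRr1 (ltW x0)) lef_pV2 ?posrE.
  by rewrite ler_powR// lerDr (ltW a0).
Qed.

(** The normalised kernel, of Laplace transform [l ^ (- a)]. *)
Definition frac_kernel a u : R := frac a u / Gamma a.

Lemma frac_kernel_ge0 a u : 0 < a -> a <= 1 -> 0 <= frac_kernel a u.
Proof. by move=> a0 a1; rewrite divr_ge0 ?frac_ge0// ltW// Gamma_gt0. Qed.

Lemma measurable_frac_kernel a : measurable_fun [set: R] (frac_kernel a).
Proof. by apply: measurable_funM => //; exact: measurable_frac. Qed.

(** The substitution [u -> l * u] in the integral defining [Gamma a]. *)
Lemma laplace_frac_kernel a l : 0 < a -> a <= 1 -> 0 < l ->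
  (\int[leb]_u (expR (- (l * u)) * frac_kernel a u)%:E = (l `^ (- a))%:E)%E.
Proof.
move=> a0 a1 l0; have G0 := Gamma_gt0 a0 a1.
have scale u : exp_frac a 1 (l * u + 0) = l `^ (a - 1) * exp_frac a l u.
  rewrite /exp_frac addr0 mul1r mulrCA; congr (_ * _).
  rewrite /frac pmulr_rgt0//; case: ifPn => [u0|_]; last by rewrite mulr0.
  by rewrite powRM// ltW.
have mf b k : measurable_fun [set: R] (fun u => (exp_frac b k u)%:E).
  by apply/measurable_EFinP.
have f0 b k u : (0 <= (exp_frac b k u)%:E)%E by rewrite lee_fin.
have := integral_affine 0 (lt0r_neq0 l0) (mf a 1) (f0 a 1).
under [in X in _ = X -> _]eq_integral do rewrite scale EFinM.
rewrite ge0_integralZl//; last 2 first.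
- exact: mf.
- by rewrite lee_fin powR_ge0.
rewrite gtr0_norm// muleA -EFinM.
have -> : l * l `^ (a - 1) = l `^ a by rewrite mulr_powRB1// ltW.
move=> H.
have -> : (\int[leb]_u (expR (- (l * u)) * frac_kernel a u)%:E =
   (Gamma a)^-1%:E * \int[leb]_u (exp_frac a l u)%:E)%E.
  rewrite -ge0_integralZl//; last 2 first.
  - exact: mf.
  - by rewrite lee_fin invr_ge0 ltW.
  by apply: eq_integral => u _; rewrite /frac_kernel/exp_frac -EFinM; congr _%:E; ring.
set I := (X in (_ * X)%E).
have {}H : (\int[leb]_u (exp_frac a 1 u)%:E = (l `^ a)%:E * I)%E by exact: H.
have finI : I \is a fin_num.
  rewrite ge0_fin_numE; last exact: integral_ge0.
  have := Gamma_lty a0 a1; rewrite H; apply: contraTT; rewrite -!leNgt !leye_eq => /eqP ->.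
  by rewrite mulry gtr0_sg ?powR_gt0// mul1e.
rewrite -(fineK finI) -EFinM; congr _%:E.
move: G0; rewrite /Gamma Gamma_integral H fineM//= pmulr_rgt0 ?powR_gt0// => G0.
by rewrite powRN; field; rewrite !gt_eqF// powR_gt0.
Qed.

End power_kernel.

(** * The Mittag-Leffler distribution as a resolvent *)

Section mittag_leffler_kernel.
Context (R : realType) (a : R).
Hypotheses (a_gt0 : 0 < a) (a_le1 : a <= 1).
Variable rho : probability (measurableTypeR R) R.
Hypothesis rhoML : mittag_leffler a rho.
Local Notation leb := (@lebesgue_measure R).
Local Notation k := (frac_kernel a).
Local Notation D := (`[0%R, +oo[%classic : set R).

Let k0 u : (0 <= (k u)%:E)%E.
Proof. by rewrite lee_fin frac_kernel_ge0. Qed.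

Let mk : measurable_fun [set: R] (fun u => (k u)%:E).
Proof. by apply/measurable_EFinP; exact: measurable_frac_kernel. Qed.

(** The density of the convolution of [k] and [rho]. *)
Definition kernel_conv (t : R) : \bar R := (\int[rho]_(v in D) (k (t - v))%:E)%E.

Let kernel_conv_ge0 t : (0 <= kernel_conv t)%E.
Proof. exact: integral_ge0. Qed.

Let mk2 : measurable_fun setT
  (fun p : (measurableTypeR R * measurableTypeR R)%type =>
     ((fun v => (k (p.1 - v))%:E) \_ D) p.2).
Proof.
rewrite (_ : (fun p => _) = ((fun p : (measurableTypeR R * measurableTypeR R)%type =>
    (k (p.1 - p.2))%:E) \_ (setT `*` D))); last first.
  by apply/funext => p; rewrite !patchE; congr (if _ then _ else _);
    apply/idP/idP; rewrite !inE /=; tauto.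
apply/(measurable_restrictT _ _).1.
  by apply: measurableX.
apply: measurable_funTS; apply/measurable_EFinP.
apply: (measurableT_comp (measurable_frac_kernel a)).
by apply: measurable_funB; [exact: measurable_fst|exact: measurable_snd].
Qed.

Let kernel_convE t : kernel_conv t = (\int[rho]_v ((fun v => (k (t - v))%:E) \_ D) v)%E.
Proof. by rewrite /kernel_conv integral_mkcond. Qed.

Let measurable_kernel_conv : measurable_fun [set: R] kernel_conv.
Proof.
have -> : kernel_conv = fun t => (\int[rho]_v ((fun v => (k (t - v))%:E) \_ D) v)%E.
  by apply/funext => t; exact: kernel_convE.
have := measurable_fun_fubini_tonelli_F (m2 := rho) _ mk2.
apply => p; apply: erestrict_ge0 => v _; exact: k0.
Qed.

Let laplace_kernel_conv l : 0 < l ->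
  (\int[leb]_(t in D) ((expR (- (l * t)))%:E * kernel_conv t) =
  (l `^ (- a))%:E * laplace_transform rho l)%E.
Proof.
move=> l0.
have me : measurable_fun [set: R] (fun t : R => (expR (- (l * t)))%:E).
  apply/measurable_EFinP; apply: measurableT_comp => //.
  by apply: measurable_funN; exact: measurable_funM.
pose F (p : measurableTypeR R * measurableTypeR R) :=
  ((expR (- (l * p.1)))%:E * ((fun v => (k (p.1 - v))%:E) \_ D) p.2)%E.
have F0 p : (0 <= F p)%E.
  by rewrite mule_ge0 ?lee_fin ?expR_ge0//; apply: erestrict_ge0 => v _; exact: k0.
have mF : measurable_fun setT F.
  apply: emeasurable_funM; last exact: mk2.
  by apply: (measurableT_comp me); exact: measurable_fst.
transitivity (\int[leb]_t \int[rho]_v F (t, v))%E.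
  rewrite integral_mkcond; apply: eq_integral => t _; rewrite patchE.
  rewrite /F/= ge0_integralZl//; first last.
  - by move=> v _; apply: erestrict_ge0 => ? _; exact: k0.
  - apply/(measurable_restrictT _ _).1 => //; apply: measurable_funTS.
    apply/measurable_EFinP; apply: (measurableT_comp (measurable_frac_kernel a)).
    exact: measurable_funB.
  rewrite -kernel_convE; case: ifPn => //; rewrite notin_setE/= in_itv/= andbT => /negP.
  rewrite -ltNge => t0; rewrite /kernel_conv integral0_eq ?mule0// => v/=.
  rewrite in_itv/= andbT => v0; rewrite /frac_kernel/frac subr_gt0 ltNge.
  by rewrite (le_trans (ltW t0) v0)/= mul0r.
rewrite fubini_tonelli//.
rewrite /laplace_transform -ge0_integralZl//; first last.
- by rewrite lee_fin powR_ge0.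
- exact: measurable_funTS.
rewrite [RHS]integral_mkcond; apply: eq_integral => v _; rewrite patchE /F/=.
case: ifPn => vD; last first.
  by apply: integral0_eq => t _; rewrite patchE (negbTE vD) mule0.
pose G t := ((expR (- (l * t)) * k t)%:E).
transitivity (\int[leb]_t ((expR (- (l * v)))%:E * G (t - v)%R))%E.
  apply: eq_integral => t _; rewrite patchE vD /G -!EFinM [in RHS]mulrA -expRD.
  by congr (expR _ * _)%:E; ring.
have mG : measurable_fun [set: R] G.
  apply/measurable_EFinP; apply: measurable_funM; last exact: measurable_frac_kernel.
  exact/measurable_EFinP.
have G0 t : (0 <= G t)%E by rewrite lee_fin mulr_ge0 ?expR_ge0// frac_kernel_ge0.
rewrite ge0_integralZl//; first last.
- apply: (measurableT_comp mG).
  exact: measurable_funB.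
by rewrite integral_shift// laplace_frac_kernel// muleC.
Qed.

Let nu_k := weighted leb mk k0.

Let nu_K := weighted leb measurable_kernel_conv kernel_conv_ge0.

(** Comparing Laplace transforms, [1 / (1 + l ^ a) * (1 + l ^ (- a))] is
    [l ^ (- a)]: [rho] satisfies the resolvent equation of the kernel [k]. *)
Lemma mittag_leffler_resolvent (A : set R) : measurable A ->
  (rho A + \int[leb]_(t in A) kernel_conv t = \int[leb]_(t in A) (k t)%:E)%E.
Proof.
move=> mA.
pose nu := measure_add rho nu_K.
have nuE X : nu X = (rho X + \int[leb]_(t in X) kernel_conv t)%E.
  exact: measure_addE.
rewrite -nuE.
have lap_k l : 0 < l ->
    (\int[nu_k]_(x in D) (expR (- (l * x)))%:E = (l `^ (- a))%:E)%E.
  move=> l0; rewrite integral_weighted_patch//; first last.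
  - apply/measurable_EFinP; apply: measurableT_comp => //.
    by apply: measurable_funN; exact: measurable_funM.
  rewrite -(laplace_frac_kernel a_gt0 a_le1 l0) integral_mkcond; apply: eq_integral => t _.
  rewrite patchE mem_setE in_itv/= andbT; case: ifPn => [_|]; first by rewrite EFinM.
  by rewrite -ltNge => t0; rewrite /frac_kernel/frac ltNge (ltW t0)/= mul0r mulr0.
have lap_nu l : 0 < l ->
    (\int[nu]_(x in D) (expR (- (l * x)))%:E = (l `^ (- a))%:E)%E.
  move=> l0; have me : measurable_fun [set: R] (fun t : R => (expR (- (l * t)))%:E).
    apply/measurable_EFinP; apply: measurableT_comp => //.
    by apply: measurable_funN; exact: measurable_funM.
  have e0 (t : R) : (0 <= (expR (- (l * t)))%:E)%E by rewrite lee_fin expR_ge0.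
  rewrite ge0_integral_measure_add//; last exact: measurable_funTS.
  rewrite integral_weighted_patch// laplace_kernel_conv//.
  have [_ lap] := rhoML; have := lap l (ltW l0); rewrite /laplace_transform => ->.
  rewrite -EFinM -EFinD; congr _%:E.
  have la0 : 0 < l `^ a by exact: powR_gt0.
  by rewrite powRN; field; rewrite !gt_eqF// ltr_wpDl.
have -> : (\int[leb]_(t in A) (k t)%:E)%E = nu_k A by [].
apply: (@laplace_unique _ nu nu_k) => //.
- apply: etrans (nuE _) _.
  have [s0 _] := rhoML; rewrite s0 add0e; apply: integral0_eq => t/=.
  rewrite in_itv/= => t0; apply: integral0_eq => v/=.
  rewrite in_itv/= andbT => v0; rewrite /frac_kernel/frac subr_gt0 ltNge.
  by rewrite (le_trans (ltW t0) v0)/= mul0r.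
- apply: integral0_eq => t/=; rewrite in_itv/= => t0.
  by rewrite /frac_kernel/frac ltNge (ltW t0)/= mul0r.
- by move=> n; rewrite lap_nu// ltry.
- by move=> n; rewrite lap_nu// lap_k.
Qed.

Lemma mittag_leffler_le (A : set R) : measurable A ->
  (rho A <= \int[leb]_(t in A) (k t)%:E)%E.
Proof.
by move=> mA; rewrite -mittag_leffler_resolvent// leeDl// integral_ge0.
Qed.

Lemma mittag_leffler_integral_le (g : R -> \bar R) :
  measurable_fun [set: R] g -> (forall x, (0 <= g x)%E) ->
  (\int[rho]_(x in D) g x <= \int[leb]_(x in D) (g x * (k x)%:E))%E.
Proof.
move=> mg g0; pose nu := measure_add rho nu_K.
have <- : (\int[nu]_(x in D) g x = \int[leb]_(x in D) (g x * (k x)%:E))%E.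
  rewrite -(integral_weighted_patch leb mk k0)//.
  apply: eq_measure_integral => A mA _.
  by rewrite /nu; apply: etrans (measure_addE _ _ _) _; exact: mittag_leffler_resolvent.
rewrite ge0_integral_measure_add//; last exact: measurable_funTS.
by rewrite leeDl// integral_ge0.
Qed.

Let G0 : 0 < Gamma a. Proof. exact: Gamma_gt0. Qed.

Let kernel_half t : 0 < t -> k (t / 2) <= 2 * k t.
Proof.
move=> t0; rewrite /frac_kernel mulrA ler_wpM2r ?invr_ge0 ?(ltW G0)// /frac t0 divr_gt0//.
rewrite powRM ?invr_ge0 ?(ltW t0)// mulrC ler_wpM2r ?powR_ge0//.
rewrite -[in leRHS](@powRr1 _ 2)// -powR_inv1// -powRrM ler_powR ?ler1n//.
by rewrite mulN1r opprB gerBl ltW.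
Qed.

(** In the integral of [k (t - v) * k v] one of the two factors is at most
    [k (t / 2)], which is of order [k t], and the other integrates to [O (t ^ a)]. *)
Let kernel_conv_le t : 0 < t ->
  (kernel_conv t <= ((4 / (a * Gamma a)) * t `^ a * k t)%:E)%E.
Proof.
move=> t0.
have mkt : measurable_fun [set: R] (fun v => (k (t - v))%:E).
  apply: (measurableT_comp mk); exact: measurable_funB.
apply: le_trans (mittag_leffler_integral_le mkt (fun v => k0 _)) _.
pose w := fun v => ((k (t / 2))%:E * (((fun u => (k u)%:E) \_ `]-oo, t]) v +
  ((fun u => (k u)%:E) \_ `]-oo, t]) (t - v)%R))%E.
have r0 v : (0 <= ((fun u => (k u)%:E) \_ `]-oo, t]) v)%E.
  by apply: erestrict_ge0 => u _; exact: k0.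
have mr : measurable_fun [set: R] ((fun u => (k u)%:E) \_ `]-oo, t]).
  by apply/(measurable_restrictT _ _).1 => //; exact: measurable_funTS.
have mr' : measurable_fun [set: R] (fun v => ((fun u => (k u)%:E) \_ `]-oo, t]) (t - v)%R).
  apply: (measurableT_comp mr); exact: measurable_funB.
have mw : measurable_fun [set: R] w.
  by apply: emeasurable_funM => //; exact: emeasurable_funD.
have w0 v : (0 <= w v)%E by rewrite mule_ge0// adde_ge0.
apply: (@le_trans _ _ (\int[leb]_v w v)%E).
  apply: (@le_trans _ _ (\int[leb]_(v in D) w v)%E); last first.
    by apply: ge0_subset_integral => //.
  apply: ge0_le_integral => //.
  - by move=> v _; rewrite mule_ge0.
  - by apply: measurable_funTS; apply: emeasurable_funM.
  - exact: measurable_funTS.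
  - move=> v/=; rewrite in_itv/= andbT => v0.
    have [vt|tv] := ltP v t; last first.
      by rewrite [k (t - v)]/frac_kernel/frac subr_gt0 ltNge tv/= mul0r mul0e.
    have [v00|vn0] := eqVneq v 0.
      by rewrite [k v]/frac_kernel/frac v00 ltxx mul0r mule0.
    have vgt0 : 0 < v by rewrite lt_neqAle eq_sym vn0.
    rewrite /w !patchE !mem_setE !in_itv/= (ltW vt) gerBl v0.
    rewrite -!EFinD -!EFinM lee_fin.
    have kv0 := frac_kernel_ge0 v a_gt0 a_le1.
    have ktv0 := frac_kernel_ge0 (t - v) a_gt0 a_le1.
    have kdec u : t / 2 <= u -> k u <= k (t / 2).
      by move=> u2; rewrite /frac_kernel ler_wpM2r ?invr_ge0 ?(ltW G0)// frac_decreasing// divr_gt0.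
    have [v2|v2] := leP v (t / 2).
      have : k (t - v) <= k (t / 2) by apply: kdec; lra.
      by nra.
    have : k v <= k (t / 2) by apply: kdec; lra.
    by nra.
rewrite ge0_integralZl//; first last.
- by move=> v _; rewrite adde_ge0.
- exact: emeasurable_funD.
rewrite ge0_integralD//.
rewrite integral_reflect//.
have I1 : (\int[leb]_v ((fun u => (k u)%:E) \_ `]-oo, t]) v <= (t `^ a / (a * Gamma a))%:E)%E.
  rewrite -integral_mkcond; under eq_integral do rewrite /frac_kernel EFinM.
  rewrite ge0_integralZr//; first last.
  - by rewrite lee_fin invr_ge0 ltW.
  - by move=> u _; rewrite lee_fin frac_ge0.
  - by apply/measurable_EFinP; apply: measurable_funTS; exact: measurable_frac.
  rewrite invfM mulrA EFinM lee_wpmul2r//; first by rewrite lee_fin invr_ge0 ltW.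
  exact: integral_frac_le.
apply: le_trans (lee_wpmul2l _ (leeD I1 I1)) _; first by rewrite lee_fin frac_kernel_ge0.
rewrite -EFinD -EFinM lee_fin.
have := kernel_half t0.
have q0 : 0 <= t `^ a / (a * Gamma a) by rewrite divr_ge0 ?powR_ge0// mulr_ge0// ltW.
set q := t `^ a / _ in q0 *.
have -> : 4 / (a * Gamma a) * t `^ a * k t = 4 * q * k t by rewrite /q; ring.
by nra.
Qed.

(** Since [k * rho] is [O (t ^ a)] times [k], near the origin [rho] is at least
    half of [k], and [k u] dominates [u ^ (- 1 / 2)] when [a <= 1 / 2]. *)
Lemma mittag_leffler_ge : a <= 2^-1 ->
  exists c t0 : R, [/\ 0 < c, 0 < t0 <= 2^-1 &
    forall (w : R) (A : set R), 0 < w <= t0 -> measurable A -> A `<=` `]0, w] ->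
      ((c * w `^ (- 2^-1))%:E * leb A <= rho A)%E].
Proof.
move=> ah; pose b := Num.min (2^-1 `^ a) (a * Gamma a / 8).
have b0 : 0 < b by rewrite lt_min powR_gt0//= divr_gt0// mulr_gt0.
pose t0 := b `^ a^-1.
have ta : t0 `^ a = b by rewrite -powRrM mulVf ?gt_eqF// powRr1// ltW.
have t00 : 0 < t0 by exact: powR_gt0.
have t0h : t0 <= 2^-1.
  have -> : 2^-1 = (2^-1 `^ a) `^ a^-1 :> R by rewrite -powRrM divff ?gt_eqF// powRr1.
  by rewrite ge0_ler_powR ?nnegrE ?invr_ge0 ?powR_ge0 ?(ltW b0) ?(ltW a_gt0)// ge_min lexx.
exists ((2 * Gamma a)^-1), t0; split; rewrite ?invr_gt0 ?mulr_gt0 ?t00//.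
move=> w A /andP[w0 wt0] mA Aw.
have mkA : measurable_fun A (fun u => (k u)%:E) by exact: measurable_funTS.
have KA t : A t -> (kernel_conv t <= (2^-1)%:E * (k t)%:E)%E.
  move=> /Aw/=; rewrite in_itv/= => /andP[tgt0 tw].
  apply: le_trans (kernel_conv_le tgt0) _; rewrite -EFinM lee_fin.
  rewrite ler_wpM2r ?frac_kernel_ge0//.
  have : t `^ a <= b.
    by rewrite -ta ge0_ler_powR ?nnegrE ?(ltW a_gt0) ?(ltW tgt0) ?(ltW t00)// (le_trans tw).
  rewrite le_min => /andP[_ tb].
  apply: (@le_trans _ _ (4 / (a * Gamma a) * (a * Gamma a / 8))).
    by rewrite ler_wpM2l// divr_ge0// mulr_ge0// ltW.
  by rewrite le_eqVlt; apply/orP; left; apply/eqP; field; rewrite !gt_eqF.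
have kA_fin : (\int[leb]_(t in A) (k t)%:E)%E \is a fin_num.
  rewrite ge0_fin_numE; last exact: integral_ge0.
  apply: (@le_lt_trans _ _ (\int[leb]_(t in `]-oo, w]) (k t)%:E)%E).
    apply: ge0_subset_integral => //; first exact: measurable_funTS.
    by move=> x /Aw/=; rewrite !in_itv/= => /andP[].
  under eq_integral do rewrite /frac_kernel EFinM.
  rewrite ge0_integralZr//; first last.
  - by rewrite lee_fin invr_ge0 ltW.
  - by move=> u _; rewrite lee_fin frac_ge0.
  - by apply/measurable_EFinP; apply: measurable_funTS; exact: measurable_frac.
  apply: (@le_lt_trans _ _ ((w `^ a / a)%:E * ((Gamma a)^-1)%:E)%E); last by rewrite -EFinM ltry.
  by rewrite lee_wpmul2r ?integral_frac_le// lee_fin invr_ge0 ltW.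
have half : (\int[leb]_(t in A) kernel_conv t <= (2^-1)%:E * \int[leb]_(t in A) (k t)%:E)%E.
  rewrite -ge0_integralZl//.
  apply: ge0_le_integral => //.
  - exact: measurable_funTS.
  - exact: emeasurable_funM.
have KA_fin : (\int[leb]_(t in A) kernel_conv t)%E \is a fin_num.
  rewrite ge0_fin_numE; last exact: integral_ge0.
  by apply: le_lt_trans half _; rewrite -(fineK kA_fin) -EFinM ltry.
have rho_half : ((2^-1)%:E * \int[leb]_(t in A) (k t)%:E <= rho A)%E.
  have := mittag_leffler_resolvent mA; move: half.
  have rfin : rho A \is a fin_num by exact: fin_num_measure.
  rewrite -(fineK kA_fin) -(fineK KA_fin) -(fineK rfin) -EFinD -!EFinM !lee_fin.
  by move=> h [e]; lra.
apply: le_trans rho_half.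
have -> : ((2 * Gamma a)^-1 * w `^ (- 2^-1))%:E =
  ((2^-1)%:E * (w `^ (- 2^-1) / Gamma a)%:E)%E by rewrite -EFinM; congr _%:E; field; rewrite gt_eqF.
rewrite -muleA lee_wpmul2l//.
rewrite -(integral_cst leb mA).
apply: ge0_le_integral => //.
- by move=> x _; rewrite lee_fin divr_ge0 ?powR_ge0// ltW.
- move=> x /Aw/=; rewrite in_itv/= => /andP[x0 xw].
  rewrite lee_fin /frac_kernel/frac x0 ler_wpM2r ?invr_ge0 ?(ltW G0)//.
  have w1 : w <= 1 by lra.
  have h1 : w `^ (- 2^-1) <= w `^ (a - 1).
    by apply: ger_powR; [rewrite w0|lra].
  apply: le_trans h1 _.
  have := frac_decreasing a_le1 x0 xw; by rewrite /frac x0 w0.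
Qed.

(** As [rho <= k], [g r] is at most the integral of [k (r - s)] over an interval
    of [s] of length [delta]. By the Cauchy-Schwarz inequality its square is at
    most [delta] times the integral of [k (r - s) ^ 2], and integrating in [r]
    gives another [delta], because the square of [k] is locally integrable
    exactly when [a > 1 / 2]. *)
Lemma mittag_leffler_square_integrable t : 2^-1 < a -> 0 <= t ->
  exists2 C : R, 0 <= C & forall (p delta : R) (g : R -> R), 0 <= p -> 0 <= delta ->
    measurable_fun [set: R] g ->
    (forall r, 0 <= g r) ->
    (forall r, (g r)%:E <= rho (D `&` `[(r - (p + delta))%R, (r - p)%R]))%E ->
    (\int[leb]_(r in `[0%R, t]) (g r ^+ 2)%:E <= (C * delta ^+ 2)%:E)%E.
Proof.
move=> ah t_ge0; pose b := 2 * a - 1.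
have b0 : 0 < b by rewrite /b; lra.
exists ((t + 1) `^ b / b / Gamma a ^+ 2).
  by rewrite !divr_ge0 ?powR_ge0 ?sqr_ge0// ltW.
move=> p delta g p0 d0 mg g0 grho.
pose J : set R := `[p, p + delta]%classic.
have mJ : measurable J by exact: measurable_itv.
have muJ : leb J = delta%:E.
  rewrite /J lebesgue_measure_itv/= lte_fin ltrDl.
  case: ltgtP d0 => // [d0 _|<- _]; last by [].
  by rewrite -EFinD addrAC subrr add0r.
have k2E u : k u ^+ 2 = frac b u / Gamma a ^+ 2.
  rewrite /frac_kernel expr_div_n; congr (_ / _).
  rewrite /frac; case: ifPn => u0; last by rewrite expr0n.
  rewrite -powR_mulrn ?powR_ge0// -powRrM; congr (_ `^ _).
  by rewrite /b; ring.
pose F (q : measurableTypeR R * measurableTypeR R) : \bar R := ((k (q.1 - q.2) ^+ 2)%:E * (\1_J q.2)%:E)%E.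
have F0 q : (0 <= F q)%E by rewrite mule_ge0// lee_fin ?sqr_ge0.
have mF : measurable_fun setT F.
  apply: emeasurable_funM; apply/measurable_EFinP.
    apply: measurable_funX; apply: (measurableT_comp (measurable_frac_kernel a)).
    by apply: measurable_funB; [exact: measurable_fst|exact: measurable_snd].
  apply: (@measurableT_comp _ _ _ _ _ _ (\1_J : R -> R)).
    exact: measurable_indic mJ.
  exact: measurable_snd.
have mF1 r : measurable_fun [set: R] (fun s => F (r, s)).
  exact: measurableT_comp mF (measurable_pair1 r).
have pointwise r : ((g r ^+ 2)%:E <= delta%:E * \int[leb]_s F (r, s))%E.
  pose S : set R := D `&` `[r - (p + delta), r - p]%classic.
  have mS : measurable S by apply: measurableI.
  have mks : measurable_fun [set: R] (fun s : R => k (r - s)).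
    by apply: (measurableT_comp (measurable_frac_kernel a)); exact: measurable_funB.
  have kJ : ((g r)%:E <= \int[leb]_(s in J) (k (r - s))%:E)%E.
    apply: le_trans (grho r) _; apply: le_trans (mittag_leffler_le mS) _.
    rewrite integral_mkcond -(@integral_reflect _ r); first last.
    - by move=> x; apply: erestrict_ge0 => u _; exact: k0.
    - by apply/(measurable_restrictT _ _).1 => //; exact: measurable_funTS.
    rewrite [leRHS]integral_mkcond; apply: ge0_le_integral => //.
    - by move=> x _; apply: erestrict_ge0 => u _; exact: k0.
    - apply: (@measurableT_comp _ _ _ _ _ _ ((fun u => (k u)%:E) \_ S)).
        by apply/(measurable_restrictT _ _).1 => //; exact: measurable_funTS.
      exact: measurable_funB.
    - by apply/(measurable_restrictT _ _).1 => //; apply: measurable_funTS; exact/measurable_EFinP.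
    - move=> s _; rewrite !patchE; case: ifPn => [|_]; last by case: ifPn.
      rewrite /S inE/= !in_itv/= => -[_ /andP[h1 h2]].
      have -> : s \in J by rewrite /J mem_setE in_itv/=; apply/andP; split; lra.
      exact: lexx.
  have -> : (\int[leb]_s F (r, s) = \int[leb]_(s in J) (k (r - s) ^+ 2)%:E)%E.
    rewrite [RHS]integral_mkcond; apply: eq_integral => s _; rewrite patchE /F/= indicE.
    by case: ifPn; rewrite ?mule1 ?mule0.
  rewrite -muJ; apply: le_trans (cauchy_schwarz_integral _ _ _ _) => //.
  - by rewrite expr2 EFinM lee_pmul ?lee_fin.
  - by have := ltry delta; rewrite -muJ.
  - exact: measurable_funTS.
  - by move=> x _; exact: frac_kernel_ge0.
apply: (@le_trans _ _ (\int[leb]_(r in `[0%R, t]) (delta%:E * \int[leb]_s F (r, s)))%E).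
  apply: ge0_le_integral => //.
  - by move=> r _; rewrite lee_fin sqr_ge0.
  - by apply/measurable_EFinP; apply: measurable_funTS; exact: measurable_funX.
  - apply: emeasurable_funM => //; apply: measurable_funTS.
    exact: measurable_fun_fubini_tonelli_F.
rewrite ge0_integralZl//; first last.
- by move=> r _; apply: integral_ge0.
- by apply: measurable_funTS; exact: measurable_fun_fubini_tonelli_F.
set C := (X in (X * delta ^+ 2)%:E).
have -> : C * delta ^+ 2 = delta * (delta * C) by ring.
rewrite EFinM lee_wpmul2l//.
pose Q : R -> \bar R := (fun u => (k u ^+ 2)%:E) \_ `]-oo, t].
have Q0 u : (0 <= Q u)%E by apply: erestrict_ge0 => v _; rewrite lee_fin sqr_ge0.
have mQ : measurable_fun [set: R] Q.
  apply/(measurable_restrictT _ _).1 => //; apply: measurable_funTS.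
  by apply/measurable_EFinP; apply: measurable_funX; exact: measurable_frac_kernel.
have intQ : (\int[leb]_u Q u <= C%:E)%E.
  rewrite -integral_mkcond; under eq_integral do rewrite k2E EFinM.
  rewrite ge0_integralZr//; first last.
  - by rewrite lee_fin invr_ge0 sqr_ge0.
  - by move=> u _; rewrite lee_fin frac_ge0.
  - by apply/measurable_EFinP; apply: measurable_funTS; exact: measurable_frac.
  rewrite [leRHS]EFinM lee_wpmul2r//; first by rewrite lee_fin invr_ge0 sqr_ge0.
  have t1 : 0 < t + 1 by rewrite ltr_wpDl.
  apply: le_trans (integral_frac_le b0 t1); apply: ge0_subset_integral => //.
  - by apply/measurable_EFinP; apply: measurable_funTS; exact: measurable_frac.
  - by move=> u _; rewrite lee_fin frac_ge0.
  - by move=> u/=; rewrite !in_itv/= => /le_trans; apply; rewrite lerDl.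
pose F' (q : measurableTypeR R * measurableTypeR R) : \bar R := (Q (q.1 - q.2)%R * (\1_J q.2)%:E)%E.
have F'0 q : (0 <= F' q)%E by rewrite mule_ge0// lee_fin.
have mF' : measurable_fun setT F'.
  apply: emeasurable_funM.
    apply: (measurableT_comp mQ).
    by apply: measurable_funB; [exact: measurable_fst|exact: measurable_snd].
  apply/measurable_EFinP; apply: (@measurableT_comp _ _ _ _ _ _ (\1_J : R -> R)).
    exact: measurable_indic mJ.
  exact: measurable_snd.
apply: (@le_trans _ _ (\int[leb]_r \int[leb]_s F' (r, s))%E).
  apply: (@le_trans _ _ (\int[leb]_(r in `[0%R, t]) \int[leb]_s F' (r, s))%E); last first.
    apply: ge0_subset_integral => //; first exact: measurable_fun_fubini_tonelli_F.
    by move=> r _; exact: integral_ge0.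
  apply: ge0_le_integral => //.
  - by move=> r _; exact: integral_ge0.
  - by apply: measurable_funTS; exact: measurable_fun_fubini_tonelli_F.
  - by apply: measurable_funTS; exact: measurable_fun_fubini_tonelli_F.
  - move=> r/=; rewrite in_itv/= => /andP[r0 rt]; apply: ge0_le_integral => //.
    + exact: mF1.
    + exact: measurableT_comp mF' (measurable_pair1 r).
    + move=> s _; rewrite /F /F'/= indicE; case: (boolP (s \in J)); last by rewrite !mule0.
      rewrite inE/J/= in_itv/= => /andP[ps _]; rewrite /Q patchE ifT//.
      by rewrite mem_setE in_itv/=; lra.
rewrite fubini_tonelli//.
apply: (@le_trans _ _ (\int[leb]_s ((\int[leb]_u Q u) * (\1_J s)%:E))%E).
  rewrite le_eqVlt; apply/orP; left; apply/eqP; apply: eq_integral => s _.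
  have mQs : measurable_fun [set: R] (fun r => Q (r - s)).
    by apply: (measurableT_comp mQ); exact: measurable_funB.
  have Js0 : (0 <= (\1_J s)%:E :> \bar R)%E by [].
  have := ge0_integralZr leb measurableT mQs (fun r _ => Q0 (r - s)) Js0.
  by rewrite (integral_shift s mQ Q0) => <-.
rewrite ge0_integralZl//; first last.
- exact: integral_ge0.
- by apply/measurable_EFinP; exact: measurable_indic mJ.
have -> : (\int[leb]_s (\1_J s)%:E = delta%:E)%E.
  by rewrite integral_indic// setIT; exact: muJ.
by rewrite [leRHS]EFinM muleC lee_wpmul2l.
Qed.

End mittag_leffler_kernel.

(** * Convolutions and the Riccati equation *)

Section convolution_theory.
Context (R : realType).
Variable kappa : {measure set (measurableTypeR R) -> \bar R}.
Hypothesis kappa_fin : forall t : R, (kappa `[0%R, t]%classic < +oo)%E.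
Implicit Types (g h : R -> R) (M t : R).
Local Notation conv g := (convolution g kappa).

Let measurable_reflect g t : measurable_fun [set: R] g ->
  measurable_fun [set: R] (fun s => g (t - s)).
Proof. by move=> mg; apply: measurableT_comp => //; exact: measurable_funB. Qed.

Lemma convolution_integrable g M t : measurable_fun [set: R] g ->
  (forall s, `|g s| <= M) -> kappa.-integrable `[0, t] (EFin \o (fun s => g (t - s))).
Proof.
move=> mg gM; apply: measurable_bounded_integrable => //.
- by apply: measurable_funTS; exact: measurable_reflect.
- exists M; split; first by rewrite num_real.
  by move=> y My x _ /=; rewrite (le_trans (gM _))// ltW.
Qed.

Lemma convolutionZ c g M t : measurable_fun [set: R] g ->
  (forall s, `|g s| <= M) -> conv (fun s => c * g s) t = c * conv g t.
Proof.
move=> mg gM; rewrite /convolution RintegralZl//.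
exact: convolution_integrable gM.
Qed.

Lemma convolutionD g h M N t : measurable_fun [set: R] g -> measurable_fun [set: R] h ->
  (forall s, `|g s| <= M) -> (forall s, `|h s| <= N) ->
  conv (fun s => g s + h s) t = conv g t + conv h t.
Proof.
move=> mg mh gM hN; rewrite /convolution RintegralD//.
- exact: convolution_integrable gM.
- exact: convolution_integrable hN.
Qed.

Lemma convolutionB g h M N t : measurable_fun [set: R] g -> measurable_fun [set: R] h ->
  (forall s, `|g s| <= M) -> (forall s, `|h s| <= N) ->
  conv (fun s => g s - h s) t = conv g t - conv h t.
Proof.
move=> mg mh gM hN; rewrite /convolution RintegralB//.
- exact: convolution_integrable gM.
- exact: convolution_integrable hN.
Qed.

Lemma normr_convolution_le g M t : measurable_fun [set: R] g ->
  (forall s, `|g s| <= M) -> `|conv g t| <= M * fine (kappa `[0, t]%classic).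
Proof.
move=> mg gM; have ig := convolution_integrable t mg gM.
apply: le_trans (le_normr_Rintegral _ ig) _ => //.
rewrite -Rintegral_cst//; apply: le_Rintegral => //.
- by have := integrable_norm ig.
- apply: (@convolution_integrable (cst M) `|M|) => //.
Qed.

Lemma convolution_ge0 g t : (forall s, 0 <= g s) -> 0 <= conv g t.
Proof. by move=> g0; apply: Rintegral_ge0 => s _. Qed.

Lemma EFin_convolution g M t : measurable_fun [set: R] g ->
  (forall s, `|g s| <= M) ->
  ((conv g t)%:E = \int[kappa]_(s in `[0%R, t]) (g (t - s))%:E)%E.
Proof.
move=> mg gM; rewrite /convolution /Rintegral fineK//.
by apply: integrable_fin_num => //; exact: convolution_integrable gM.
Qed.

End convolution_theory.

Section convolution_probability.
Context (R : realType) (rho : probability (measurableTypeR R) R).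
Implicit Types (g h F : R -> R) (M t theta : R).
Local Notation conv g := (convolution g rho).

Let rho_fin t : (rho `[0%R, t]%classic < +oo)%E.
Proof. by rewrite (le_lt_trans (probability_le1 _ _))// ltry. Qed.

Let fine_rho_le1 t : 0 <= fine (rho `[0, t]%classic) <= 1.
Proof.
rewrite fine_ge0//= -lee_fin fineK ?probability_le1//.
by rewrite ge0_fin_numE.
Qed.

Lemma normr_convolution_le1 g M t : measurable_fun [set: R] g ->
  (forall s, `|g s| <= M) -> `|conv g t| <= M.
Proof.
move=> mg gM; apply: le_trans (normr_convolution_le rho_fin t mg gM) _.
by rewrite ler_piMr// ?(le_trans _ (gM 0))//; have /andP[] := fine_rho_le1 t.
Qed.

Lemma measurable_convolution_integrand g : measurable_fun [set: R] g ->
  measurable_fun setT (fun p : measurableTypeR R * measurableTypeR R =>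
    ((fun s => (g (p.1 - s))%:E) \_ `[0, p.1]) p.2).
Proof.
move=> mg; rewrite (_ : (fun p => _) =
   (fun p : (measurableTypeR R * measurableTypeR R)%type =>
    (g (p.1 - p.2))%:E) \_ [set p | 0 <= p.2 <= p.1]); last first.
  by apply/funext => p; rewrite !patchE; congr (if _ then _ else _).
have mS : measurable [set p : measurableTypeR R * measurableTypeR R | 0 <= p.2 <= p.1].
  pose d (p : measurableTypeR R * measurableTypeR R) : R := p.1 - p.2.
  have md : measurable_fun setT d.
    by apply: measurable_funB; [exact: measurable_fst|exact: measurable_snd].
  have ms : measurable_fun setT (fun p : measurableTypeR R * measurableTypeR R => p.2 : R).
    exact: measurable_snd.
  rewrite (_ : [set _ | _] = (setT `&` snd @^-1` `[0, +oo[%classic) `&`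
                             (setT `&` d @^-1` `[0, +oo[%classic)).
    by apply: measurableI; [exact: ms|exact: md].
  apply/seteqP; split=> p/=; rewrite !in_itv/= !andbT /d subr_ge0.
    by move=> /andP[-> ->].
  by move=> [[_ ->] [_ ->]].
apply/(measurable_restrictT _ _).1 => //.
apply: measurable_funTS; apply/measurable_EFinP.
apply: (measurableT_comp mg).
by apply: measurable_funB; [exact: measurable_fst|exact: measurable_snd].
Qed.

Lemma ge0_measurable_convolution g : measurable_fun [set: R] g ->
  (forall s, 0 <= g s) -> measurable_fun [set: R] (conv g).
Proof.
move=> mg g0.
have -> : conv g = fine \o (fun t => \int[rho]_s ((fun s => (g (t - s))%:E) \_ `[0%R, t]) s)%E.
  by apply/funext => t; rewrite /convolution /Rintegral integral_mkcond.
apply: measurableT_comp; first exact: fine_measurable.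
have := measurable_fun_fubini_tonelli_F (m2 := rho) _ (measurable_convolution_integrand mg).
by apply => p; apply: erestrict_ge0 => s _; rewrite lee_fin.
Qed.

(** A bounded [g] becomes nonnegative after adding a constant. *)
Lemma measurable_convolution g M : measurable_fun [set: R] g ->
  (forall s, `|g s| <= M) -> measurable_fun [set: R] (conv g).
Proof.
move=> mg gM.
have -> : conv g = fun t => conv (fun s => g s + M) t - conv (cst M) t.
  apply/funext => t; rewrite -(convolutionB rho_fin (M := `|M| + `|M|) (N := `|M|))//.
  - by congr convolution; apply/funext => s; rewrite /= addrK.
  - exact: measurable_funD.
  - by move=> s; rewrite (le_trans (ler_normD _ _))// lerD2r (le_trans (gM s))// ler_norm.
have M0 : 0 <= M by exact: le_trans (gM 0).
apply: measurable_funB; apply: ge0_measurable_convolution => //.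
- exact: measurable_funD.
- by move=> s; have := gM s; rewrite ler_norml => /andP[]; lra.
Qed.

Section riccati.
Variables (F : R -> R) (theta : R).
Hypotheses (mF : measurable_fun [set: R] F) (theta_itv : 0 <= theta <= 2^-1).
Hypothesis F_le : forall s, `|F s| <= theta / 2.

(** On the ball of radius [theta <= 1 / 2] the Riccati operator contracts
    uniform distances by [theta]. *)
Let Phi h := conv (fun s => F s + 2^-1 * h s ^+ 2).

Let theta0 : 0 <= theta. Proof. by case/andP : theta_itv. Qed.

Let theta1 : theta <= 2^-1. Proof. by case/andP : theta_itv. Qed.

Let adm h := measurable_fun [set: R] h /\ forall s, `|h s| <= theta.

Let integrand h s := F s + 2^-1 * h s ^+ 2.

Let sqr_le h s : (forall s, `|h s| <= theta) -> h s ^+ 2 <= theta ^+ 2.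
Proof. by move=> hb; rewrite -real_normK ?num_real// lerXn2r ?nnegrE. Qed.

Let adm_integrand h : adm h ->
  measurable_fun [set: R] (integrand h) /\ forall s, `|integrand h s| <= theta.
Proof.
move=> [mh hb]; split.
  by apply: measurable_funD => //; apply: measurable_funM => //; exact: measurable_funX.
move=> s; rewrite (le_trans (ler_normD _ _))// [leRHS](splitr theta) lerD//.
have h2 := sqr_le s hb; have t0 := theta0; have t1 := theta1.
by rewrite ger0_norm; [nra|rewrite mulr_ge0// sqr_ge0].
Qed.

Let adm_Phi h : adm h -> adm (Phi h).
Proof.
move=> /adm_integrand[mi ib]; split; first exact: measurable_convolution ib.
by move=> s; exact: normr_convolution_le1.
Qed.

Let Phi_contracting h g e : adm h -> adm g -> (forall s, `|h s - g s| <= e) ->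
  forall s, `|Phi h s - Phi g s| <= e / 2.
Proof.
move=> bh bg hge s.
have [mh ih] := adm_integrand bh; have [mg ig] := adm_integrand bg.
rewrite /Phi -(convolutionB rho_fin s mh mg ih ig).
apply: normr_convolution_le1; first exact: measurable_funB.
move=> r; rewrite /integrand opprD addrACA subrr add0r -mulrBr subr_sqr normrM.
have -> : `|2^-1| = 2^-1 :> R by rewrite ger0_norm.
rewrite normrM; have [_ /(_ r) hr] := bh; have [_ /(_ r) gr] := bg.
have := hge r; have := normr_ge0 (h r - g r).
have := ler_normD (h r) (g r); have := theta1; have := normr_ge0 (h r + g r).
by nra.
Qed.

Let iter_adm n h : adm h -> adm (iter n Phi h).
Proof. by move=> bh; elim: n => //= n IH; exact: adm_Phi. Qed.

Let iter_contracting n h g : adm h -> adm g -> (forall s, `|h s - g s| <= 1) ->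
  forall s, `|iter n Phi h s - iter n Phi g s| <= 2^-1 ^+ n.
Proof.
move=> bh bg hg; elim: n => [s|n IH s /=]; first by rewrite expr0.
rewrite exprS mulrC; apply: Phi_contracting => //; exact: iter_adm.
Qed.

Lemma riccati_exists : exists h, [/\ measurable_fun [set: R] h,
  forall s, `|h s| <= theta &
  forall t, h t = conv (fun s => F s + 2^-1 * h s ^+ 2) t].
Proof.
pose H n := iter n Phi (cst 0).
have b0 : adm (cst 0) by split => // s; rewrite normr0.
have bH n : adm (H n) by exact: iter_adm.
have small h : adm h -> forall s, `|h s - 0| <= 1.
  by move=> [_ hb] s; rewrite subr0 (le_trans (hb s))//; have := theta1; lra.
have HH n m s : (n <= m)%N -> `|H m s - H n s| <= 2^-1 ^+ n.
  move=> /subnKC <-; rewrite /H iterD; apply: iter_contracting => //.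
  - exact: iter_adm.
  - by apply: small; exact: iter_adm.
have pow_harmonic n : (2^-1 : R) ^+ n <= harmonic n.
  by rewrite exprVn lef_pV2 ?posrE ?exprn_gt0// -natrX ler_nat ltn_expl.
have cH s : cvg (H n s @[n --> \oo]).
  apply: cauchy_cvg; apply: cauchy_exP => e e0.
  have [n _ hn] : \forall n \near \oo, harmonic n < e.
    move/cvgrPdist_lt : (@cvg_harmonic R) => /(_ e e0).
    by case=> N _ hN; exists N => // m /hN /=; rewrite sub0r normrN ger0_norm ?ltW ?harmonic_gt0.
  exists (H n s); exists n => // m /= nm.
  rewrite -ball_normE /ball_/= distrC (le_lt_trans (HH _ _ _ nm))// (le_lt_trans (pow_harmonic n))//.
  exact: (hn n (leqnn n)).
pose h s := lim (H n s @[n --> \oo]).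
have hH n s : `|h s - H n s| <= 2^-1 ^+ n.
  have cs : `|H m s - H n s| @[m --> \oo] --> `|h s - H n s|.
    by apply: cvg_norm; apply: cvgB; [exact: cH|exact: cvg_cst].
  rewrite -(cvg_lim _ cs)//; apply: limr_le; first by apply/cvg_ex; eexists; exact: cs.
  by exists n => // m /= nm; exact: HH.
have bh : adm h.
  split; first by apply: (@measurable_fun_cvg _ _ _ _ H) => [m|x _]; [case: (bH m)|exact: cH].
  move=> s; have cs : `|H m s| @[m --> \oo] --> `|h s| by apply: cvg_norm; exact: cH.
  rewrite -(cvg_lim _ cs)//; apply: limr_le; first by apply/cvg_ex; eexists; exact: cs.
  by apply: nearW => m; case: (bH m).
exists h; split; [by case: bh|by case: bh|move=> t].
have eq0 n : `|h t - Phi h t| <= 2 * harmonic n.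
  have := Phi_contracting (bH n) bh (fun s => _) t => /(_ (2^-1 ^+ n)) c.
  have {}c : `|H n.+1 t - Phi h t| <= 2^-1 ^+ n / 2.
    by apply: c => s; rewrite distrC.
  have := hH n.+1 t; rewrite exprS.
  have := ler_normD (h t - H n.+1 t) (H n.+1 t - Phi h t); rewrite addrA subrK.
  have := pow_harmonic n; have := @harmonic_gt0 R n; lra.
apply/eqP; rewrite -subr_eq0 -normr_eq0; apply/eqP.
have : (fun=> `|h t - Phi h t|) n @[n --> \oo] --> (0 : R).
  by apply: (@squeeze_harmonic _ 2) => n; rewrite subr0 normr_id.
by move=> /(cvg_lim (@Rhausdorff R)) <-; rewrite lim_cst//; exact: Rhausdorff.
Qed.

End riccati.

End convolution_probability.

(** * Expansion of the Riccati solution *)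

Section riccati_expansion.
Context (R : realType) (rho : probability (measurableTypeR R) R).
Variables (f : R -> R) (t : R).
Hypotheses (mf : measurable_fun [set: R] f) (f_itv : forall s, 0 <= f s <= 2^-1).
Hypothesis t0 : 0 <= t.
Implicit Types (h g : R -> R) (theta : R).
Local Notation conv g := (convolution g rho).
Local Notation L g := (convolution g (lebesgue_nonneg R) t).

Let rho_fin s : (rho `[0%R, s]%classic < +oo)%E.
Proof. by rewrite (le_lt_trans (probability_le1 _ _))// ltry. Qed.

Lemma lebesgue_nonneg_itv (s : R) : 0 <= s -> lebesgue_nonneg R `[0, s]%classic = s%:E.
Proof.
move=> s0; have -> : lebesgue_nonneg R `[0, s]%classic =
  lebesgue_measure (`[0, s]%classic `&` `[0, +oo[%classic : set R) by [].
rewrite [X in lebesgue_measure X](_ : _ = `[0, s]%classic); last first.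
  by apply/seteqP; split=> x/=; rewrite !in_itv/= andbT; [case|move=> /andP[-> ->]].
rewrite lebesgue_measure_itv/= lte_fin; case: ltgtP s0 => // [s0 _|<- _]; last by [].
by rewrite -EFinD subr0.
Qed.

Lemma lebesgue_nonneg_fin (s : R) : (lebesgue_nonneg R `[0%R, s]%classic < +oo)%E.
Proof.
have [s0|s0] := leP 0 s; first by rewrite lebesgue_nonneg_itv// ltry.
by rewrite set_itv_ge ?measure0// bnd_simp -ltNge.
Qed.

Let normr_L g M : measurable_fun [set: R] g -> (forall s, `|g s| <= M) -> `|L g| <= M * t.
Proof.
move=> mg gM; have := normr_convolution_le lebesgue_nonneg_fin t mg gM.
by rewrite lebesgue_nonneg_itv.
Qed.

(** A Riccati solution for the test function [- theta f], defined on the whole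
    line and bounded by [theta]; both make the estimates below uniform. *)
Definition is_riccati theta h := [/\ measurable_fun [set: R] h,
  forall s, `|h s| <= theta &
  forall s, h s = conv (fun u => - (theta * f u) + 2^-1 * h u ^+ 2) s].

Lemma is_riccati_exists theta : 0 <= theta <= 2^-1 -> exists h, is_riccati theta h.
Proof.
move=> th; apply: riccati_exists => //.
  by apply: measurable_funN; exact: measurable_funM.
move=> s; have /andP[f0 f1] := f_itv s; case/andP: th => th0 _.
by rewrite normrN ger0_norm ?mulr_ge0// ler_wpM2l.
Qed.

Let f_norm s : `|f s| <= 2^-1.
Proof. by have /andP[f0 f1] := f_itv s; rewrite ger0_norm. Qed.

Let q_norm s : `|conv f s| <= 2^-1.
Proof. exact: normr_convolution_le1. Qed.

Let mq : measurable_fun [set: R] (conv f).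
Proof. exact: measurable_convolution f_norm. Qed.

Let sqr_norm h M : (forall s, `|h s| <= M) -> forall s, `|h s ^+ 2| <= M ^+ 2.
Proof.
move=> hM s; rewrite normrX lerXn2r ?nnegrE//.
by rewrite (le_trans _ (hM 0)).
Qed.

Let riccatiE theta h : is_riccati theta h -> forall s,
  h s = - theta * conv f s + 2^-1 * conv (fun u => h u ^+ 2) s.
Proof.
move=> [mh hb hE] s; rewrite {1}hE.
have mh2 : measurable_fun [set: R] (fun u => h u ^+ 2) by exact: measurable_funX.
rewrite (convolutionD (M := `|- theta| * 2^-1) (N := 2^-1 * theta ^+ 2) rho_fin).
- rewrite -(convolutionZ rho_fin (- theta) s mf f_norm).
  rewrite -(convolutionZ rho_fin (2^-1) s mh2 (sqr_norm hb)).
  by under eq_fun do rewrite -mulNr.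
- by apply: measurable_funN; exact: measurable_funM.
- exact: measurable_funM.
- by move=> u; rewrite -mulNr normrM ler_wpM2l.
- by move=> u; rewrite normrM ger0_norm// ler_wpM2l// sqr_norm.
Qed.

Let riccati_first theta h : is_riccati theta h -> forall s,
  `|h s + theta * conv f s| <= theta ^+ 2 / 2.
Proof.
move=> hr s; have [mh hb hE] := hr.
rewrite (riccatiE hr) addrAC mulNr addNr add0r normrM ger0_norm// mulrC ler_wpM2r//.
by apply: normr_convolution_le1; [exact: measurable_funX|exact: sqr_norm].
Qed.

Let riccati_sqr theta h : is_riccati theta h -> forall s,
  `|h s ^+ 2 - theta ^+ 2 * conv f s ^+ 2| <= 3 / 4 * theta ^+ 3.
Proof.
move=> hr s; have [_ hb _] := hr; rewrite -exprMn subr_sqr mulrC normrM.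
have := riccati_first hr s; have := hb s; have := q_norm s.
have th0 : 0 <= theta by rewrite (le_trans _ (hb 0)).
have : `|h s - theta * conv f s| <= `|h s| + theta * `|conv f s|.
  by rewrite (le_trans (ler_normB _ _))// normrM (ger0_norm th0).
have := normr_ge0 (h s - theta * conv f s); have := normr_ge0 (h s + theta * conv f s).
set A := `|h s - _|; set B := `|h s + _|; set x := `|h s|; set y := `|conv f s| => B0 A0 h1 h2 h3 h4.
have A1 : A <= 3 / 2 * theta by nra.
apply: (@le_trans _ _ ((theta ^+ 2 / 2) * (3 / 2 * theta))); first exact: ler_pM.
by rewrite le_eqVlt; apply/orP; left; apply/eqP; field.
Qed.

(** To first order in [theta] the solution is [- theta (f * rho)]. *)
Lemma riccati_integral_first theta h : is_riccati theta h ->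
  `|L h + theta * L (conv f)| <= theta ^+ 2 / 2 * t.
Proof.
move=> hr; have [mh hb _] := hr.
rewrite -(convolutionZ lebesgue_nonneg_fin theta t mq q_norm).
rewrite -(convolutionD (N := `|theta| * 2^-1) lebesgue_nonneg_fin t mh _ hb).
- apply: normr_L; last exact: riccati_first.
  by apply: measurable_funD => //; exact: measurable_funM.
- exact: measurable_funM.
- by move=> s; rewrite normrM ler_wpM2l.
Qed.

(** The terms linear in [theta] cancel in the combination [h2 - 2 h1], which
    leaves the quadratic term of the Riccati equation. *)
Lemma riccati_integral_second theta h1 h2 : is_riccati theta h1 ->
  is_riccati (2 * theta) h2 ->
  `|L h2 - 2 * L h1 - theta ^+ 2 * L (conv (fun s => conv f s ^+ 2))| <= 4 * theta ^+ 3 * t.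
Proof.
move=> r1 r2; have [mh1 hb1 _] := r1; have [mh2 hb2 _] := r2.
have th0 : 0 <= theta by rewrite (le_trans _ (hb1 0)).
have mq2 : measurable_fun [set: R] (fun s => conv f s ^+ 2) by exact: measurable_funX.
have q2b : forall s, `|conv f s ^+ 2| <= 2^-1 ^+ 2 by exact: sqr_norm.
have mcq2 := measurable_convolution rho mq2 q2b.
have cq2b s : `|conv (fun s => conv f s ^+ 2) s| <= 2^-1 ^+ 2 by exact: normr_convolution_le1.
rewrite -(convolutionZ lebesgue_nonneg_fin 2 t mh1 hb1).
rewrite -(convolutionZ lebesgue_nonneg_fin (theta ^+ 2) t mcq2 cq2b).
rewrite -(convolutionB (N := 2 * theta) lebesgue_nonneg_fin t mh2 _ hb2); last 2 first.
- exact: measurable_funM.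
- by move=> s; rewrite normrM ger0_norm// ler_wpM2l.
rewrite -(convolutionB (M := 4 * theta) (N := theta ^+ 2 * 2^-1 ^+ 2) lebesgue_nonneg_fin); last 4 first.
- by apply: measurable_funB => //; exact: measurable_funM.
- exact: measurable_funM.
- move=> s; rewrite (le_trans (ler_normB _ _))// normrM ger0_norm//.
  by have := hb1 s; have := hb2 s; lra.
- by move=> s; rewrite normrM ger0_norm ?sqr_ge0// ler_wpM2l ?sqr_ge0.
apply: normr_L.
  by apply: measurable_funB; [apply: measurable_funB => //|]; exact: measurable_funM.
move=> s.
pose e1 u := h1 u ^+ 2 - theta ^+ 2 * conv f u ^+ 2.
pose e2 u := h2 u ^+ 2 - (2 * theta) ^+ 2 * conv f u ^+ 2.
have me1 : measurable_fun [set: R] e1.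
  by apply: measurable_funB; [exact: measurable_funX|exact: measurable_funM].
have me2 : measurable_fun [set: R] e2.
  by apply: measurable_funB; [exact: measurable_funX|exact: measurable_funM].
have ce1 : conv e1 s = conv (fun u => h1 u ^+ 2) s - theta ^+ 2 * conv (fun u => conv f u ^+ 2) s.
  rewrite /e1 (convolutionB (M := theta ^+ 2) (N := theta ^+ 2 * 2^-1 ^+ 2) rho_fin)//.
  - by rewrite (convolutionZ rho_fin _ _ mq2 q2b).
  - exact: measurable_funX.
  - exact: measurable_funM.
  - exact: sqr_norm.
  - by move=> u; rewrite normrM ger0_norm ?sqr_ge0// ler_wpM2l ?sqr_ge0.
have ce2 : conv e2 s = conv (fun u => h2 u ^+ 2) s - (2 * theta) ^+ 2 * conv (fun u => conv f u ^+ 2) s.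
  rewrite /e2 (convolutionB (M := (2 * theta) ^+ 2) (N := (2 * theta) ^+ 2 * 2^-1 ^+ 2) rho_fin)//.
  - by rewrite (convolutionZ rho_fin _ _ mq2 q2b).
  - exact: measurable_funX.
  - exact: measurable_funM.
  - exact: sqr_norm.
  - by move=> u; rewrite normrM ger0_norm ?sqr_ge0// ler_wpM2l ?sqr_ge0.
have -> : h2 s - 2 * h1 s - theta ^+ 2 * conv (fun u => conv f u ^+ 2) s =
    2^-1 * conv e2 s - conv e1 s.
  by rewrite ce1 ce2 (riccatiE r1) (riccatiE r2); field.
have b1 := normr_convolution_le1 rho s me1 (riccati_sqr r1).
have b2 := normr_convolution_le1 rho s me2 (riccati_sqr r2).
rewrite (le_trans (ler_normB _ _))// normrM ger0_norm//.
have th3 : 0 <= theta ^+ 3 by exact: exprn_ge0.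
have e23 : (2 * theta) ^+ 3 = 8 * theta ^+ 3 by ring.
by rewrite e23 in b2; lra.
Qed.

End riccati_expansion.

(** For [X >= 0] with [E exp (- theta X) = exp L1], [E exp (- 2 theta X) = exp L2],
    the quantity below is [E ((1 - exp (- theta X)) / theta) ^ 2]; the two
    expansions pin it between [v] and [m ^ 2 + v], up to [O(theta)]. *)
Lemma second_difference_bounds (R : realType) (L1 L2 m v t theta : R) :
  0 <= m -> 0 <= v -> 0 <= t -> 0 < theta <= 1 -> L1 <= 0 ->
  `|L1 + theta * m| <= theta ^+ 2 / 2 * t ->
  `|L2 - 2 * L1 - theta ^+ 2 * v| <= 4 * theta ^+ 3 * t ->
  let K := (v + 4 * t) * expR (v + 4 * t) in
  let a := (1 - 2 * expR L1 + expR L2) / theta ^+ 2 in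
  v - (v * (2 * m + t) + 4 * t) * theta <= a /\
  a <= m ^+ 2 + v + (m * t + t ^+ 2 + (4 * t + K * (v + 4 * t))) * theta.
Proof.
move=> m0 v0 t0 /andP[th0 th1] L10.
move=> hL1 hL2 K a.
have /andP[a1 a2] : - (theta ^+ 2 / 2 * t) <= L1 + theta * m <= theta ^+ 2 / 2 * t.
  by rewrite -ler_norml.
have /andP[b1 b2] : - (4 * theta ^+ 3 * t) <= L2 - 2 * L1 - theta ^+ 2 * v <= 4 * theta ^+ 3 * t.
  by rewrite -ler_norml.
have th2 : 0 < theta ^+ 2 by exact: exprn_gt0.
pose D := L2 - 2 * L1.
have aE : a = (((1 - expR L1) ^+ 2 + expR L1 ^+ 2 * (expR D - 1)) / theta ^+ 2).
  rewrite /a; congr (_ / _).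
  have -> : expR L2 = expR L1 ^+ 2 * expR D.
    by rewrite -expRM_natl -expRD /D; congr expR; ring.
  by ring.
have e0 : 0 < expR L1 by exact: expR_gt0.
have e1 : expR L1 <= 1 by rewrite -[leRHS]expR0 ler_expR.
have e_sqr : 0 <= expR L1 ^+ 2 <= 1 by rewrite sqr_ge0/= expr_le1// ltW.
have D_ge : D <= expR D - 1 by have := expR_ge1Dx D; lra.
have th3 : theta ^+ 3 = theta ^+ 2 * theta by ring.
have Dlow : theta ^+ 2 * (v - 4 * t * theta) <= D by rewrite /D; nra.
have Dup : D <= theta ^+ 2 * (v + 4 * t * theta) by rewrite /D; nra.
have L1low : 1 - theta * (2 * m + t) <= expR L1 ^+ 2.
  have -> : expR L1 ^+ 2 = expR (2 * L1) by rewrite -expRM_natl.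
  have := expR_ge1Dx (2 * L1).
  have : theta ^+ 2 <= theta by nra.
  by nra.
rewrite aE; split.
  rewrite ler_pdivlMr//.
  set e := expR L1 ^+ 2 in e_sqr L1low *; case/andP: e_sqr => es0 es1.
  have h1 : e * (theta ^+ 2 * (v - 4 * t * theta)) <= e * (expR D - 1).
    by rewrite ler_wpM2l// (le_trans Dlow).
  have h2 : 0 <= (1 - expR L1) ^+ 2 by exact: sqr_ge0.
  have h3 : (v - (v * (2 * m + t) + 4 * t) * theta) <= e * (v - 4 * t * theta).
    have h4 : (1 - theta * (2 * m + t)) * v <= e * v by rewrite ler_wpM2r.
    have h5 : e * (4 * t * theta) <= 4 * t * theta.
      by rewrite ler_piMl// !mulr_ge0// ltW.
    by lra.
  have h6 : (v - (v * (2 * m + t) + 4 * t) * theta) * theta ^+ 2 <= e * (v - 4 * t * theta) * theta ^+ 2.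
    by rewrite ler_wpM2r// ltW.
  by lra.
rewrite ler_pdivrMr//.
pose B := theta ^+ 2 * (v + 4 * t * theta).
pose c := v + 4 * t.
have c0 : 0 <= c by rewrite addr_ge0// mulr_ge0.
have B0 : 0 <= B by rewrite mulr_ge0 ?(ltW th2)// addr_ge0// !mulr_ge0// ltW.
have th21 : theta ^+ 2 <= theta by nra.
have vc : v + 4 * t * theta <= c by rewrite /c; nra.
have Bc : B <= theta * c.
  by rewrite /B ler_pM ?(ltW th2)// addr_ge0// !mulr_ge0// ltW.
have Bc1 : B <= c by apply: le_trans Bc _; rewrite ler_piMl.
have expB (x : R) : expR x <= 1 + x * expR x.
  have := expR_ge1Dx (- x); rewrite expRN => h.
  have : (1 + - x) * expR x <= (expR x)^-1 * expR x by rewrite ler_wpM2r ?expR_ge0.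
  by rewrite mulVf ?expR_eq0//; lra.
have eBK : expR B <= 1 + theta * K.
  rewrite (le_trans (expB B))// lerD2l /K -/c mulrA.
  by rewrite ler_pM ?expR_ge0// ler_expR.
have h1 : expR D - 1 <= B * (1 + theta * K).
  have : expR D <= expR B by rewrite ler_expR.
  have := expB B; have : B * expR B <= B * (1 + theta * K) by rewrite ler_wpM2l.
  by lra.
have K0 : 0 <= K by rewrite mulr_ge0 ?expR_ge0.
have h2 : expR L1 ^+ 2 * (expR D - 1) <= B * (1 + theta * K).
  have h0 : 0 <= B * (1 + theta * K) by rewrite mulr_ge0// addr_ge0// mulr_ge0// ltW.
  case/andP: e_sqr => es0 es1.
  have [D0|D0] := leP 0 (expR D - 1).
    by apply: le_trans h1; rewrite ler_piMl.
  by apply: le_trans h0; rewrite mulr_ge0_le0// ltW.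
have h3 : (1 - expR L1) ^+ 2 <= (theta * m + theta ^+ 2 / 2 * t) ^+ 2.
  have := expR_ge1Dx L1 => h.
  rewrite lerXn2r ?nnegrE ?subr_ge0//; last by lra.
  by rewrite addr_ge0// !mulr_ge0// ?ltW.
have h4 : (theta * m + theta ^+ 2 / 2 * t) ^+ 2 <= (m ^+ 2 + (m * t + t ^+ 2) * theta) * theta ^+ 2.
  have -> : (theta * m + theta ^+ 2 / 2 * t) ^+ 2 =
    (m ^+ 2 + m * t * theta + t ^+ 2 / 4 * theta ^+ 2) * theta ^+ 2 by field.
  rewrite ler_wpM2r ?(ltW th2)//.
  have tt : t ^+ 2 / 4 * theta ^+ 2 <= t ^+ 2 * theta.
    apply: ler_pM => //; rewrite ?divr_ge0 ?sqr_ge0//.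
    by have := sqr_ge0 t; lra.
  by lra.
have h5 : B * (1 + theta * K) <= (v + (4 * t + K * (v + 4 * t)) * theta) * theta ^+ 2.
  rewrite /B -mulrA mulrC ler_wpM2r ?(ltW th2)//.
  have : (v + 4 * t * theta) * (theta * K) <= c * (theta * K).
    by rewrite ler_wpM2r// mulr_ge0// ltW.
  by rewrite /c; lra.
lra.
Qed.

(** * Second moments of a Feller random measure *)

Section second_moment.
Context (R : realType) (rho : probability (measurableTypeR R) R).
Context (d : measure_display) (T : measurableType d) (P : probability T R).
Variable xi : R.-ker T ~> (measurableTypeR R).
Hypothesis xiF : feller_random_measure P (lebesgue_nonneg R) rho xi.
Variables (f : R -> R) (t : R).
Hypotheses (cf : continuous f) (f_itv : forall s, 0 <= f s <= 2^-1) (f00 : f 0 = 0).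
Hypothesis t0 : 0 <= t.
Local Notation X w := (convolution f (xi w) t).
Local Notation L g := (convolution g (lebesgue_nonneg R) t).
Local Notation q := (convolution f rho).

Let mf : measurable_fun [set: R] f.
Proof. exact: continuous_measurable_fun. Qed.

Let f_norm s : `|f s| <= 2^-1.
Proof. by have /andP[f0 f1] := f_itv s; rewrite ger0_norm. Qed.

Let xi_fin w s : (xi w `[0%R, s]%classic < +oo)%E.
Proof. by have [/(_ w)[]] := xiF. Qed.

Let X_ge0 w : 0 <= X w.
Proof. by apply: convolution_ge0 => s; have /andP[] := f_itv s. Qed.

Lemma measurable_random_convolution : measurable_fun [set: T] (fun w => X w).
Proof.
have -> : (fun w => X w) = fine \o
   (fun w => \int[xi w]_s ((fun s => (f (t - s))%:E) \_ `[0%R, t]) s)%E.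
  by apply/funext => w; rewrite /convolution /Rintegral integral_mkcond.
apply: measurableT_comp; first exact: fine_measurable.
apply: measurable_fun_integral_kernel.
- by move=> U mU; exact: measurable_kernel.
- by apply: erestrict_ge0 => s _; rewrite lee_fin; have /andP[] := f_itv (t - s).
- apply/(measurable_restrictT _ _).1 => //; apply: measurable_funTS.
  by apply/measurable_EFinP; apply: (measurableT_comp mf); exact: measurable_funB.
Qed.

Let mX := measurable_random_convolution.

Lemma laplace_random_convolution theta h : 0 <= theta <= 2^-1 ->
  is_riccati rho f theta h ->
  (\int[P]_w (expR (- (theta * X w)))%:E = (expR (L h))%:E)%E.
Proof.
move=> /andP[th0 th1] [mh hb hE]; have [_ xiE] := xiF.
have test : test_function (fun s => - (theta * f s)).
  split.
  - apply: continuous_subspaceT => s; apply: cvgN; apply: cvgMr; exact: cf.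
  - by rewrite f00 mulr0 oppr0.
  - move=> s _; rewrite normrN normrM ger0_norm//.
    by have := f_norm s; have := normr_ge0 (f s); nra.
have ric : riccati_solution rho (fun s => - (theta * f s)) h.
  split.
  - exact: measurable_funTS.
  - move=> s; exists theta; split; first by rewrite num_real.
    by move=> y thy u _ /=; rewrite (le_trans (hb u))// ltW.
  - by move=> s _; rewrite {1}hE.
have := xiE _ _ test ric t t0; rewrite unlock => <-.
apply: eq_integral => w _; congr (expR _)%:E.
rewrite -mulNr -(convolutionZ (xi_fin w) (- theta) t mf f_norm).
by congr convolution; apply/funext => s; rewrite mulNr.
Qed.

Let Z theta w := (1 - expR (- (theta * X w))) ^+ 2.

Let mexp theta : measurable_fun [set: T] (fun w => expR (- (theta * X w))).
Proof.
by apply: measurableT_comp => //; apply: measurable_funN; exact: measurable_funM.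
Qed.

Let mZ theta : measurable_fun [set: T] (Z theta).
Proof. by apply: measurable_funX; exact: measurable_funB. Qed.

Let integral_Z theta h1 h2 : 0 <= theta <= 4^-1 ->
  is_riccati rho f theta h1 -> is_riccati rho f (2 * theta) h2 ->
  (\int[P]_w (Z theta w)%:E = (1 - 2 * expR (L h1) + expR (L h2))%:E)%E.
Proof.
move=> /andP[th0 th1] r1 r2.
have E1 : (\int[P]_w (expR (- (theta * X w)))%:E = (expR (L h1))%:E)%E.
  by apply: laplace_random_convolution r1; rewrite th0/=; lra.
have E2 : (\int[P]_w (expR (- ((2 * theta) * X w)))%:E = (expR (L h2))%:E)%E.
  by apply: laplace_random_convolution r2; apply/andP; split; lra.
have : (\int[P]_w ((Z theta w)%:E + 2%:E * (expR (- (theta * X w)))%:E) =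
        \int[P]_w (1%:E + (expR (- ((2 * theta) * X w)))%:E))%E.
  apply: eq_integral => w _; rewrite -EFinM -!EFinD; congr _%:E.
  have -> : expR (- ((2 * theta) * X w)) = expR (- (theta * X w)) ^+ 2.
    by rewrite -expRM_natl; congr expR; ring.
  by rewrite /Z; ring.
have mE (g : T -> R) : measurable_fun [set: T] g -> measurable_fun [set: T] (fun w => (g w)%:E).
  by move=> mg; exact/measurable_EFinP.
rewrite ge0_integralD//; last 3 first.
- by move=> w _; rewrite lee_fin sqr_ge0.
- exact: mE.
- by apply: emeasurable_funM => //; exact: mE.
rewrite ge0_integralZl//; last by exact: mE.
rewrite ge0_integralD//; last by exact: mE.
rewrite E1 E2 integral_cst// [V in (1 * V)%E](_ : _ = 1%E) ?mule1; last exact: probability_setT.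
move=> /(congr1 (fun y => y - (2%:E * (expR (L h1))%:E))%E).
by rewrite addeK// => ->; rewrite -EFinM -!EFinD -?EFinB; congr _%:E; ring.
Qed.

Let m := L q.

Let v := L (convolution (fun s => q s ^+ 2) rho).

Let q_norm s : `|q s| <= 2^-1.
Proof. exact: normr_convolution_le1. Qed.

Let q_ge0 s : 0 <= q s.
Proof. by apply: convolution_ge0 => u; have /andP[] := f_itv u. Qed.

Let m_ge0 : 0 <= m. Proof. exact: convolution_ge0. Qed.

Let v_ge0 : 0 <= v.
Proof.
by apply: convolution_ge0 => u; apply: convolution_ge0 => s; rewrite sqr_ge0.
Qed.

(** The quotients [((1 - exp (- theta X)) / theta) ^ 2], [theta = 1 / (4 (n + 1))],
    are below [X ^ 2] and converge to it. *)
Let theta n : R := 4^-1 * harmonic n.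

Let theta_gt0 n : 0 < theta n. Proof. by rewrite mulr_gt0 ?harmonic_gt0. Qed.

Let theta_le n : theta n <= 4^-1.
Proof. by rewrite ler_piMr// invf_le1// ler1n. Qed.

Let a n := (\int[P]_w (Z (theta n) w / theta n ^+ 2)%:E)%E.

Let a_bounds : exists2 C : R, 0 <= C & forall n,
  ((v - C * theta n)%:E <= a n <= (m ^+ 2 + v + C * theta n)%:E)%E.
Proof.
pose K := (v + 4 * t) * expR (v + 4 * t).
pose C1 := v * (2 * m + t) + 4 * t.
pose C2 := m * t + t ^+ 2 + (4 * t + K * (v + 4 * t)).
have K0 : 0 <= K by rewrite mulr_ge0 ?expR_ge0// addr_ge0// mulr_ge0.
have C10 : 0 <= C1 by rewrite addr_ge0// mulr_ge0// addr_ge0// mulr_ge0.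
have C20 : 0 <= C2.
  by rewrite !addr_ge0 ?sqr_ge0// mulr_ge0// ?addr_ge0// mulr_ge0.
exists (C1 + C2); first exact: addr_ge0.
move=> n; have th0 := theta_gt0 n; have th4 := theta_le n.
have [h1 r1] : exists h, is_riccati rho f (theta n) h.
  by apply: is_riccati_exists => //; apply/andP; split; lra.
have [h2 r2] : exists h, is_riccati rho f (2 * theta n) h.
  by apply: is_riccati_exists => //; apply/andP; split; lra.
have th_itv : 0 <= theta n <= 4^-1 by rewrite (ltW th0).
have aE : a n = ((1 - 2 * expR (L h1) + expR (L h2)) / theta n ^+ 2)%:E.
  rewrite EFinM -(integral_Z th_itv r1 r2) /a.
  under eq_integral do rewrite EFinM.
  rewrite ge0_integralZr//.
  - exact/measurable_EFinP.
  - by move=> w _; rewrite lee_fin sqr_ge0.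
  - by rewrite lee_fin invr_ge0 sqr_ge0.
have L10 : L h1 <= 0.
  rewrite -ler_expR expR0 -lee_fin -(laplace_random_convolution _ r1); last first.
    by apply/andP; split; lra.
  apply: (@le_trans _ _ (\int[P]_w (cst 1%E w))%E).
    apply: ge0_le_integral => //.
    - exact/measurable_EFinP.
    - by move=> w _; rewrite lee_fin -[leRHS]expR0 ler_expR oppr_le0 mulr_ge0// ltW.
  by rewrite integral_cst// mul1e; exact: probability_le1.
have th1 : 0 < theta n <= 1 by rewrite th0/=; lra.
have := second_difference_bounds m_ge0 v_ge0 t0 th1 L10
  (riccati_integral_first mf f_itv t0 r1) (riccati_integral_second mf f_itv t0 r1 r2).
rewrite /= -/K -/C1 -/C2 => -[b1 b2].
rewrite aE !lee_fin; apply/andP; split.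
  by apply: le_trans b1; rewrite lerD2l lerN2 ler_wpM2r ?(ltW th0)// lerDl.
by apply: (le_trans b2); rewrite lerD2l ler_wpM2r ?(ltW th0)// lerDr.
Qed.

Let theta_cvg (b C : R) : b + C * theta n @[n --> \oo] --> b.
Proof.
apply: (@squeeze_harmonic _ (`|C| * 4^-1)) => n.
by rewrite addrAC subrr add0r normrM (ger0_norm (ltW (theta_gt0 n))) /theta mulrA.
Qed.

(** The expectation of [X ^ 2] exceeds every [a n], and these are at least
    [v - O (theta n)]. *)
Lemma second_moment_ge : (v%:E <= \int[P]_w (X w ^+ 2)%:E)%E.
Proof.
have [C C0 aC] := a_bounds.
have aX n : (a n <= \int[P]_w (X w ^+ 2)%:E)%E.
  apply: ge0_le_integral => //.
  - by move=> w _; rewrite lee_fin divr_ge0 ?sqr_ge0.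
  - by apply/measurable_EFinP; exact: measurable_funM.
  - by apply/measurable_EFinP; exact: measurable_funX.
  - move=> w _; rewrite lee_fin ler_pdivrMr ?exprn_gt0// -exprMn.
    have tX : 0 <= theta n * X w by rewrite mulr_ge0// ltW.
    rewrite lerXn2r ?nnegrE//.
    - by rewrite subr_ge0 -[leRHS]expR0 ler_expR oppr_le0.
    - by rewrite mulr_ge0// ltW.
    - by have := expR_ge1Dx (- (theta n * X w)); rewrite mulrC; lra.
have [->|fin] := eqVneq (\int[P]_w (X w ^+ 2)%:E)%E +oo%E; first by rewrite leey.
have E0 : (0 <= \int[P]_w (X w ^+ 2)%:E)%E.
  by apply: integral_ge0 => w _; rewrite lee_fin sqr_ge0.
have Efin : (\int[P]_w (X w ^+ 2)%:E)%E \is a fin_num by rewrite ge0_fin_numE// ltey.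
rewrite -(fineK Efin) lee_fin.
have cv := @theta_cvg v (- C).
rewrite -(cvg_lim (@Rhausdorff R) cv); apply: limr_le; first by apply/cvg_ex; eexists; exact: cv.
apply: nearW => n; rewrite -lee_fin (fineK Efin); apply: le_trans (aX n).
by have /andP[+ _] := aC n; rewrite mulNr.
Qed.

(** Fatou's lemma for the quotients whose expectations are the [a n]. *)
Lemma second_moment_le : (\int[P]_w (X w ^+ 2)%:E <= (m ^+ 2 + v)%:E)%E.
Proof.
have [C C0 aC] := a_bounds.
have lim_Z w : (Z (theta n) w / theta n ^+ 2)%:E @[n --> \oo] --> (X w ^+ 2)%:E.
  pose u n := (1 - expR (- (theta n * X w))) / theta n.
  have cu : u n @[n --> \oo] --> X w.
    apply: (@squeeze_harmonic _ (X w ^+ 2 * 4^-1)) => n.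
    set y := theta n * X w; have y0 : 0 <= y by rewrite mulr_ge0// ltW.
    have th0 := theta_gt0 n.
    have e1 := expR_ge1Dx (- y).
    have e2 : expR (- y) <= 1 - y + y ^+ 2.
      have := expR_ge1Dx y => ey; have ey0 : 0 < expR y by exact: expR_gt0.
      rewrite expRN -[leLHS]mul1r ler_pdivrMr//.
      apply: (@le_trans _ _ ((1 - y + y ^+ 2) * (1 + y))); first by nra.
      by rewrite ler_wpM2l//; nra.
    have -> : u n - X w = - ((expR (- y) - (1 - y)) / theta n).
      by rewrite /u /y; field; rewrite gt_eqF.
    rewrite normrN ger0_norm ?divr_ge0 ?(ltW th0)//; last by lra.
    rewrite ler_pdivrMr//; apply: (@le_trans _ _ (y ^+ 2)); first by lra.
    by rewrite le_eqVlt; apply/orP; left; apply/eqP; rewrite /y /theta; ring.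
  rewrite (_ : (fun n => _) = (fun n => (u n * u n)%:E)); last first.
    by apply/funext => n; rewrite /u /Z; congr _%:E; field; rewrite gt_eqF.
  by apply: cvg_EFin; [exact: nearW|rewrite expr2; exact: cvgM].
have -> : (\int[P]_w (X w ^+ 2)%:E = \int[P]_w limn_einf (fun n => (Z (theta n) w / theta n ^+ 2)%:E))%E.
  by apply: eq_integral => w _; rewrite (cvg_limn_einf_sup (lim_Z w)).1.
apply: le_trans (fatou _ _ _ _) _ => //.
- by move=> n; apply/measurable_EFinP; exact: measurable_funM.
- by move=> n w _; rewrite lee_fin divr_ge0 ?sqr_ge0.
have cv : (m ^+ 2 + v + C * theta n)%:E @[n --> \oo] --> (m ^+ 2 + v)%:E.
  by apply: cvg_EFin; [exact: nearW|exact: theta_cvg].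
rewrite -(cvg_limn_einf_sup cv).1.
apply: lee_limn_einf => n.
by have /andP[] := aC n.
Qed.

End second_moment.

Section iterated_convolution.
Context (R : realType) (rho : probability (measurableTypeR R) R).
Variables (g : R -> R) (M t : R).
Hypotheses (mg : measurable_fun [set: R] g) (g0 : forall s, 0 <= g s).
Hypotheses (gM : forall s, `|g s| <= M) (t0 : 0 <= t).
Local Notation leb := (@lebesgue_measure R).

Lemma EFin_convolution_lebesgue (k : R -> R) : measurable_fun [set: R] k ->
  (forall s, 0 <= k s) -> (forall s, `|k s| <= M) ->
  ((convolution k (lebesgue_nonneg R) t)%:E = \int[leb]_(r in `[0%R, t]) (k r)%:E)%E.
Proof.
move=> mk k0 kM.
rewrite (EFin_convolution (@lebesgue_nonneg_fin R) t mk kM).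
rewrite (eq_measure_integral leb); last first.
  move=> A mA At.
  have -> : lebesgue_nonneg R A = leb (A `&` `[0, +oo[%classic) by [].
  by rewrite setIidl// => x /At/=; rewrite !in_itv/= andbT => /andP[].
have mkE (D : set R) : measurable_fun D (fun r => (k r)%:E).
  by apply/measurable_EFinP; exact: measurable_funTS.
rewrite integral_mkcond [RHS]integral_mkcond -[RHS](integral_reflect t); first last.
- by move=> x; apply: erestrict_ge0 => r _; rewrite lee_fin.
- by apply/(measurable_restrictT _ _).1 => //; exact: mkE.
apply: eq_integral => s _; rewrite !patchE !mem_setE !in_itv/=.
by rewrite subr_ge0 gerBl andbC.
Qed.

Let F (p : measurableTypeR R * measurableTypeR R) : \bar R :=
  (((fun s => (g (p.1 - s))%:E) \_ `[0%R, p.1]) p.2 * (\1_(`[0, t]%classic : set R) p.1)%:E)%E.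

Let F0 p : (0 <= F p)%E.
Proof.
by rewrite mule_ge0 ?lee_fin//; apply: erestrict_ge0 => s _; rewrite lee_fin.
Qed.

Let mF : measurable_fun setT F.
Proof.
apply: emeasurable_funM; first exact: measurable_convolution_integrand.
apply/measurable_EFinP.
apply: (@measurableT_comp _ _ _ _ _ _ (\1_(`[0, t]%classic : set R) : R -> R)).
  by apply: measurable_indic; exact: measurable_itv.
exact: measurable_fst.
Qed.

Let rho_fin s : (rho `[0%R, s]%classic < +oo)%E.
Proof. by rewrite (le_lt_trans (probability_le1 _ _))// ltry. Qed.

Let iterated : ((convolution (convolution g rho) (lebesgue_nonneg R) t)%:E =
  \int[rho]_u \int[leb]_r F (r, u))%E.
Proof.
rewrite EFin_convolution_lebesgue; first last.
- by move=> s; exact: normr_convolution_le1.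
- by move=> s; exact: convolution_ge0.
- exact: measurable_convolution gM.
transitivity (\int[leb]_r \int[rho]_u F (r, u))%E; last exact: fubini_tonelli.
rewrite integral_mkcond; apply: eq_integral => r _; rewrite patchE.
have mr : measurable_fun [set: R] ((fun s => (g (r - s))%:E) \_ `[0, r]).
  apply/(measurable_restrictT _ _).1 => //; apply: measurable_funTS.
  by apply/measurable_EFinP; apply: (measurableT_comp mg); exact: measurable_funB.
rewrite /F/= ge0_integralZr//; last first.
  by move=> s _; apply: erestrict_ge0 => u _; rewrite lee_fin.
rewrite -integral_mkcond -(EFin_convolution rho_fin r mg gM) indicE.
by case: ifPn => _; rewrite ?mule1 ?mule0.
Qed.

Let mgE (D : set R) : measurable_fun D (fun r => (g r)%:E).
Proof. by apply/measurable_EFinP; exact: measurable_funTS. Qed.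

Let G (D : set R) : R -> \bar R := (fun r => (g r)%:E) \_ D.

Let G0 D r : (0 <= G D r)%E.
Proof. by apply: erestrict_ge0 => s _; rewrite lee_fin. Qed.

Let mG (D : set R) : measurable D -> measurable_fun [set: R] (G D).
Proof. by move=> mD; apply/(measurable_restrictT _ _).1. Qed.

Let mF1 u : measurable_fun [set: R] (fun r => F (r, u)).
Proof. exact: measurableT_comp mF (pair2_measurable u). Qed.

Let mFint : measurable_fun [set: R] (fun u => \int[leb]_r F (r, u))%E.
Proof. exact: measurable_fun_fubini_tonelli_G. Qed.

(** After exchanging the integrals, each [u] charged by [rho] contributes the
    integral of [g] over the interval from [0] to [t - u]. *)
Lemma iterated_convolution_le :
  ((convolution (convolution g rho) (lebesgue_nonneg R) t)%:E <=
   \int[leb]_(r in `[0%R, t]) (g r)%:E)%E.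
Proof.
rewrite iterated.
have I0 : (0 <= \int[leb]_(r in `[0%R, t]) (g r)%:E)%E.
  by apply: integral_ge0 => r _; rewrite lee_fin.
apply: (@le_trans _ _ (\int[rho]_u cst (\int[leb]_(r in `[0%R, t]) (g r)%:E) u)%E).
  apply: ge0_le_integral => //.
  - by move=> u _; exact: integral_ge0.
  move=> u _; rewrite /cst.
  have mI : measurable (`[0, t]%classic : set R) by exact: measurable_itv.
  rewrite [leRHS]integral_mkcond -(integral_shift u (mG mI) (G0 _)).
  apply: ge0_le_integral => //.
  - exact: mF1.
  - by apply: (measurableT_comp (mG mI)); exact: measurable_funB.
  - move=> r _; rewrite /F/= patchE mem_setE in_itv/= indicE mem_setE in_itv/=.
    case: ifPn => [/andP[u0 ur]|_]; last by rewrite mul0e.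
    have [/andP[r0 rt]|] := boolP (0 <= r <= t); last by rewrite mule0.
    rewrite mule1 /G patchE mem_setE in_itv/= ifT// subr_ge0 ur/=.
    by rewrite (le_trans _ rt)// gerBl.
rewrite integral_cst//= -[leRHS]mule1 lee_wpmul2l//; exact: probability_le1.
Qed.

(** Only the [u] up to [1 / 2] are kept: for these the interval from [0] to
    [t - u] contains the one from [0] to [t - 1 / 2]. *)
Lemma iterated_convolution_ge :
  (rho `[0%R, (2^-1)%R]%classic * \int[leb]_(r in `[0%R, (t - 2^-1)%R]) (g r)%:E <=
   (convolution (convolution g rho) (lebesgue_nonneg R) t)%:E)%E.
Proof.
rewrite iterated.
have I0 : (0 <= \int[leb]_(r in `[0%R, (t - 2^-1)%R]) (g r)%:E)%E.
  by apply: integral_ge0 => r _; rewrite lee_fin.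
have mI : measurable (`[0, t - 2^-1]%classic : set R) by exact: measurable_itv.
rewrite muleC -integral_cst//; rewrite [leLHS]integral_mkcond.
apply: ge0_le_integral => //.
- by move=> u _; apply: erestrict_ge0.
- by apply/(measurable_restrictT _ _).1.
move=> u _; rewrite patchE mem_setE in_itv/=.
case: ifPn => [/andP[u0 u2]|_]; last exact: integral_ge0.
rewrite [leLHS]integral_mkcond -(integral_shift u (mG mI) (G0 _)).
apply: ge0_le_integral => //.
- by apply: (measurableT_comp (mG mI)); exact: measurable_funB.
- exact: mF1.
- move=> r _; rewrite /G patchE mem_setE in_itv/=.
  case: ifPn => [/andP[h1 h2]|_]; last exact: F0.
  rewrite /F/= patchE mem_setE in_itv/= indicE mem_setE in_itv/=.
  have -> : 0 <= u <= r by apply/andP; split; lra.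
  have -> : 0 <= r <= t by apply/andP; split; lra.
  by rewrite mule1.
Qed.

End iterated_convolution.

(** * Densities as limits of averages over cells *)

Section cells.
Context (R : realType).
Local Notation leb := (@lebesgue_measure R).
Implicit Types (n : nat) (x y : R) (k : int).

Definition cell_index n x : int := Num.floor (n.+1%:R * x).

Definition cell n k : set R := `[k%:~R / n.+1%:R, (k + 1)%:~R / n.+1%:R[%classic.

Lemma cellP n k x : cell n k x <-> cell_index n x = k.
Proof.
rewrite /cell /cell_index/= in_itv/=.
have n0 : 0 < n.+1%:R :> R by exact: ltr0Sn.
rewrite ler_pdivrMr// ltr_pdivlMr// ![x * _]mulrC -floor_eq.
by split=> [/eqP|->].
Qed.

Lemma measurable_cell n k : measurable (cell n k).
Proof. exact: measurable_itv. Qed.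

Lemma lebesgue_cell n k : leb (cell n k) = (n.+1%:R^-1)%:E.
Proof.
have n0 : 0 < n.+1%:R :> R by exact: ltr0Sn.
rewrite /cell lebesgue_measure_itv/= lte_fin ltr_pM2r ?invr_gt0//.
rewrite ltr_int ltrDl ltr01 -EFinD -mulrBl intrD.
by rewrite addrAC subrr add0r div1r.
Qed.

Lemma cell_dist n k x y : cell n k x -> cell n k y -> `|x - y| < n.+1%:R^-1.
Proof.
rewrite /cell/= !in_itv/= => /andP[x1 x2] /andP[y1 y2].
have e : (k + 1)%:~R / n.+1%:R = k%:~R / n.+1%:R + n.+1%:R^-1 :> R.
  by rewrite intrD mulrDl div1r.
rewrite {}e in x2 y2; move: (n.+1%:R^-1) (k%:~R / _) x1 x2 y1 y2 => b a x1 x2 y1 y2.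
by rewrite ltr_norml; apply/andP; split; lra.
Qed.

(** Unit intervals with integer end points are unions of cells. *)
Definition block (j : nat) : set R := `[j%:R, j.+1%:R[%classic.

Lemma cell_block n k j x : cell n k x -> block j x -> cell n k `<=` block j.
Proof.
have n0 : 0 < n.+1%:R :> R by exact: ltr0Sn.
rewrite /cell /block => /=; rewrite !in_itv/= => /andP[x1 x2] /andP[x3 x4] y/=.
rewrite !in_itv/= => /andP[y1 y2].
have k1 : (j * n.+1)%:Z < k + 1.
  rewrite -(ltr_int R); move: x2; rewrite ltr_pdivlMr// => x2.
  by apply: le_lt_trans x2; rewrite -pmulrn natrM ler_wpM2r// ltW.
have k2 : k < (j.+1 * n.+1)%:Z.
  rewrite -(ltr_int R); move: x1; rewrite ler_pdivrMr// => x1.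
  by apply: (le_lt_trans x1); rewrite -pmulrn natrM ltr_pM2r.
apply/andP; split.
  apply: le_trans y1; rewrite ler_pdivlMr// -natrM pmulrn ler_int.
  by rewrite -ltzD1.
apply: (lt_le_trans y2); rewrite ler_pdivrMr// -natrM pmulrn ler_int.
by rewrite lezD1.
Qed.

Lemma measurable_block j : measurable (block j).
Proof. exact: measurable_itv. Qed.

(** The form in which the Lebesgue differentiation theorem applies to averages
    over cells. *)
Lemma nicely_shrinking_cell x : nicely_shrinking x (fun n => cell n (cell_index n x)).
Proof.
split; first by move=> n; exact: measurable_cell.
have h n : 0 < harmonic n :> R by exact: harmonic_gt0.
exists (2, fun n => PosNum (h n)); split => //=.
- exact: cvg_harmonic.
- move=> n y cy; rewrite -ball_normE/= /harmonic/=.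
  by apply: cell_dist cy; apply/cellP.
- move=> n; rewrite lebesgue_cell lebesgue_measure_ball ?(ltW (h n))//.
  by rewrite -EFinM lee_fin mulr_natl.
Qed.

End cells.

(** The cell containing the first coordinate takes countably many values. *)
Lemma measurable_cell_step (R : realType) d (T : measurableType d) (n : nat)
    (F : int -> T -> R) : (forall k, measurable_fun [set: T] (F k)) ->
  measurable_fun setT (fun p : measurableTypeR R * T => F (cell_index n p.1) p.2).
Proof.
move=> mF _ Y mY; rewrite setTI.
rewrite (_ : _ @^-1` Y = \bigcup_(k : int) (@cell R n k `*` (F k @^-1` Y))); last first.
  apply/seteqP; split=> [[x w] /= Fxw|[x w] [k _ [/= /cellP xk Fkw]]].
    by exists (cell_index n x) => //; split => //=; exact/cellP.
  by rewrite /= xk.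
apply: countable_bigcupT_measurable => [|k]; first exact: countableP.
apply: measurableX; first exact: measurable_cell.
by rewrite -[X in measurable X]setTI; exact: mF.
Qed.

Section cell_density.
Context (R : realType).
Variables (m : {measure set (measurableTypeR R) -> \bar R}) (j : nat).
Local Notation leb := (@lebesgue_measure R).
Local Notation B := (@block R j).
Hypothesis mB_fin : (m B < +oo)%E.

Definition cell_average n (x : R) : R := n.+1%:R * fine (m (@cell R n (cell_index n x))).

Lemma cell_average_ge0 n x : 0 <= cell_average n x.
Proof. by rewrite mulr_ge0// fine_ge0. Qed.

Lemma measurable_cell_average n : measurable_fun [set: R] (cell_average n).
Proof.
have H := @measurable_cell_step _ _ (measurableTypeR R) n
  (fun k _ => n.+1%:R * fine (m (@cell R n k))) (fun k => measurable_cst _).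
have H2 := measurableT_comp H (pair2_measurable (0 : R)).
exact: H2.
Qed.

Let avg := cell_average.

Let mavg := measurable_cell_average.

Let mB : measurable (B : set (measurableTypeR R)). Proof. exact: measurable_block. Qed.

Let nu : {finite_measure set (measurableTypeR R) -> \bar R} := mfrestr mB mB_fin.

Let nuE A : nu A = m (A `&` B). Proof. by []. Qed.

Let nu_cell n x : B x -> (avg n x)%:E = (n.+1%:R%:E * nu (@cell R n (cell_index n x)))%E.
Proof.
move=> Bx; have cB : @cell R n (cell_index n x) `<=` B.
  by apply: cell_block Bx; exact/cellP.
rewrite nuE (setIidl cB) /avg /cell_average EFinM fineK// ge0_fin_numE//.
apply: le_lt_trans mB_fin; rewrite le_measure ?inE//; exact: measurable_cell.
Qed.

Hypothesis energy : (limn_einf (fun n => \int[leb]_(x in B) (avg n x ^+ 2)%:E) < +oo)%E.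

(** Averaging the indicator of an open set [V] over cells and using
    [2 x <= 1 / eta + eta x ^ 2] bounds [nu V] by [leb V / eta] plus [eta]
    times the energy. *)
Let open_bound (V : set R) (K eta : R) : open V -> 0 < eta ->
  (limn_einf (fun n => \int[leb]_(x in B) (avg n x ^+ 2)%:E) < K%:E)%E ->
  (nu V <= (2 * eta)^-1%:E * leb V + (eta / 2 * K)%:E)%E.
Proof.
move=> oV eta0 qK.
have mV : measurable V by exact: open_measurable.
have mVB : measurable (V `&` B) by exact: measurableI.
pose G n (p : measurableTypeR R * measurableTypeR R) : \bar R :=
  ((n.+1%:R * (\1_(V `&` B) p.2 * \1_(@cell R n (cell_index n p.1)) p.2))%:E).
have G0 n p : (0 <= G n p)%E by rewrite lee_fin !mulr_ge0.
have mG n : measurable_fun setT (G n).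
  apply/measurable_EFinP; apply: measurable_funM => //; apply: measurable_funM.
    apply: (@measurableT_comp _ _ _ _ _ _ (\1_(V `&` B) : R -> R)).
      exact: measurable_indic.
    exact: measurable_snd.
  apply: (@measurable_cell_step _ _ _ n (fun k => \1_(@cell R n k))) => k.
  by apply: measurable_indic; exact: measurable_cell.
pose h n s := (\int[leb]_r G n (s, r))%E.
have h1 s : (V `&` B) s -> h n s @[n --> \oo] --> 1%E.
  move=> [Vs Bs]; apply: cvg_near_cst.
  have [e /= e0 eV] := open_nbhs_nbhs (conj oV Vs).
  have [N _ hN] : \forall n \near \oo, harmonic n < e.
    move/cvgrPdist_lt : (@cvg_harmonic R) => /(_ e e0).
    by case=> N _ hN; exists N => // k /hN /=; rewrite sub0r normrN ger0_norm ?ltW ?harmonic_gt0.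
  exists N => // n /= Nn; have cs : @cell R n (cell_index n s) s by exact/cellP.
  have cV : @cell R n (cell_index n s) `<=` V `&` B.
    move=> y cy; split; last by apply: (cell_block cs Bs).
    by apply: eV => /=; apply: lt_trans (hN _ Nn); exact: cell_dist cs cy.
  rewrite /h /G/=; under eq_integral do rewrite EFinM.
  rewrite ge0_integralZl//; first last.
  - by apply/measurable_EFinP; apply: measurable_funM; apply: measurable_indic => //; exact: measurable_cell.
  rewrite (_ : \int[leb]_r _ = leb (@cell R n (cell_index n s)))%E; last first.
    rewrite -[X in leb X]setIT -integral_indic//; last exact: measurable_cell.
    apply: eq_integral => r _; congr _%:E; rewrite !indicE.
    have [rc|_] := boolP (r \in @cell R n (cell_index n s)); last by rewrite mulr0.
    by rewrite mem_set ?mul1r//; apply: cV; rewrite inE in rc.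
  by rewrite lebesgue_cell -EFinM divff.
have mh n : measurable_fun [set: R] (h n) by exact: (measurable_fun_fubini_tonelli_F (m2 := leb) (G n) (mG n) (G0 n)).
have h0 n s : (0 <= h n s)%E by exact: integral_ge0.
have hint n : (\int[nu]_(s in V `&` B) h n s <=
    (2 * eta)^-1%:E * leb V + (eta / 2)%:E * \int[leb]_(x in B) (avg n x ^+ 2)%:E)%E.
  apply: (@le_trans _ _ (\int[nu]_s h n s)%E).
    by apply: ge0_subset_integral => //; exact: mh.
  rewrite /h fubini_tonelli//.
  have -> : (\int[leb]_y \int[nu]_x G n (x, y) = \int[leb]_(y in V `&` B) (avg n y)%:E)%E.
    rewrite [RHS]integral_mkcond; apply: eq_integral => r _; rewrite patchE /G/=.
    case: ifPn => [|rV]; last first.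
      by apply: integral0_eq => x _; rewrite indicE (negbTE rV) mul0r mulr0.
    move=> rVB; rewrite nu_cell; last by case: (set_mem rVB).
    rewrite -[X in nu X]setIT -integral_indic//; last exact: measurable_cell.
    rewrite -ge0_integralZl//; last first.
      by apply/measurable_EFinP; apply: measurable_indic; exact: measurable_cell.
    apply: eq_integral => x _; rewrite -EFinM !indicE rVB mul1r; congr (_ * _%:R)%:E.
    apply: congr1; apply/idP/idP => /set_mem/cellP H; apply/mem_set/cellP; exact/esym.
  have mavg2 (D : set R) : measurable_fun D (fun x => (avg n x ^+ 2)%:E).
    by apply/measurable_EFinP; apply: measurable_funTS; apply: measurable_funX; exact: mavg.
  have avg2_0 (x : R) : (0 <= (avg n x ^+ 2)%:E)%E by rewrite lee_fin sqr_ge0.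
  apply: (@le_trans _ _ (\int[leb]_(y in V `&` B)
      ((2 * eta)^-1%:E + (eta / 2)%:E * (avg n y ^+ 2)%:E))%E).
    apply: ge0_le_integral => //.
    - by move=> y _; rewrite lee_fin cell_average_ge0.
    - by apply/measurable_EFinP; apply: measurable_funTS; exact: mavg.
    - by apply: emeasurable_funD => //; apply: emeasurable_funM => //; exact: mavg2.
    - move=> y _; rewrite -EFinM -EFinD lee_fin.
      have : 0 <= (1 - eta * avg n y) ^+ 2 / (2 * eta) by rewrite divr_ge0 ?sqr_ge0// mulr_ge0// ltW.
      have -> : (1 - eta * avg n y) ^+ 2 / (2 * eta) =
        (2 * eta)^-1 + eta / 2 * avg n y ^+ 2 - avg n y by field; rewrite gt_eqF.
      by rewrite subr_ge0.
  have eta2 : 0 <= eta / 2 by rewrite divr_ge0// ltW.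
  have eta3 : 0 <= (2 * eta)^-1 by rewrite invr_ge0 mulr_ge0// ltW.
  rewrite ge0_integralD//; last 2 first.
  - by move=> y _; rewrite mule_ge0.
  - by apply: emeasurable_funM => //; exact: mavg2.
  rewrite integral_cst// ge0_integralZl//; last exact: mavg2.
  apply: leeD; rewrite lee_wpmul2l//.
  - by rewrite le_measure// inE.
  - by apply: ge0_subset_integral => //; exact: mavg2.
apply: (@le_trans _ _ (\int[nu]_(s in V `&` B) limn_einf (h ^~ s))%E).
  rewrite (eq_integral (cst 1%E)); last first.
    by move=> s /set_mem sV; rewrite (cvg_limn_einf_sup (h1 s sV)).1.
  rewrite integral_cst// mul1e.
  suff : (m (V `&` B) <= m (V `&` B `&` B))%E by [].
  by rewrite -setIA setIid.
apply: le_trans (fatou _ _ _ _) _ => //.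
- by move=> n; apply: measurable_funTS; exact: mh.
apply: limn_einf_le_frequently => k.
have [n kn qn] := limn_einf_lt_frequently qK k.
exists n => //; apply: le_trans (hint n) _; rewrite leeD2l// [leRHS]EFinM lee_wpmul2l//.
- by rewrite lee_fin divr_ge0// ltW.
- exact: ltW.
Qed.

(** Outer regularity encloses a null set in open sets of measure at most
    [eta ^ 2], for which [open_bound] gives [O (eta)]. *)
Let nu_leb : nu `<< leb.
Proof.
have [K K0 qK] : exists2 K : R, 0 <= K &
    (limn_einf (fun n => \int[leb]_(x in B) (avg n x ^+ 2)%:E) < K%:E)%E.
  move: energy; case: limn_einf => [r _|//|_].
  - exists (`|r| + 1); first by rewrite addr_ge0.
    by rewrite lte_fin (le_lt_trans (ler_norm r))// ltrDl.
  - by exists 0 => //; rewrite ltNyr.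
apply/null_content_dominatesP => N mN N0.
have nuN : nu N \is a fin_num by exact: fin_num_measure.
have bound eta : 0 < eta -> (nu N <= (eta * (1 + K))%:E)%E.
  move=> eta0; have Nfin : (leb N < +oo)%E by rewrite N0.
  have e2 : 0 < eta ^+ 2 by rewrite exprn_gt0.
  have [U [oU NU Ueps]] := lebesgue_regularity_outer mN Nfin e2.
  have mU : measurable U by exact: open_measurable.
  have lebU : (leb U <= (eta ^+ 2)%:E)%E.
    rewrite -(setDKU NU) measureU//=; first last.
    - by rewrite setDE -setIA setICl setI0.
    - exact: measurableD.
    by rewrite N0 adde0 ltW.
  apply: (@le_trans _ _ (nu U)); first by rewrite le_measure ?inE.
  apply: le_trans (open_bound oU eta0 qK) _.
  apply: (@le_trans _ _ ((2 * eta)^-1%:E * (eta ^+ 2)%:E + (eta / 2 * K)%:E)%E).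
    by rewrite leeD2r// lee_wpmul2l// lee_fin invr_ge0 mulr_ge0// ltW.
  rewrite -EFinM -EFinD lee_fin.
  have -> : (2 * eta)^-1 * eta ^+ 2 = eta / 2 by field; rewrite gt_eqF.
  by nra.
apply/eqP; rewrite eq_le measure_ge0 andbT -(fineK nuN) lee_fin leNgt; apply/negP => N_gt0.
have K1 : 0 < 1 + K by rewrite ltr_wpDr.
have := bound (fine (nu N) / (2 * (1 + K))).
rewrite divr_gt0 ?mulr_gt0// => /(_ isT); rewrite -[in X in X -> _](fineK nuN) lee_fin.
have -> : fine (nu N) / (2 * (1 + K)) * (1 + K) = fine (nu N) / 2 by field; rewrite gt_eqF.
by lra.
Qed.

(** The averages converge almost everywhere to the Radon-Nikodym derivative, so
    their limit inferior is a version of it given by an explicit formula. *)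
Lemma cell_density (A : set R) : measurable A -> A `<=` B ->
  (m A = \int[leb]_(x in A) (fine (limn_einf (fun n => (avg n x)%:E)))%:E)%E.
Proof.
move=> mA AB.
have [y [y0 yfin yint yE]] := radon_nikodym_sigma_finite nu_leb.
have -> : m A = nu A by rewrite nuE setIidl.
rewrite yE//.
have my : measurable_fun [set: R] y by case/integrableP : yint.
have mfy : measurable_fun [set: R] (fine \o y) by apply: measurableT_comp.
have yK x : (fine (y x))%:E = y x by rewrite fineK.
have locy : locally_integrable [set: R] (fine \o y).
  split => // [|C _ cC]; first exact: openT.
  have mC : measurable C by exact: compact_measurable.
  apply: (@le_lt_trans _ _ (\int[leb]_x y x)%E); last first.
    by case/integrableP : yint => _; under eq_integral do rewrite gee0_abs//.
  apply: (@le_trans _ _ (\int[leb]_(x in C) y x)%E).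
    rewrite le_eqVlt; apply/orP; left; apply/eqP; apply: eq_integral => x _.
    by rewrite /= ger0_norm ?yK// fine_ge0.
  exact: ge0_subset_integral.
apply: ae_eq_integral => //.
- exact: measurable_funTS.
- apply/measurable_EFinP; apply: measurable_funTS; apply: measurableT_comp => //.
  by apply: measurable_fun_limn_einf => n; apply/measurable_EFinP; exact: mavg.
have [N [mN N0 subN]] := lebesgue_differentiation locy.
exists N; split => // x /= xN; apply: subN => /= ptx; apply: xN => Ax.
have cvx := nice_lebesgue_differentiation (@nicely_shrinking_cell R) locy ptx.
have Bx := AB _ Ax.
have avgE n : (avg n x)%:E = ((leb (@cell R n (cell_index n x)))^-1 *
    \int[leb]_(z in @cell R n (cell_index n x)) ((fine \o y) z)%:E)%E.
  rewrite nu_cell// yE; last exact: measurable_cell.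
  rewrite lebesgue_cell inver invr_eq0 pnatr_eq0/= invrK; congr (_ * _)%E.
  by apply: eq_integral => z _; rewrite /= yK.
rewrite -yK; congr (fine _)%:E; apply/esym.
have {}cvx : (avg n x)%:E @[n --> \oo] --> y x.
  by under eq_fun do rewrite avgE; rewrite -yK.
by rewrite (cvg_limn_einf_sup cvx).1.
Qed.

End cell_density.

(** * Existence of a density *)

Section trapezoid.
Context (R : realType).
Implicit Types (c delta u x : R).

(** The projection of the line onto the unit interval, written with absolute
    values so that its continuity is immediate. *)
Definition clamp x : R := (`|x| - `|x - 1| + 1) / 2.

Lemma clamp_itv x : 0 <= clamp x <= 1.
Proof.
rewrite /clamp; have [x0|x0] := leP 0 x.
  by rewrite (ger0_norm x0); have [x1|x1] := leP 0 (x - 1);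
    rewrite ?(ger0_norm x1) ?(ltr0_norm x1); apply/andP; split; lra.
have x1 : x - 1 < 0 by lra.
by rewrite (ltr0_norm x0) (ltr0_norm x1); apply/andP; split; lra.
Qed.

Lemma clamp_ge1 x : 1 <= x -> clamp x = 1.
Proof. by move=> x1; rewrite /clamp !ger0_norm ?subr_ge0//; [lra|rewrite (le_trans _ x1)]. Qed.

Lemma clamp_le0 x : x <= 0 -> clamp x = 0.
Proof. by move=> x0; rewrite /clamp !ler0_norm//; [lra|rewrite subr_le0 (le_trans x0)]. Qed.

Lemma clamp_le x y : x <= y -> clamp x <= clamp y.
Proof.
move=> xy; rewrite /clamp ler_pM2r// lerD2r.
by case: (ger0P x); case: (ger0P y); case: (ger0P (x - 1)); case: (ger0P (y - 1)); lra.
Qed.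

Lemma continuous_clamp : continuous clamp.
Proof.
move=> x; rewrite /clamp; apply: cvgMl; apply: cvgD; last exact: cvg_cst.
apply: cvgB; first exact: norm_continuous.
by apply: cvg_norm; apply: cvgB; [exact: cvg_id|exact: cvg_cst].
Qed.

(** A continuous stand-in for half the indicator function of an interval of
    length [delta]: a test function is continuous and at most [1 / 2]. *)
Definition trapezoid c delta u : R := 2^-1 * clamp (3 / 2 - `|u - c| / delta).

Lemma trapezoid_itv c delta u : 0 <= trapezoid c delta u <= 2^-1.
Proof.
have /andP[h0 h1] := clamp_itv (3 / 2 - `|u - c| / delta).
by rewrite mulr_ge0//= ler_piMr.
Qed.

Lemma continuous_trapezoid c delta : continuous (trapezoid c delta).
Proof.
move=> x; apply: cvgMr.
apply: (@continuous_comp _ _ _ (fun u => 3 / 2 - `|u - c| / delta) clamp); last exact: continuous_clamp.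
apply: cvgB; first exact: cvg_cst.
by apply: cvgMl; apply: cvg_norm; apply: cvgB; [exact: cvg_id|exact: cvg_cst].
Qed.

Lemma trapezoid_near c delta u : 0 < delta -> `|u - c| <= delta / 2 ->
  trapezoid c delta u = 2^-1.
Proof.
move=> d0 uc; rewrite /trapezoid clamp_ge1 ?mulr1//.
have : `|u - c| / delta <= 2^-1 by rewrite ler_pdivrMr// mulrC.
by lra.
Qed.

Lemma trapezoid_far c delta u : 0 < delta -> 3 / 2 * delta <= `|u - c| ->
  trapezoid c delta u = 0.
Proof.
move=> d0 uc; rewrite /trapezoid clamp_le0 ?mulr0//.
by rewrite subr_le0 ler_pdivlMr.
Qed.

End trapezoid.

Section cell_second_moment.
Context (R : realType) (a : R).
Hypotheses (a_gt0 : 0 < a) (a_le1 : a <= 1) (a_gt_half : 2^-1 < a).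
Variable rho : probability (measurableTypeR R) R.
Hypothesis rhoML : mittag_leffler a rho.
Context (d : measure_display) (T : measurableType d) (P : probability T R).
Variable xi : R.-ker T ~> (measurableTypeR R).
Hypothesis xiF : feller_random_measure P (lebesgue_nonneg R) rho xi.
Local Notation leb := (@lebesgue_measure R).

Let xi_fin w s : (xi w `[0%R, s]%classic < +oo)%E.
Proof. by have [/(_ w)[]] := xiF. Qed.

Let rho_fin s : (rho `[0%R, s]%classic < +oo)%E.
Proof. by rewrite (le_lt_trans (probability_le1 _ _))// ltry. Qed.

(** In the bound [m ^ 2 + v] both terms are [O (delta ^ 2)]: the first because
    [f] has integral [O (delta)], the second because the square integral of
    [f * rho] is [O (delta ^ 2)]. *)
Let trapezoid_second_moment t : 0 <= t -> exists2 C : R, 0 <= C &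
  forall c delta, 0 < delta -> 3 / 2 * delta <= c ->
  (\int[P]_w (convolution (trapezoid c delta) (xi w) t ^+ 2)%:E <= (C * delta ^+ 2)%:E)%E.
Proof.
move=> t0.
have [C0 C00 HC0] := mittag_leffler_square_integrable a_gt0 a_le1 rhoML a_gt_half t0.
exists (9 / 4 + 9 * C0); first by rewrite addr_ge0// mulr_ge0.
move=> c delta d0 dc.
pose f := trapezoid c delta.
have cf : continuous f by exact: continuous_trapezoid.
have mf : measurable_fun [set: R] f by exact: continuous_measurable_fun.
have f_itv u : 0 <= f u <= 2^-1 by exact: trapezoid_itv.
have f0 u : 0 <= f u by have /andP[] := f_itv u.
have f_norm u : `|f u| <= 2^-1 by rewrite ger0_norm//; have /andP[] := f_itv u.
have f00 : f 0 = 0.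
  apply: trapezoid_far => //; rewrite sub0r normrN ger0_norm//.
  by apply: le_trans dc; rewrite mulr_ge0// ltW.
pose p := c - 3 / 2 * delta.
have p0 : 0 <= p by rewrite subr_ge0.
pose q := convolution f rho.
have q0 s : 0 <= q s by exact: convolution_ge0.
have q_norm s : `|q s| <= 2^-1 by exact: normr_convolution_le1.
have mq : measurable_fun [set: R] q by exact: measurable_convolution f_norm.
have d3 : 0 <= 3 * delta by rewrite mulr_ge0// ltW.
have f_supp u : ~ (p <= u <= p + 3 * delta) -> f u = 0.
  move=> pu; apply: trapezoid_far => //; rewrite leNgt; apply/negP.
  rewrite ltr_norml => /andP[h1 h2]; apply: pu; rewrite /p; apply/andP; split; lra.
have qrho r : ((q r)%:E <= rho (`[0%R, +oo[ `&` `[(r - (p + 3 * delta))%R, (r - p)%R]))%E.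
  rewrite /q (EFin_convolution rho_fin r mf f_norm).
  set S := _ `&` _; have mS : measurable (S : set R) by exact: measurableI.
  rewrite -[X in (_ <= rho X)%E]setIT -integral_indic// [leLHS]integral_mkcond.
  apply: ge0_le_integral => //.
  - by move=> s _; apply: erestrict_ge0 => u _; rewrite lee_fin.
  - apply/(measurable_restrictT _ _).1 => //; apply: measurable_funTS.
    by apply/measurable_EFinP; apply: (measurableT_comp mf); exact: measurable_funB.
  - by apply/measurable_EFinP; exact: measurable_indic.
  - move=> s _; rewrite patchE; case: ifPn => [|_]; last by rewrite lee_fin.
    rewrite mem_setE in_itv/= => /andP[s0 sr].
    have [ps|ps] := boolP (p <= r - s <= p + 3 * delta); last first.
      by rewrite (f_supp _ (elimN idP ps)) lee_fin.
    case/andP : ps => ps1 ps2; rewrite indicE mem_set; last first.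
      by split; rewrite /= in_itv/= ?andbT//; apply/andP; split; lra.
    by rewrite lee_fin; have /andP[_ h] := f_itv (r - s); apply: le_trans h _; rewrite invf_le1// ler1n.
have [m_ge0 v_ge0] : 0 <= convolution q (lebesgue_nonneg R) t /\
    0 <= convolution (convolution (fun s => q s ^+ 2) rho) (lebesgue_nonneg R) t.
  split; apply: convolution_ge0 => // s; apply: convolution_ge0 => u; exact: sqr_ge0.
apply: le_trans (second_moment_le xiF cf f_itv f00 t0) _.
rewrite lee_fin mulrDl; apply: lerD.
  suff mle : convolution q (lebesgue_nonneg R) t <= 3 / 2 * delta.
    have -> : 9 / 4 * delta ^+ 2 = (3 / 2 * delta) ^+ 2 by field.
    by rewrite lerXn2r ?nnegrE ?mulr_ge0 ?(ltW d0).
  have mle := iterated_convolution_le rho t mf f0 f_norm.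
  rewrite -lee_fin; apply: (le_trans mle).
  apply: (@le_trans _ _ (\int[leb]_u ((2^-1)%:E * (\1_(`[p, p + 3 * delta]%classic : set R) u)%:E))%E).
    rewrite integral_mkcond; apply: ge0_le_integral => //.
    - by move=> s _; apply: erestrict_ge0 => u _; rewrite lee_fin.
    - apply/(measurable_restrictT _ _).1 => //; apply: measurable_funTS; exact/measurable_EFinP.
    - by apply: emeasurable_funM => //; apply/measurable_EFinP; exact: measurable_indic.
    - move=> u _; rewrite patchE; case: ifPn => _; last by rewrite -EFinM lee_fin mulr_ge0.
      rewrite indicE mem_setE in_itv/= -EFinM lee_fin.
      have [pu|pu] := boolP (p <= u <= p + 3 * delta); last by rewrite (f_supp _ (elimN idP pu)) mulr0.
      by rewrite mulr1; have /andP[] := f_itv u.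
  rewrite ge0_integralZl//; last by apply/measurable_EFinP; exact: measurable_indic.
  have lebI : leb (`[p, p + 3 * delta]%classic : set R) = (3 * delta)%:E.
    rewrite lebesgue_measure_itv/= lte_fin ltrDl mulr_gt0//.
    by rewrite -EFinD addrAC subrr add0r.
  have -> : (\int[leb]_u (\1_(`[p, (p + 3 * delta)%R]%classic : set R) u)%:E = (3 * delta)%:E)%E.
    by rewrite integral_indic// setIT; exact: lebI.
  by rewrite -EFinM mulrA [2^-1 * 3]mulrC.
have q2b s : `|q s ^+ 2| <= 2^-1 ^+ 2.
  by rewrite normrX lerXn2r ?nnegrE.
have mq2 : measurable_fun [set: R] (fun s => q s ^+ 2) by exact: measurable_funX.
have q20 s : 0 <= q s ^+ 2 by exact: sqr_ge0.
have vle := iterated_convolution_le rho t mq2 q20 q2b.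
rewrite -lee_fin; apply: (le_trans vle).
apply: le_trans (HC0 p (3 * delta) q p0 d3 mq q0 qrho) _.
by rewrite lee_fin le_eqVlt; apply/orP; left; apply/eqP; ring.
Qed.

(** The trapezoid around the reflection of a cell dominates half its indicator
    function, uniformly in the size of the cell. *)
Lemma cell_second_moment t1 : 0 <= t1 -> exists2 C : R, 0 <= C &
  forall n x, 0 <= x <= t1 -> (\int[P]_w (cell_average (xi w) n x ^+ 2)%:E <= C%:E)%E.
Proof.
move=> t10.
have t0 : 0 <= t1 + 2 by rewrite addr_ge0.
have [C C0 HC] := trapezoid_second_moment t0.
exists (4 * C); first by rewrite mulr_ge0.
move=> n x /andP[x0 xt].
pose delta : R := n.+1%:R^-1.
have d0 : 0 < delta by rewrite invr_gt0.
have d1 : delta <= 1 by rewrite invf_le1// ler1n.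
pose k := cell_index n x.
have cx : @cell R n k x by exact/cellP.
have k0 : (0 <= k)%R by rewrite /k /cell_index floor_ge0 mulr_ge0.
pose c0 : R := k%:~R * delta.
have cE s : @cell R n k s -> c0 <= s < c0 + delta.
  by rewrite /cell/= in_itv/= intrD mulrDl div1r.
have c00 : 0 <= c0 by rewrite mulr_ge0 ?ler0z// ltW.
have c0t : c0 <= t1 by have /andP[h _] := cE _ cx; exact: le_trans h xt.
pose c := t1 + 2 - c0 - delta / 2.
have dc : 3 / 2 * delta <= c by rewrite /c; lra.
pose f := trapezoid c delta.
pose X w := convolution f (xi w) (t1 + 2).
have mf : measurable_fun [set: R] f by apply: continuous_measurable_fun; exact: continuous_trapezoid.
have f_itv u : 0 <= f u <= 2^-1 by exact: trapezoid_itv.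
have f0 u : 0 <= f u by have /andP[] := f_itv u.
have f_norm u : `|f u| <= 2^-1 by rewrite ger0_norm//; have /andP[] := f_itv u.
have mX : measurable_fun [set: T] X.
  exact: (measurable_random_convolution xi (t1 + 2) (@continuous_trapezoid _ c delta) f_itv).
have avgX w : cell_average (xi w) n x <= 2 * delta^-1 * X w.
  have cell_t : @cell R n k `<=` `[0, t1 + 2]%classic.
    by move=> s /cE/andP[h1 h2]; rewrite /= in_itv/=; apply/andP; split; lra.
  have cell_fin : xi w (@cell R n k) \is a fin_num.
    rewrite ge0_fin_numE//; apply: le_lt_trans (xi_fin w (t1 + 2)).
    by rewrite le_measure// inE//; exact: measurable_cell.
  suff : fine (xi w (@cell R n k)) <= 2 * X w.
    rewrite /cell_average -/k /delta invrK => h.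
    by rewrite [2 * _]mulrC -mulrA ler_wpM2l.
  rewrite -lee_fin fineK// EFinM /X (EFin_convolution (xi_fin w) (t1 + 2) mf f_norm).
  have -> : xi w (@cell R n k) = (2%:E * \int[xi w]_(s in @cell R n k) (2^-1)%:E)%E.
    rewrite integral_cst//; last exact: measurable_cell.
    by rewrite muleA -EFinM divff// mul1e.
  rewrite lee_wpmul2l//.
  have mg (D : set R) : measurable_fun D (fun s => (f (t1 + 2 - s))%:E).
    by apply: measurable_funTS; apply/measurable_EFinP; apply: (measurableT_comp mf); exact: measurable_funB.
  apply: (@le_trans _ _ (\int[xi w]_(s in @cell R n k) (f (t1 + 2 - s))%:E)%E).
    apply: ge0_le_integral => //.
    - exact: measurable_cell.
    - exact: mg.
    - move=> s /cE/andP[h1 h2]; rewrite lee_fin /f trapezoid_near// /c.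
      by rewrite ler_norml; apply/andP; split; lra.
  apply: ge0_subset_integral => //.
  - exact: measurable_cell.
  - exact: mg.
  - by move=> s _; rewrite lee_fin.
have X0 w : 0 <= X w by exact: convolution_ge0.
have mavg : measurable_fun [set: T] (fun w => cell_average (xi w) n x).
  apply: measurable_funM => //; apply: measurableT_comp; first exact: fine_measurable.
  by apply: kernel.measurable_kernel; exact: measurable_cell.
apply: (@le_trans _ _ (\int[P]_w ((4 * delta ^- 2)%:E * (X w ^+ 2)%:E))%E).
  apply: ge0_le_integral => //.
  - by move=> w _; rewrite lee_fin sqr_ge0.
  - by apply/measurable_EFinP; exact: measurable_funX.
  - by apply: emeasurable_funM => //; apply/measurable_EFinP; exact: measurable_funX.
  - move=> w _; rewrite -EFinM lee_fin.
    have -> : 4 * delta ^- 2 * X w ^+ 2 = (2 * delta^-1 * X w) ^+ 2.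
      by field; rewrite gt_eqF.
    by rewrite lerXn2r ?nnegrE ?cell_average_ge0// !mulr_ge0// invr_ge0 ltW.
rewrite ge0_integralZl//; last 3 first.
- by apply/measurable_EFinP; exact: measurable_funX.
- by move=> w _; rewrite lee_fin sqr_ge0.
- by rewrite lee_fin mulr_ge0// invr_ge0 sqr_ge0.
have d2 : 0 <= 4 * delta ^- 2 by rewrite mulr_ge0// invr_ge0 sqr_ge0.
apply: le_trans (lee_wpmul2l _ (HC c delta d0 dc)) _; first by rewrite lee_fin.
rewrite -EFinM lee_fin le_eqVlt; apply/orP; left; apply/eqP.
by field; rewrite gt_eqF.
Qed.

End cell_second_moment.

Section density_existence.
Context (R : realType) (a : R).
Hypotheses (a_gt0 : 0 < a) (a_le1 : a <= 1) (a_gt_half : 2^-1 < a).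
Variable rho : probability (measurableTypeR R) R.
Hypothesis rhoML : mittag_leffler a rho.
Context (d : measure_display) (T : measurableType d) (P : probability T R).
Variable xi : R.-ker T ~> (measurableTypeR R).
Hypothesis xiF : feller_random_measure P (lebesgue_nonneg R) rho xi.
Local Notation leb := (@lebesgue_measure R).

Let xi_fin w s : (xi w `[0%R, s]%classic < +oo)%E.
Proof. by have [/(_ w)[]] := xiF. Qed.

(** The limit inferior gives a density that is jointly measurable in time and
    chance, which a Radon-Nikodym derivative chosen path by path need not be. *)
Definition lower_density (t : R) (w : T) : R :=
  fine (limn_einf (fun n => (cell_average (xi w) n t)%:E)).

Let measurable_cell_average2 n : measurable_fun setT
  (fun p : measurableTypeR R * T => cell_average (xi p.2) n p.1).
Proof.
have H := @measurable_cell_step R _ T n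
  (fun k w => n.+1%:R * fine (xi w (@cell R n k))).
apply: H => k; apply: measurable_funM => //; apply: measurableT_comp; first exact: fine_measurable.
by apply: kernel.measurable_kernel; exact: measurable_cell.
Qed.

(** By Fatou's lemma and Tonelli's theorem, the bound on the second moments of
    the averages becomes a bound on almost every path. *)
Let energy_lty (j : nat) : {ae P, forall w,
  (limn_einf (fun n => \int[leb]_(x in @block R j) (cell_average (xi w) n x ^+ 2)%:E) < +oo)%E}.
Proof.
have j0 : 0 <= j.+1%:R :> R by [].
have [C C0 HC] := cell_second_moment a_gt0 a_le1 a_gt_half rhoML xiF j0.
pose q n w := (\int[leb]_(x in @block R j) (cell_average (xi w) n x ^+ 2)%:E)%E.
pose G n (p : measurableTypeR R * T) : \bar R :=
  ((cell_average (xi p.2) n p.1 ^+ 2)%:E * (\1_(@block R j) p.1)%:E)%E.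
have G0 n p : (0 <= G n p)%E by rewrite /G -EFinM lee_fin mulr_ge0 ?sqr_ge0.
have mG n : measurable_fun setT (G n).
  apply: emeasurable_funM; apply/measurable_EFinP; first exact: measurable_funX.
  apply: (@measurableT_comp _ _ _ _ _ _ (\1_(@block R j) : R -> R)).
    by apply: measurable_indic; exact: measurable_block.
  exact: measurable_fst.
have qE n w : q n w = (\int[leb]_x G n (x, w))%E.
  rewrite /q integral_mkcond; apply: eq_integral => x _; rewrite patchE /G/= indicE.
  by case: ifPn => _; rewrite ?mule1 ?mule0.
have mq n : measurable_fun [set: T] (q n).
  rewrite (_ : q n = fun w => \int[leb]_x G n (x, w))%E; last by apply/funext => w; exact: qE.
  exact: (measurable_fun_fubini_tonelli_G (m1 := leb) (G n) (mG n) (G0 n)).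
have q0 n w : (0 <= q n w)%E by apply: integral_ge0 => x _; rewrite lee_fin sqr_ge0.
have mbl : measurable (@block R j) by exact: measurable_block.
have lebB : leb (@block R j) = 1%E.
  rewrite /block lebesgue_measure_itv/= lte_fin ltr_nat ltnSn -EFinD -natr1.
  by rewrite addrAC subrr add0r.
have intq n : (\int[P]_w q n w <= C%:E)%E.
  under eq_integral do rewrite qE.
  rewrite -fubini_tonelli//.
  apply: (@le_trans _ _ (\int[leb]_(x in @block R j) C%:E)%E); last first.
    by rewrite integral_cst//= -[leRHS]mule1 lee_wpmul2l ?lee_fin// -lebB.
  rewrite [leRHS]integral_mkcond; apply: ge0_le_integral => //.
  - by move=> x _; exact: integral_ge0.
  - exact: (measurable_fun_fubini_tonelli_F (m2 := P) (G n) (mG n) (G0 n)).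
  - by apply/(measurable_restrictT _ _).1.
  - move=> x _; rewrite patchE; case: ifPn => [xB|xB]; last first.
      by rewrite integral0_eq// => w _; rewrite /G/= indicE (negbTE xB) mule0.
    have xj : 0 <= x <= j.+1%:R.
      move: xB; rewrite inE/block/= in_itv/= => /andP[h1 /ltW ->]; rewrite andbT.
      by rewrite (le_trans _ h1).
    apply: le_trans (HC n x xj); rewrite le_eqVlt; apply/orP; left; apply/eqP.
    by apply: eq_integral => w _; rewrite /G/= indicE xB mule1.
have ml : measurable_fun [set: T] (fun w => limn_einf (q ^~ w)) by exact: measurable_fun_limn_einf.
have l0 w : (0 <= limn_einf (q ^~ w))%E by exact: limn_einf_ge0.
have il : P.-integrable [set: T] (fun w => limn_einf (q ^~ w)).
  apply/integrableP; split => //.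
  under eq_integral do rewrite gee0_abs//.
  apply: (@le_lt_trans _ _ C%:E); last by rewrite ltry.
  apply: le_trans (fatou _ _ _ _) _ => //.
  by apply: limn_einf_le_frequently => k; exists k.
have [N [mN N0 subN]] := integrable_ae measurableT il.
exists N; split => // w /= h; apply: subN => /= /(_ I) fin; apply: h.
by move: fin; rewrite ge0_fin_numE.
Qed.

Let block_cover (A : set R) : A `<=` `[0, +oo[ -> A = \bigcup_j (A `&` @block R j).
Proof.
move=> A0; apply/seteqP; split=> [x Ax|x [j _ []//]].
have := A0 x Ax; rewrite /= in_itv/= andbT => x0.
exists (Num.trunc x) => //; split => //.
by rewrite /block/= in_itv/=; have /andP[-> ->] := truncn_itv x0.
Qed.

Let block_disjoint (A : set R) : trivIset setT (fun j => A `&` @block R j).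
Proof.
move=> i j _ _ [x [[_ xi_] [_ xj]]].
move: xi_ xj; rewrite /block/= !in_itv/= => /andP[i1 i2] /andP[j1 j2].
apply/eqP; rewrite eqn_leq; apply/andP; split.
  by rewrite -ltnS -(ltr_nat R); exact: le_lt_trans j2.
by rewrite -ltnS -(ltr_nat R); exact: le_lt_trans i2.
Qed.

Lemma density_lower_density : density P xi lower_density.
Proof.
split.
- apply: measurable_funTS; rewrite /lower_density.
  apply: (measurableT_comp (fine_measurable _)) => //.
  apply: measurable_fun_limn_einf => n; exact/measurable_EFinP.
- move=> t w _; rewrite /lower_density fine_ge0//; apply: limn_einf_ge0 => n.
  by rewrite lee_fin cell_average_ge0.
- have [N [mN N0 subN]] := ae_foralln energy_lty.
  exists N; split => // w /= h; apply: subN => /= en; apply: h => A mA A0.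
  have mAj j : measurable (A `&` @block R j) by apply: measurableI => //; exact: measurable_block.
  have fin_block j : (xi w (@block R j) < +oo)%E.
    apply: le_lt_trans (xi_fin w j.+1%:R); rewrite le_measure ?inE//.
      exact: measurable_block.
    move=> x; rewrite /block/= !in_itv/= => /andP[h1 /ltW ->]; rewrite andbT.
    by rewrite (le_trans _ h1).
  have mY : measurable_fun [set: R] (fun t => (lower_density t w)%:E).
    apply/measurable_EFinP; apply: (measurableT_comp (fine_measurable _)) => //.
    by apply: measurable_fun_limn_einf => n; apply/measurable_EFinP; exact: measurable_cell_average.
  have mU : measurable (\bigcup_j (A `&` @block R j)) by exact: bigcupT_measurable.
  have -> : xi w A = (\sum_(0 <= j <oo) xi w (A `&` @block R j))%E.
    by rewrite {1}(block_cover A0); exact: (measure_semi_bigcup (xi w) mAj (@block_disjoint A) mU).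
  have -> : (\int[leb]_(t in A) (lower_density t w)%:E =
      \sum_(0 <= j <oo) \int[leb]_(t in A `&` @block R j) (lower_density t w)%:E)%E.
    rewrite {1}(block_cover A0); apply: ge0_integral_bigcup => //.
    - exact: measurable_funTS.
    - move=> t _; rewrite lee_fin /lower_density fine_ge0//; apply: limn_einf_ge0 => n.
      by rewrite lee_fin cell_average_ge0.
  apply: eq_eseriesr => j _.
  by apply: (@cell_density _ (xi w) j (fin_block j) (en j) _ (mAj j)) => x [].
Qed.

Lemma square_integrable_lower_density : square_integrable P lower_density.
Proof.
move=> t t0; have [C C0 HC] := cell_second_moment a_gt0 a_le1 a_gt_half rhoML xiF t0.
rewrite unlock; apply: (@le_lt_trans _ _ C%:E); last by rewrite ltry.
have mavg n : measurable_fun [set: T] (fun w => cell_average (xi w) n t).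
  exact: measurableT_comp (measurable_cell_average2 n) (pair1_measurable (t : measurableTypeR R)).
have mavg2 n : measurable_fun [set: T] (fun w => (cell_average (xi w) n t ^+ 2)%:E).
  by apply/measurable_EFinP; exact: measurable_funX.
apply: (@le_trans _ _ (\int[P]_w limn_einf (fun n => (cell_average (xi w) n t ^+ 2)%:E))%E).
  apply: ge0_le_integral => //.
  - by move=> w _; rewrite lee_fin sqr_ge0.
  - apply/measurable_EFinP; apply: measurable_funX.
    apply: (measurableT_comp (fine_measurable _)) => //.
    by apply: measurable_fun_limn_einf => n; exact/measurable_EFinP.
  - exact: measurable_fun_limn_einf.
  - move=> w _; apply: sqr_fine_limn_einf => n; exact: cell_average_ge0.
apply: le_trans (fatou _ _ _ _) _ => //.
- by move=> n w _; rewrite lee_fin sqr_ge0.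
- by apply: limn_einf_le_frequently => k; exists k => //; apply: HC; rewrite t0/=.
Qed.

End density_existence.

(** * Second moments of the masses of compact sets *)

Section distance_to_set.
Context (R : realType).
Implicit Types (A : set R) (s x u : R).

Definition set_dist A s : R := inf [set `|s - x| | x in A].

Lemma set_dist_ge A s c : A !=set0 -> (forall x, A x -> c <= `|s - x|) -> c <= set_dist A s.
Proof.
move=> [x0 Ax0] cA; apply: lb_le_inf; first by exists `|s - x0|, x0.
by move=> _ [x Ax <-]; exact: cA.
Qed.

Lemma set_dist_le A s x : A x -> set_dist A s <= `|s - x|.
Proof.
by move=> Ax; apply: ge_inf; [exists 0 => _ [y _ <-]; exact: normr_ge0|exists x].
Qed.

Lemma set_dist_mem A s : A s -> set_dist A s = 0.
Proof.
move=> As; apply/eqP; rewrite eq_le; apply/andP; split.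
  by rewrite (le_trans (set_dist_le s As))// subrr normr0.
by apply: set_dist_ge => [|x _]; [exists s|exact: normr_ge0].
Qed.

Lemma set_dist_lipschitz A s u : A !=set0 -> set_dist A s - set_dist A u <= `|s - u|.
Proof.
move=> A0; rewrite lerBlDr -lerBlDl; apply: set_dist_ge => // x Ax.
rewrite lerBlDl (le_trans (set_dist_le s Ax))// -[s - x](subrKA u); exact: ler_normD.
Qed.

Lemma continuous_set_dist A : A !=set0 -> continuous (set_dist A).
Proof.
move=> A0 s; apply/cvgrPdist_le => /= e e0.
have /cvgrPdist_le /(_ e e0) : id u @[u --> s] --> s by exact: cvg_id.
apply: filterS => u; apply: le_trans.
rewrite ler_norml lerNl opprB; apply/andP; split; last exact: set_dist_lipschitz.
by rewrite distrC; exact: set_dist_lipschitz.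
Qed.

Lemma set_dist_gt0 A s : closed A -> A !=set0 -> ~ A s -> 0 < set_dist A s.
Proof.
move=> cA A0 nAs.
have : nbhs s (~` A) by apply: open_nbhs_nbhs; split => //; exact: closed_openC.
move=> /nbhs_ballP[e /= e0 eA]; apply: (lt_le_trans e0); apply: set_dist_ge => // x Ax.
by rewrite leNgt; apply/negP => /eA.
Qed.

End distance_to_set.

Section compact_second_moment.
Context (R : realType).
Variable rho : probability (measurableTypeR R) R.
Context (d : measure_display) (T : measurableType d) (P : probability T R).
Variable xi : R.-ker T ~> (measurableTypeR R).
Hypothesis xiF : feller_random_measure P (lebesgue_nonneg R) rho xi.
Variable A : set R.
Hypotheses (cA : compact A) (A0 : A !=set0) (A12 : A `<=` `[1, 2]).
Local Notation leb := (@lebesgue_measure R).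

Let xi_fin w s : (xi w `[0%R, s]%classic < +oo)%E.
Proof. by have [/(_ w)[]] := xiF. Qed.

Let rho_fin s : (rho `[0%R, s]%classic < +oo)%E.
Proof. by rewrite (le_lt_trans (probability_le1 _ _))// ltry. Qed.

Let closedA : closed A.
Proof. exact: compact_closed. Qed.

Let mA : measurable (A : set (measurableTypeR R)).
Proof. exact: closed_measurable. Qed.

Let bump (m : nat) s : R := 2^-1 * clamp (1 - m.+1%:R * set_dist A s).

Let bump_itv m s : 0 <= bump m s <= 2^-1.
Proof.
have /andP[h0 h1] := clamp_itv (1 - m.+1%:R * set_dist A s).
by rewrite /bump mulr_ge0//= ler_piMr.
Qed.

Let continuous_bump m : continuous (bump m).
Proof.
move=> s; apply: cvgMr.
apply: (@continuous_comp _ _ _ (fun s => 1 - m.+1%:R * set_dist A s) (@clamp R)); last exact: continuous_clamp.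
by apply: cvgB; [exact: cvg_cst|apply: cvgMr; exact: continuous_set_dist].
Qed.

Let bump_mem m s : A s -> bump m s = 2^-1.
Proof. by move=> As; rewrite /bump set_dist_mem// mulr0 subr0 clamp_ge1// mulr1. Qed.

Let bump_cvg s : bump m s @[m --> \oo] --> (2^-1 * \1_A s : R).
Proof.
rewrite indicE; case: (boolP (s \in A)) => [|]; rewrite ?inE ?notin_setE => As.
  by under eq_fun do rewrite bump_mem//; rewrite mulr1; exact: cvg_cst.
rewrite mulr0; apply: cvg_near_cst.
have dist0 := set_dist_gt0 closedA A0 As.
have idist0 : 0 <= (set_dist A s)^-1 by rewrite invr_ge0 ltW.
exists (Num.trunc (set_dist A s)^-1) => //= m /= nm.
rewrite /bump clamp_le0 ?mulr0// subr_le0 -ler_pdivrMr// div1r.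
apply: ltW; apply: lt_le_trans (_ : (Num.trunc (set_dist A s)^-1).+1%:R <= _).
  by have /andP[] := truncn_itv idist0.
by rewrite ler_nat.
Qed.

(* The time [3] exceeds every point of [A] by at least [1], so that each [f m]
   vanishes at the origin. *)
Let f m u := bump m (3 - u).

Let continuous_f m : continuous (f m).
Proof.
move=> u; rewrite /f.
apply: (@continuous_comp _ _ _ (fun u : R => 3 - u) (bump m)).
  by apply: cvgB; [exact: cvg_cst|exact: cvg_id].
exact: continuous_bump.
Qed.

Let f_itv m u : 0 <= f m u <= 2^-1. Proof. exact: bump_itv. Qed.

Let f_ge0 m u : 0 <= f m u. Proof. by have /andP[] := f_itv m u. Qed.

Let f_norm m u : `|f m u| <= 2^-1.
Proof. by rewrite ger0_norm//; have /andP[] := f_itv m u. Qed.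

Let measurable_f m : measurable_fun [set: R] (f m).
Proof. exact: continuous_measurable_fun (@continuous_f m). Qed.

Let f00 m : f m 0 = 0.
Proof.
rewrite /f subr0 /bump clamp_le0 ?mulr0// subr_le0.
have : 1 <= set_dist A 3.
  apply: set_dist_ge => // x /A12; rewrite /= in_itv/= => /andP[x1 x2].
  by rewrite ger0_norm; lra.
move=> h; rewrite (le_trans h)// ler_peMl ?ler1n//.
exact: le_trans h.
Qed.

Let X m w := convolution (f m) (xi w) 3.

Let X_ge0 m w : 0 <= X m w. Proof. exact: convolution_ge0. Qed.

Let X_le m w : X m w <= X 0 w.
Proof.
rewrite -lee_fin /X.
rewrite (EFin_convolution (xi_fin w) 3 (@measurable_f m) (@f_norm m)).
rewrite (EFin_convolution (xi_fin w) 3 (@measurable_f 0) (@f_norm 0)).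
have mf j : measurable_fun (`[0, 3]%classic : set R) (fun s => (f j (3 - s))%:E).
  apply: measurable_funTS; apply/measurable_EFinP; apply: (measurableT_comp (@measurable_f j)).
  exact: measurable_funB.
apply: ge0_le_integral => //.
- by move=> s _; rewrite lee_fin.
- exact: mf.
- exact: mf.
- move=> s _; rewrite lee_fin /f /bump ler_wpM2l//.
  apply: clamp_le; rewrite lerD2l lerN2 ler_wpM2r ?ler_nat//.
  by apply: set_dist_ge => // z _; exact: normr_ge0.
Qed.

Let measurable_X m : measurable_fun [set: T] (X m).
Proof. exact: (measurable_random_convolution xi 3 (@continuous_f m) (@f_itv m)). Qed.

Let measurable_X2 m : measurable_fun [set: T] (fun w => (X m w ^+ 2)%:E).
Proof. by apply/measurable_EFinP; exact: measurable_funX. Qed.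

Let A03 : A `<=` `[0, 3].
Proof.
by move=> s /A12; rewrite /= !in_itv/= => /andP[s1 s2]; apply/andP; split; lra.
Qed.

Let X_cvg w : X m w @[m --> \oo] --> (2^-1 * fine (xi w A) : R).
Proof.
have xiA : xi w A \is a fin_num.
  rewrite ge0_fin_numE//; apply: le_lt_trans (xi_fin w 3).
  by rewrite le_measure// inE//; exact: measurable_itv.
have mb m : measurable_fun (`[0, 3]%classic : set R) (fun s => (bump m s)%:E).
  by apply: measurable_funTS; apply/measurable_EFinP; exact: continuous_measurable_fun.
have XE m : (X m w)%:E = (\int[xi w]_(s in `[0%R, 3%R]) (bump m s)%:E)%E.
  rewrite /X (EFin_convolution (xi_fin w) 3 (@measurable_f m) (@f_norm m)).
  by apply: eq_integral => s _; rewrite /f opprB addrCA subrr addr0.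
have m03 : measurable (`[0, 3]%classic : set (measurableTypeR R)) by exact: measurable_itv.
have mlim : measurable_fun (`[0, 3]%classic : set R) (fun s => (2^-1 * \1_A s : R)%:E).
  apply: measurable_funTS; apply/measurable_EFinP; apply: measurable_funM => //; exact: measurable_indic.
have b_cvg : {ae xi w, forall s, (`[0, 3]%classic : set R) s ->
    (bump m s)%:E @[m --> \oo] --> (2^-1 * \1_A s : R)%:E}.
  by apply: aeW => s _; apply: cvg_EFin => //; [exact: nearW|exact: bump_cvg].
have iC : (xi w).-integrable (`[0, 3]%classic : set R) (cst (2^-1)%:E).
  apply/integrableP; split => //.
  by rewrite integral_cst//= lte_mul_pinfty//.
have b_le : {ae xi w, forall s m, (`[0, 3]%classic : set R) s ->
    (`|(bump m s)%:E| <= cst (2^-1)%:E s)%E}.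
  by apply: aeW => s m _; rewrite lee_fin ger0_norm; have /andP[] := bump_itv m s.
have [_ _] := dominated_convergence m03 mb mlim b_cvg iC b_le.
have -> : (\int[xi w]_(s in `[0%R, 3%R]) (2^-1 * \1_A s)%:E = (2^-1 * fine (xi w A))%:E)%E.
  under eq_integral do rewrite EFinM.
  rewrite ge0_integralZl//; last first.
    by apply/measurable_EFinP; exact: measurable_indic.
  by rewrite integral_indic// setIidl// EFinM fineK.
under eq_fun do rewrite -XE.
by move=> /fine_cvgP[].
Qed.

Let X2_cvg : (\int[P]_w (X m w ^+ 2)%:E)%E @[m --> \oo] -->
  (\int[P]_w ((2^-1 * fine (xi w A)) ^+ 2)%:E)%E.
Proof.
have mlim : measurable_fun [set: T] (fun w => ((2^-1 * fine (xi w A) : R) ^+ 2)%:E).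
  apply/measurable_EFinP; apply: measurable_funX; apply: measurable_funM => //.
  by apply: measurableT_comp; [exact: fine_measurable|exact: kernel.measurable_kernel].
have cX : {ae P, forall w, [set: T] w ->
    (X m w ^+ 2)%:E @[m --> \oo] --> ((2^-1 * fine (xi w A) : R) ^+ 2)%:E}.
  by apply: aeW => w _; apply: cvg_EFin; [exact: nearW|apply: cvgM; exact: X_cvg].
have i0 : P.-integrable [set: T] (fun w => (X 0 w ^+ 2)%:E).
  apply/integrableP; split => //.
  under eq_integral do rewrite gee0_abs ?lee_fin ?sqr_ge0//.
  apply: le_lt_trans (second_moment_le xiF (@continuous_f 0) (@f_itv 0) (@f00 0) _) _ => //.
  by rewrite ltry.
have X2_le : {ae P, forall w m, [set: T] w -> (`|(X m w ^+ 2)%:E| <= (X 0 w ^+ 2)%:E)%E}.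
  apply: aeW => w m _; rewrite lee_fin ger0_norm ?sqr_ge0//.
  by rewrite lerXn2r ?nnegrE.
by have [_ _] := dominated_convergence measurableT measurable_X2 mlim cX i0 X2_le.
Qed.

(** The lower bound for continuous test functions passes to the indicator
    function of a compact set, approximated from above by the bumps [bump m].
    Domination by [X 0], whose second moment is finite, gives the convergence
    of the expectations. *)
Lemma compact_second_moment_ge (b : R -> R) : measurable_fun [set: R] b -> (forall r, 0 <= b r) ->
  (forall r, (b r)%:E <= rho (`[0%R, r] `&` [set s | A (s + (3 - r))%R]))%E ->
  (rho `[0%R, (2^-1)%R]%classic * \int[leb]_(r in `[0%R, (3 - 2^-1)%R]) (b r ^+ 2)%:E <=
   \int[P]_w (fine (xi w A) ^+ 2)%:E)%E.
Proof.
move=> mb b0 b_le.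
set S := (X in (X <= _)%E).
have S0 : (0 <= S)%E by rewrite mule_ge0// integral_ge0// => r _; rewrite lee_fin sqr_ge0.
have step m : ((4^-1 : R)%:E * S <= \int[P]_w (X m w ^+ 2)%:E)%E.
  pose q := convolution (f m) rho.
  have q0 r : 0 <= q r by exact: convolution_ge0.
  have q_norm r : `|q r| <= 2^-1 by exact: normr_convolution_le1.
  have mq : measurable_fun [set: R] q by exact: measurable_convolution (@f_norm m).
  have mq2 : measurable_fun [set: R] (fun r => q r ^+ 2) by exact: measurable_funX.
  have q2b r : `|q r ^+ 2| <= 2^-1 ^+ 2 by rewrite normrX lerXn2r ?nnegrE.
  have q20 r : 0 <= q r ^+ 2 by exact: sqr_ge0.
  have bq r : 2^-1 * b r <= q r.
    rewrite -lee_fin /q (EFin_convolution rho_fin r (@measurable_f m) (@f_norm m)).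
    have mA_r : measurable [set s | A (s + (3 - r))].
      rewrite -[X in measurable X]setTI.
      have : measurable_fun [set: R] (fun s : R => s + (3 - r)) by exact: measurable_funD.
      exact.
    have mD : measurable (`[0, r]%classic : set R) by exact: measurable_itv.
    apply: (@le_trans _ _ (\int[rho]_(s in `[0%R, r]) (2^-1 * \1_[set s | A (s + (3 - r))] s)%:E)%E).
      under eq_integral do rewrite EFinM.
      rewrite ge0_integralZl//; last first.
        by apply/measurable_EFinP; exact: measurable_indic.
      by rewrite integral_indic// EFinM lee_wpmul2l// setIC.
    apply: ge0_le_integral => //.
    - apply/measurable_EFinP; apply: measurable_funM => //; exact: measurable_indic.
    - apply: measurable_funTS; apply/measurable_EFinP; apply: (measurableT_comp (@measurable_f m)).
      exact: measurable_funB.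
    - move=> s _; rewrite lee_fin indicE; have [|_] := boolP (s \in _); last by rewrite mulr0.
      rewrite inE/= => As; rewrite mulr1 /f bump_mem//.
      by rewrite (_ : 3 - (r - s) = s + (3 - r))//; ring.
  apply: le_trans (second_moment_ge xiF (@continuous_f m) (@f_itv m) (@f00 m) _) => //.
  apply: le_trans (iterated_convolution_ge rho 3 mq2 q20 q2b).
  rewrite /S muleCA lee_wpmul2l// -ge0_integralZl//; last 2 first.
  - apply: measurable_funTS; apply/measurable_EFinP; exact: measurable_funX.
  - by move=> r _; rewrite lee_fin sqr_ge0.
  apply: ge0_le_integral => //.
  - by move=> r _; rewrite -EFinM lee_fin mulr_ge0// sqr_ge0.
  - apply: measurable_funTS; apply: emeasurable_funM => //; apply/measurable_EFinP; exact: measurable_funX.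
  - by apply: measurable_funTS; exact/measurable_EFinP.
  - move=> r _; rewrite -EFinM lee_fin.
    have -> : 4^-1 * b r ^+ 2 = (2^-1 * b r) ^+ 2 by field.
    by rewrite lerXn2r ?nnegrE// mulr_ge0.
have lim_le : ((4^-1 : R)%:E * S <= \int[P]_w ((2^-1 * fine (xi w A)) ^+ 2)%:E)%E.
  apply: (cvge_ge _ X2_cvg); exact: nearW.
rewrite -(@lee_pmul2l _ (4^-1 : R)%:E)//; apply: (le_trans lim_le).
rewrite -ge0_integralZl//; last first.
  apply/measurable_EFinP; apply: measurable_funX.
  by apply: measurableT_comp; [exact: fine_measurable|exact: kernel.measurable_kernel].
rewrite le_eqVlt; apply/orP; left; apply/eqP.
by apply: eq_integral => w _; rewrite -EFinM; congr EFin; field.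
Qed.

End compact_second_moment.

Lemma integral_inv_shift (R : realType) (s p q : R) : 0 < p + s -> p < q ->
  (\int[@lebesgue_measure R]_(x in `[p, q]) ((x + s)^-1)%:E = (ln ((q + s) / (p + s)))%:E)%E.
Proof.
move=> ps pq; have qs : 0 < q + s by rewrite (lt_trans ps)// ltrD2r.
have dF x : 0 < x + s -> is_derive x 1 (fun x : R => ln (x + s)) (x + s)^-1.
  move=> xs.
  have h1 := is_derive1_ln xs.
  have h2 : is_derive x 1 (fun x : R => x + s) 1.
    by apply: is_derive_eq; rewrite addr0.
  by have := @is_derive1_comp _ (@ln R) (fun x : R => x + s) _ _ _ h1 h2; rewrite mulr1.
have cF x : 0 < x + s -> {for x, continuous (fun x : R => ln (x + s))}.
  move=> xs; apply: (@continuous_comp _ _ _ (fun x : R => x + s) (@ln R)).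
    by apply: cvgD; [exact: cvg_id|exact: cvg_cst].
  exact: continuous_ln.
rewrite (@continuous_FTC2 _ _ (fun x : R => ln (x + s)))//.
- by rewrite -EFinB lnM ?posrE ?invr_gt0// lnV ?posrE.
- apply: continuous_in_subspaceT => x; rewrite inE/= in_itv/= => /andP[px _].
  have xs : 0 < x + s by rewrite (lt_le_trans ps)// lerD2r.
  apply: (@continuous_comp _ _ _ (fun x : R => x + s) GRing.inv).
    by apply: cvgD; [exact: cvg_id|exact: cvg_cst].
  by apply: inv_continuous; rewrite gt_eqF.
- split.
  + move=> x; rewrite in_itv/= => /andP[px _].
    have xs : 0 < x + s by rewrite (lt_trans ps)// ltrD2r.
    by have [] := dF x xs.
  + apply: cvg_at_right_filter; exact: cF.
  + apply: cvg_at_left_filter; exact: cF.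
- move=> x; rewrite in_itv/= => /andP[px _].
  have xs : 0 < x + s by rewrite (lt_trans ps)// ltrD2r.
  by rewrite derive1E; have [_ ->] := dF x xs.
Qed.

Section clumping.
Context (R : realType) (a : R).
Hypotheses (a_gt0 : 0 < a) (a_le1 : a <= 1) (a_le_half : a <= 2^-1).
Variable rho : probability (measurableTypeR R) R.
Hypothesis rhoML : mittag_leffler a rho.
Context (d : measure_display) (T : measurableType d) (P : probability T R).
Variable xi : R.-ker T ~> (measurableTypeR R).
Hypothesis xiF : feller_random_measure P (lebesgue_nonneg R) rho xi.
Local Notation leb := (@lebesgue_measure R).

(** The set translated to lie between [y] and [y + delta] has [rho]-measure at
    least [c * leb A * (y + delta) ^ (- 1 / 2)]. The integral over [y] of the
    square of this bound diverges logarithmically as [delta] tends to [0]. *)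
Lemma compact_second_moment_ln : exists kappa t0 : R, [/\ 0 < kappa, 0 < t0 &
  forall (A : set R) c0 delta, compact A -> A !=set0 -> A `<=` `[1, 2] ->
    A `<=` `[c0, c0 + delta] -> 0 < delta < t0 ->
    ((kappa * fine (leb A) ^+ 2 * ln (t0 / delta))%:E <=
     \int[P]_w (fine (xi w A) ^+ 2)%:E)%E].
Proof.
have [c [t0 [c_gt0 /andP[t0_gt0 t0_le] rho_ge]]] := mittag_leffler_ge a_gt0 a_le1 rhoML a_le_half.
pose p := fine (rho `[0, 2^-1]%classic).
have pE : rho `[0, 2^-1]%classic = p%:E.
  by rewrite fineK// ge0_fin_numE// (le_lt_trans (probability_le1 _ _))// ltry.
have p_gt0 : 0 < p.
  rewrite -lte_fin -pE; apply: (@lt_le_trans _ _ (rho `]0, t0]%classic)); last first.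
    apply: le_measure; rewrite ?inE// => s; rewrite /= !in_itv/= => /andP[s0 st]; rewrite ltW//=; exact: le_trans t0_le.
  apply: lt_le_trans (rho_ge t0 _ _ _ _) => //; rewrite ?t0_gt0 ?lexx//.
  rewrite lebesgue_measure_itv/= lte_fin t0_gt0 -EFinB subr0 -EFinM lte_fin.
  by rewrite !mulr_gt0// powR_gt0.
exists (p * c ^+ 2), t0; split => //; first by rewrite mulr_gt0// exprn_gt0.
move=> A c0 delta cA A0 A12 Ac /andP[d0 dt].
have mA : measurable A by exact: closed_measurable (compact_closed _ cA).
have lebA_fin : leb A \is a fin_num.
  rewrite ge0_fin_numE//; apply: (@le_lt_trans _ _ (leb `[1, 2]%classic)).
    by apply: le_measure; rewrite ?inE//.
  by rewrite lebesgue_measure_itv/=; case: ifP => _; rewrite -?EFinB ?ltry.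
pose m := fine (leb A).
have m0 : 0 <= m by exact: fine_ge0.
have [c01 c02] : 1 <= c0 + delta /\ c0 <= 2.
  have [x Ax] := A0; move: (Ac x Ax) (A12 x Ax); rewrite /= !in_itv/= => /andP[h1 h2] /andP[h3 h4].
  by split; lra.
pose s := c0 + delta - 3.
pose J : set R := `](3 - c0), (3 - c0 + t0 - delta)]%classic.
have JP r : J r -> 0 < r + s - delta /\ r + s <= t0.
  by rewrite /J /s/= in_itv/= => /andP[h1 h2]; split; lra.
pose b r := \1_J r * (c * m * (r + s) `^ (- 2^-1)).
have mJ : measurable J by exact: measurable_itv.
have mb : measurable_fun [set: R] b.
  apply: measurable_funM; first exact: measurable_indic.
  apply: measurable_funM => //.
  apply: (@measurableT_comp _ _ _ _ _ _ (fun x : R => x `^ (- 2^-1))).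
    exact: measurable_powR.
  exact: measurable_funD.
have b0 r : 0 <= b r by rewrite /b !mulr_ge0// ?(ltW c_gt0)// powR_ge0.
have b_le r : ((b r)%:E <= rho (`[0%R, r] `&` [set u | A (u + (3 - r))%R]))%E.
  rewrite /b indicE; have [|_] := boolP (r \in J); last by rewrite mul0r.
  rewrite inE mul1r => /JP[rs1 rs2].
  set S := _ `&` _.
  have SE : S = (fun x : R => 1 * x + (3 - r)) @^-1` A.
    apply/seteqP; split => u; rewrite /S/= mul1r; first by case.
    move=> Au; split => //; move: (Ac _ Au) (A12 _ Au); rewrite /= !in_itv/=.
    by move: rs1; rewrite /s => h /andP[h1 h2] /andP[h3 h4]; apply/andP; split; lra.
  have mS : measurable S.
    rewrite SE -[X in measurable X]setTI.
    have h : measurable_fun [set: R] (fun x : R => 1 * x + (3 - r)).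
      by apply: measurable_funD => //; exact: measurable_funM.
    exact: h.
  have lebS : leb S = m%:E.
    by rewrite /m fineK// SE (lebesgue_measure_affine (3 - r) (oner_neq0 R) mA) normr1 mul1e.
  have := rho_ge (r + s) S _ mS; rewrite lebS -EFinM => H.
  have -> : c * m * (r + s) `^ (- 2^-1) = c * (r + s) `^ (- 2^-1) * m by ring.
  apply: H; first by apply/andP; split => //; lra.
  move=> u; rewrite SE /= mul1r in_itv/= => /Ac; rewrite /= in_itv/= => /andP[h1 h2].
  by move: rs1; rewrite /s => h; apply/andP; split; lra.
apply: le_trans (compact_second_moment_ge xiF cA A0 A12 mb b0 b_le).
rewrite pE.
have -> : (p * c ^+ 2 * m ^+ 2 * ln (t0 / delta))%:E =
    (p%:E * \int[leb]_(r in J) ((c * m) ^+ 2 * (r + s) `^ (- 1))%:E)%E.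
  under eq_integral do rewrite EFinM.
  have minv : measurable_fun [set: R] (fun r : R => ((r + s) `^ (- 1))%:E).
    apply/measurable_EFinP; apply: (@measurableT_comp _ _ _ _ _ _ (fun x : R => x `^ (- 1))).
      exact: measurable_powR.
    exact: measurable_funD.
  rewrite ge0_integralZl//; last 3 first.
  - exact: measurable_funTS.
  - by move=> r /JP[rs _]; rewrite lee_fin powR_ge0.
  - by rewrite lee_fin sqr_ge0.
  rewrite /J integral_itv_obnd_cbnd; last exact: measurable_funTS.
  have inv_powR r : r \in (`[(3 - c0), (3 - c0 + t0 - delta)]%classic : set R) ->
      ((r + s) `^ (- 1))%:E = ((r + s)^-1)%:E.
    by rewrite inE/= in_itv/= /s => /andP[h1 h2]; rewrite powR_inv1//; lra.
  under eq_integral => r rI do rewrite (inv_powR _ rI).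
  rewrite integral_inv_shift; [|by rewrite /s; lra|by lra].
  have -> : 3 - c0 + t0 - delta + s = t0 by rewrite /s; ring.
  have -> : 3 - c0 + s = delta by rewrite /s; ring.
  by rewrite -!EFinM; congr EFin; ring.
rewrite lee_wpmul2l ?lee_fin ?(ltW p_gt0)//.
have bJ r : r \in J -> ((c * m) ^+ 2 * (r + s) `^ (- 1))%:E = (b r ^+ 2)%:E.
  move=> rJ; rewrite /b indicE rJ mul1r [in RHS]exprMn.
  move: rJ; rewrite inE => /JP[rs _]; congr (_ * _)%:E.
  rewrite -[RHS]powR_mulrn ?powR_ge0// -powRrM.
  by congr (_ `^ _); field.
under eq_integral => r rJ do rewrite (bJ _ rJ).
apply: ge0_subset_integral => //.
- by apply: measurable_funTS; apply/measurable_EFinP; exact: measurable_funX.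
- by move=> r _; rewrite lee_fin sqr_ge0.
- by move=> r; rewrite /J/= !in_itv/= => /andP[h1 h2]; apply/andP; split; lra.
Qed.

End clumping.

(** * Non-existence of a square-integrable density *)

Section density_second_moment.
Context (R : realType) (d : measure_display) (T : measurableType d) (P : probability T R).
Variable xi : R.-ker T ~> (measurableTypeR R).
Variable Y : R -> T -> R.
Hypothesis xiY : density P xi Y.
Local Notation leb := (@lebesgue_measure R).

Let Y1 : measurableTypeR R * T -> R :=
  (fun p => Y p.1 p.2) \_ ((`[0, +oo[%classic : set (measurableTypeR R)) `*` [set: T]).

Let Y1E t w : 0 <= t -> Y1 (t, w) = Y t w.
Proof. by move=> t0; rewrite /Y1 patchE mem_set//; split => //=; rewrite in_itv/= t0. Qed.

Let Y1_ge0 p : 0 <= Y1 p.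
Proof.
have [_ Y0 _] := xiY; rewrite /Y1 patchE; case: ifPn => // /set_mem[/= + _].
by rewrite in_itv/= andbT => /Y0.
Qed.

Let measurable_Y1 : measurable_fun setT Y1.
Proof.
have [mY _ _] := xiY; apply/(measurable_restrictT _ _).1 => //.
by apply: measurableX => //; exact: measurable_itv.
Qed.

Let measurable_sqr : measurable_fun setT (fun p => (Y1 p ^+ 2)%:E).
Proof. by apply/measurable_EFinP; exact: measurable_funX. Qed.

Lemma measurable_density_second_moment :
  measurable_fun (`[0, +oo[%classic : set R) (fun t => \int[P]_w (Y t w ^+ 2)%:E)%E.
Proof.
apply: (eq_measurable_fun (fun t => \int[P]_w (Y1 (t, w) ^+ 2)%:E)%E).
  move=> t; rewrite inE/= in_itv/= andbT => t0.
  by apply: eq_integral => w _; rewrite Y1E.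
apply: measurable_funTS.
apply: (measurable_fun_fubini_tonelli_F (m2 := P) (fun p => (Y1 p ^+ 2)%:E)) => //.
by move=> p; rewrite lee_fin sqr_ge0.
Qed.

(** The Cauchy-Schwarz inequality in time on almost every path, then Tonelli's
    theorem. *)
Lemma density_second_moment_le (A : set R) (N : R) : measurable A -> (leb A < +oo)%E ->
  A `<=` `[0, +oo[ -> 0 <= N ->
  (forall t, A t -> (\int[P]_w (Y t w ^+ 2)%:E <= N%:E)%E) ->
  (\int[P]_w (fine (xi w A) ^+ 2)%:E <= (N * fine (leb A) ^+ 2)%:E)%E.
Proof.
move=> mA lebA A0 N0 YN.
have lebA_fin : leb A \is a fin_num by rewrite ge0_fin_numE.
pose G (p : measurableTypeR R * T) : \bar R := ((Y1 p ^+ 2)%:E * (\1_A p.1)%:E)%E.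
have G0 p : (0 <= G p)%E by rewrite /G -EFinM lee_fin mulr_ge0 ?sqr_ge0.
have mG : measurable_fun setT G.
  apply: emeasurable_funM => //; apply/measurable_EFinP.
  apply: (@measurableT_comp _ _ _ _ _ _ (\1_A : R -> R)); last exact: measurable_fst.
  exact: measurable_indic.
have GE w : (\int[leb]_(t in A) (Y1 (t, w) ^+ 2)%:E = \int[leb]_t G (t, w))%E.
  rewrite integral_mkcond; apply: eq_integral => t _; rewrite patchE /G/= indicE.
  by case: ifPn => _; rewrite ?mule1 ?mule0.
have mYw w : measurable_fun [set: R] (fun t => Y1 (t, w)).
  exact: (measurableT_comp measurable_Y1 (pair2_measurable w)).
have pathwise : {ae P, forall w, [set: T] w ->
    ((fine (xi w A) ^+ 2)%:E <= leb A * \int[leb]_t G (t, w))%E}.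
  have [_ _ xiE] := xiY; apply: filterS xiE => w xiE _.
  have -> : xi w A = (\int[leb]_(t in A) (Y1 (t, w))%:E)%E.
    rewrite xiE//; apply: eq_integral => t /set_mem/A0.
    by rewrite /= in_itv/= andbT => t0; rewrite Y1E.
  rewrite -GE.
  have := @cauchy_schwarz_integral _ _ R leb A (fun t => Y1 (t, w)) mA lebA
    (measurable_funTS (mYw w)) (fun t _ => Y1_ge0 (t, w)).
  apply: le_trans.
  have : (0 <= \int[leb]_(t in A) (Y1 (t, w))%:E)%E by apply: integral_ge0 => t _; rewrite lee_fin.
  by case: (\int[leb]_(t in A) (Y1 (t, w))%:E)%E => [r| |]//= _;
    rewrite ?expr0n ?mulyy ?leey// -EFinM.
have mGw : measurable_fun [set: T] (fun w => \int[leb]_t G (t, w))%E.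
  exact: (measurable_fun_fubini_tonelli_G (m1 := leb) G mG G0).
have G1 w : (0 <= \int[leb]_t G (t, w))%E by exact: integral_ge0.
apply: (@le_trans _ _ (\int[P]_w (leb A * \int[leb]_t G (t, w)))%E).
  apply: ae_ge0_le_integral => //.
  - apply/measurable_EFinP; apply: measurable_funX.
    by apply: measurableT_comp; [exact: fine_measurable|exact: kernel.measurable_kernel].
  - by move=> w _; rewrite mule_ge0.
  - exact: emeasurable_funM.
rewrite ge0_integralZl// -fubini_tonelli//.
have -> : (N * fine (leb A) ^+ 2)%:E = (leb A * (N%:E * leb A))%E.
  by rewrite -[in RHS](fineK lebA_fin) -!EFinM; congr EFin; ring.
rewrite lee_wpmul2l//.
rewrite -integral_cst// [leRHS]integral_mkcond; apply: ge0_le_integral => //.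
- by move=> t _; exact: integral_ge0.
- exact: (measurable_fun_fubini_tonelli_F (m2 := P) G mG G0).
- by apply/(measurable_restrictT _ _).1.
- move=> t _; rewrite patchE; case: ifPn => [tA|tA]; last first.
    by rewrite integral0_eq// => w _; rewrite /G/= indicE (negbTE tA) mule0.
  have At : A t by exact: set_mem.
  have t0 : 0 <= t by have := A0 t At; rewrite /= in_itv/= andbT.
  apply: le_trans (YN t At); rewrite le_eqVlt; apply/orP; left; apply/eqP.
  by apply: eq_integral => w _; rewrite /G/= indicE tA mule1 Y1E.
Qed.

End density_second_moment.

Section no_density.
Context (R : realType) (a : R).
Hypotheses (a_gt0 : 0 < a) (a_le1 : a <= 1).
Variable rho : probability (measurableTypeR R) R.
Hypothesis rhoML : mittag_leffler a rho.
Context (d : measure_display) (T : measurableType d) (P : probability T R).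
Variable xi : R.-ker T ~> (measurableTypeR R).
Hypothesis xiF : feller_random_measure P (lebesgue_nonneg R) rho xi.
Local Notation leb := (@lebesgue_measure R).

(** A set of times of positive measure on which the second moment of [Y] is at
    most [N] meets some arbitrarily short cell in a set of positive measure, which
    contains a compact set [A] with [leb A > 0]. The second moment of the mass of
    [A] is at most [N * leb A ^ 2] by [density_second_moment_le], against a
    logarithmic factor in [compact_second_moment_ln]. *)
Lemma density_gt_half Y : density P xi Y -> square_integrable P Y -> 2^-1 < a.
Proof.
move=> xiY Y2; rewrite ltNge; apply/negP => a_le_half.
have [kappa [t0 [kappa_gt0 t0_gt0 clump]]] :=
  compact_second_moment_ln a_gt0 a_le1 a_le_half rhoML xiF.
pose e t := (\int[P]_w (Y t w ^+ 2)%:E)%E.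
have e_lty t : 0 <= t -> (e t < +oo)%E by move=> t_ge0; have := Y2 t t_ge0; rewrite unlock.
have me : measurable_fun (`[0, +oo[%classic : set R) e := measurable_density_second_moment xiY.
have sub12 : (`[1, 2]%classic : set R) `<=` `[0, +oo[.
  by move=> x; rewrite /= !in_itv/= andbT => /andP[x1 _]; exact: le_trans x1.
pose I12 : set R := `[1, 2]%classic.
have mI12 : measurable I12 by exact: measurable_itv.
pose L (N : nat) : set R := I12 `&` [set t | (e t <= N%:R%:E)%E].
have mL N : measurable (L N).
  apply: (emeasurable_fun_infty_c mI12).
  by apply: measurable_funS me => //; exact: measurable_itv.
have lebI12 : leb I12 = 1%E.
  rewrite /I12 lebesgue_measure_itv/= lte_fin ltrDl ltr01 -EFinB.
  by congr EFin; ring.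
have [N LN] : exists N, (0 < leb (I12 `&` L N))%E.
  apply: countable_cover_gt0 => //.
    move=> t t12; have t_ge0 : 0 <= t by have := sub12 t t12; rewrite /= in_itv/= andbT.
    have efin : e t \is a fin_num.
      rewrite ge0_fin_numE; first exact: e_lty.
      by apply: integral_ge0 => w _; rewrite lee_fin sqr_ge0.
    exists (Num.trunc (fine (e t))).+1 => //; split => //=.
    rewrite -[leLHS]fineK// lee_fin ltW// truncnS_gt//.
  by apply: (@lt_le_trans _ _ 1%E) => //; rewrite -lebI12.
(* Cells so short that [1 / (n + 1) < t0] and [kappa * ln (t0 * (n + 1)) > N]. *)
pose n := Num.trunc (Num.max t0^-1 (expR (N%:R / kappa) / t0)).
have n_gt : Num.max t0^-1 (expR (N%:R / kappa) / t0) < n.+1%:R.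
  by apply: truncnS_gt.
move: n_gt; rewrite gt_max => /andP[n_gt1 n_gt2].
pose delta : R := n.+1%:R^-1.
have [k Bk] : exists k : nat, (0 < leb ((I12 `&` L N) `&` @cell R n k%:Z))%E.
  apply: countable_cover_gt0 => //.
  - have mIL : measurable (I12 `&` L N) by exact: measurableI.
    exact: mIL.
  - by move=> k; exact: measurable_cell.
  - move=> t [t12 _]; have t_ge0 : 0 <= t by have := sub12 t t12; rewrite /= in_itv/= andbT.
    have : (0 <= cell_index n t)%R by rewrite /cell_index floor_ge0 mulr_ge0.
    case E : (cell_index n t) => [k|//] _; exists k => //; exact/cellP.
set B := (X in leb X) in Bk.
have mB : measurable B.
  apply: measurableI; last exact: measurable_cell.
  exact: measurableI.
have B12 : B `<=` `[1, 2] by move=> t [[]].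
have lebB : (leb B < +oo)%E.
  apply: (@le_lt_trans _ _ (leb I12)); first by apply: le_measure; rewrite ?inE//.
  by rewrite lebI12 ltry.
have lebBE : leb B = (fine (leb B))%:E by rewrite fineK// ge0_fin_numE.
have [A [cA AB lebBA]] : exists A : set R,
    [/\ compact A, A `<=` B & (leb (B `\` A) < (fine (leb B))%:E)%E].
  by apply: lebesgue_regularity_inner => //; rewrite -lte_fin -lebBE.
have mA : measurable A by exact: closed_measurable (compact_closed _ cA).
have lebA_lty : (leb A < +oo)%E by apply: le_lt_trans lebB; apply: le_measure; rewrite ?inE.
have lebA_gt0 : (0 < leb A)%E.
  rewrite lt0e measure_ge0 andbT; apply/eqP => lebA0.
  move: lebBA; rewrite -lebBE measureD// (setIidr AB).
  by move: (lebA0) => /= ->; rewrite sube0 ltxx.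
pose m := fine (leb A).
have m_gt0 : 0 < m by rewrite fine_gt0// lebA_gt0.
have A0 : A !=set0 by apply/set0P/eqP => A0; move: lebA_gt0; rewrite A0 measure0 ltxx.
have A12 : A `<=` `[1, 2] by move=> t /AB/B12.
have Acell : A `<=` `[(k%:R * delta), (k%:R * delta + delta)].
  move=> t /AB[_]; rewrite /cell/= !in_itv/= => /andP[h1 h2].
  rewrite h1/= ltW// (lt_le_trans h2)// intrD mulrDl div1r.
  exact: lexx.
have delta_itv : 0 < delta < t0.
  by rewrite invr_gt0 ltr0n/= -[t0]invrK ltf_pV2 ?posrE ?invr_gt0.
have lower := clump A _ _ cA A0 A12 Acell delta_itv.
have upper : (\int[P]_w (fine (xi w A) ^+ 2)%:E <= (N%:R * m ^+ 2)%:E)%E.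
  apply: (density_second_moment_le xiY mA lebA_lty) => //.
    by move=> t /A12/sub12.
  by move=> t /AB[[_ []]].
have := le_trans lower upper; rewrite lee_fin -/m; apply/negP; rewrite -ltNge.
rewrite mulrAC ltr_pM2r ?exprn_gt0// mulrC -ltr_pdivrMr//.
rewrite -[ltLHS]expRK ltr_ln ?posrE ?expR_gt0//; last first.
  by rewrite divr_gt0//; case/andP: delta_itv.
by rewrite /delta invrK -ltr_pdivrMl// mulrC.
Qed.

End no_density.

(** * The criterion *)

Unset Implicit Arguments.

Theorem corollary3p13 (R : realType) (alpha : R)
    (alpha_gt0 : 0 < alpha) (alpha_le1 : alpha <= 1)
    (rho : probability (measurableTypeR R) R)
    (rhoML : mittag_leffler alpha rho)
    (d : measure_display) (T : measurableType d) (P : probability T R)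
    (xi : R.-ker T ~> (measurableTypeR R))
    (xiF : feller_random_measure P (lebesgue_nonneg R) rho xi) :
  (exists Y : R -> T -> R, density P xi Y /\ square_integrable P Y) <->
  2^-1 < alpha.
Proof.
split=> [[Y [xiY Y2]]|alpha_gt_half].
  exact: (density_gt_half (Y := Y) alpha_gt0 alpha_le1 rhoML xiF).
exists (lower_density xi); split.
  exact: (density_lower_density alpha_gt0 alpha_le1 alpha_gt_half rhoML xiF).
exact: (square_integrable_lower_density alpha_gt0 alpha_le1 alpha_gt_half rhoML xiF).
Qed.
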